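(* Let $\lambda=(\lambda_1,\lambda_2,\lambda_3)\in\mathbb{R}^3$, $0<\varepsilon<\tfrac12$, $(\gamma_1,\gamma_2,\gamma_3)=(\lambda_1+\mathrm{i}\varepsilon,\lambda_2-\mathrm{i}\varepsilon,\lambda_3)$ and $0<\varkappa<\tfrac12$. Transformation of the left and right $\mathfrak{gl}_3(\mathbb{R})$-Whittaker vectors by the operators $\mathcal{B}_L,\mathcal{B}_R$ provides a direct identification of the integral forms $W_{GT}$ and $W_{GG}$ of the matrix element $\Psi_{\gamma_1,\gamma_2,\gamma_3}(e^{x_1},e^{x_2},e^{x_3})$ (the $\mathfrak{gl}_3(\mathbb{R})$-Whittaker function) arising via the Gelfand-Tsetlin and the modified Gauss-Givental realizations, respectively: for $x=(x_1,x_2,x_3)\in\mathbb{R}^3$, $$W_{GT}(x)=W_{GG}(x),$$ where $$W_{GT}(x)=e^{-\rho(x)}\langle\psi_L,e^{-\sum_i x_iE_{ii}}\psi_R\rangle_{GT}=e^{-\rho(x)}\int_{\mathbb{R}^3}d\tau\,\mu(\tau)\,\overline{\psi_L(\tau)}\,e^{-\sum_i x_iE_{ii}}\psi_R(\tau),\qquad \rho(x)=x_1-x_3,$$ and $$W_{GG}(x)=e^{-\rho(x)}\langle\hat\phi_L,e^{-\sum_i x_i\hat{\mathcal E}_{ii}}\hat\phi_R\rangle=\frac{e^{\mathrm{i}(\gamma_1x_1+\gamma_2x_2+\gamma_3x_3)-x_1+x_3}}{(2\pi)^3}\int_{\mathbb{R}^3}ds_{11}ds_{21}ds_{22}\,e^{\mathrm{i}s_{21}(x_1-x_2)+\mathrm{i}s_{11}(x_1-x_3)+\mathrm{i}s_{22}(x_2-x_3)}$$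 $$\times\,\Gamma(\tfrac12-\mathrm{i}s_{21})\,\Gamma(\tfrac12-\mathrm{i}s_{11})\,\Gamma(1-\mathrm{i}s_{11}-\mathrm{i}s_{22})\,\Gamma\big(-\mathrm{i}(\gamma_1-\gamma_3+s_{11}+s_{21})+1\big)$$ $$\times\,\Gamma\big(-\mathrm{i}(\gamma_2-\gamma_3+s_{22})+\tfrac12\big)\,\Gamma\big(-\mathrm{i}(\gamma_1-\gamma_2+s_{11})+\tfrac12\big).$$
   Context: $\mathrm{i}=\sqrt{-1}$, bars denote complex conjugation, $\tau=(\tau_{11},\tau_{21},\tau_{22})$, $s=(s_{11},s_{21},s_{22})$. Gelfand-Tsetlin realization. The Cartan generators act by multiplication by $E_{11}=-\mathrm{i}\tau_{11}$, $E_{22}=-\mathrm{i}(\tau_{21}+\tau_{22})+\mathrm{i}\tau_{11}$, $E_{33}=-\mathrm{i}(\gamma_1+\gamma_2+\gamma_3)+\mathrm{i}(\tau_{21}+\tau_{22})$. The Whittaker vectors are $\psi_L(\tau)=e^{-\frac{\pi}{2}(\tau_{11}+\tau_{21}+\tau_{22})}$ and $$\psi_R(\tau)=e^{\frac{\pi}{2}(\tau_{11}-\tau_{21}-\tau_{22})}\prod_{j=1}^2\Gamma\big(\mathrm{i}(\tau_{2,j}-\tau_{11})+\tfrac12\big)\prod_{i=1}^3\prod_{j=1}^2\Gamma\big(\mathrm{i}(\gamma_i-\tau_{2,j})+\tfrac12\big),\qquad \tau_{2,1}=\tau_{21},\ \tau_{2,2}=\tau_{22}.$$ The measure is $$\mu(\tau)=\frac{1}{(2\pi)^3}\frac{e^{\pi(\tau_{21}+\tau_{22})}}{\Gamma(\mathrm{i}\tau_{21}-\mathrm{i}\tau_{22})\,\Gamma(\mathrm{i}\tau_{22}-\mathrm{i}\tau_{21})},\qquad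 \langle\psi_1,\psi_2\rangle_{GT}=\int_{\mathbb{R}^3}d\tau\,\mu(\tau)\,\overline{\psi_1(\tau)}\,\psi_2(\tau).$$ Modified Gauss-Givental realization. The Cartan generators act by multiplication by $\hat{\mathcal E}_{11}=-\mathrm{i}(\gamma_1+s_{11}+s_{21})$, $\hat{\mathcal E}_{22}=\mathrm{i}(-\gamma_2+s_{21}-s_{22})$, $\hat{\mathcal E}_{33}=\mathrm{i}(-\gamma_3+s_{11}+s_{22})$; the pairing $\langle\phi_1,\phi_2\rangle=\int_{\mathbb{R}^3}ds\,\overline{\phi_1(s)}\phi_2(s)$ is the standard $L^2$-pairing; the Whittaker vectors are $$\hat\phi_L(s)=\frac{1}{(2\pi)^{3/2}}\Gamma\big(\mathrm{i}(\bar\gamma_1-\bar\gamma_2+s_{11})+\tfrac12\big)\Gamma\big(\mathrm{i}(\bar\gamma_2-\bar\gamma_3+s_{22})+\tfrac12\big)\Gamma\big(\mathrm{i}(\bar\gamma_1-\bar\gamma_3+s_{11}+s_{21})+1\big),$$ $$\hat\phi_R(s)=\frac{1}{(2\pi)^{3/2}}\Gamma(\tfrac12-\mathrm{i}s_{21})\,\Gamma(\tfrac12-\mathrm{i}s_{11})\,\Gamma(1-\mathrm{i}s_{11}-\mathrm{i}s_{22}).$$ Operators. $\mathcal{B}_R$ and $\mathcal{B}_L$ act by $(\mathcal{B}\phi)(\tau)=\int_{\mathbb{R}^3}ds\,B(\tau;s)\phi(s)$ with kernels $$B_R(\tau;s)=\frac{1}{2\pi}\frac{e^{\frac{\pi(\tau_{11}-\mathrm{i}\varkappa)}{2}}}{\Gamma(\mathrm{i}\tau_{21}-\mathrm{i}\tau_{22})}\frac{\Gamma(\mathrm{i}(\gamma_2-\gamma_1-s_{11})+\frac12)}{\Gamma(-\mathrm{i}s_{21}+\frac12)}\prod_{j=1}^2\Gamma\big(\mathrm{i}(\tau_{11}-\tau_{2,j}-s_{21})+\varkappa\big)\Gamma\big(\mathrm{i}(\tau_{2,j}-\tau_{11})-\varkappa+\tfrac12\big)\Gamma\big(\mathrm{i}(\gamma_3-\tau_{2,j})+\tfrac12\big)$$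 $$\times\,\delta(\gamma_1+s_{11}+s_{21}-\tau_{11}+\mathrm{i}\varkappa)\,\delta(\gamma_1+\gamma_2+s_{11}+s_{22}-\tau_{21}-\tau_{22}),$$ $$B_L(\tau;s)=\frac{1}{2\pi}\frac{e^{-\frac{\pi(\tau_{11}-\mathrm{i}\varkappa)}{2}}}{\Gamma(\mathrm{i}\tau_{21}-\mathrm{i}\tau_{22})}\frac{\Gamma(\mathrm{i}s_{21}+\frac12)}{\Gamma(\mathrm{i}(\bar\gamma_1-\bar\gamma_2+s_{11})+\frac12)}\prod_{j=1}^2\frac{\Gamma(\mathrm{i}(\tau_{11}-\tau_{2,j}-s_{21})+\varkappa)}{\Gamma(\mathrm{i}(\tau_{11}-\tau_{2,j})+\varkappa+\frac12)\,\Gamma(\mathrm{i}(\tau_{2,j}-\gamma_3)+\frac12)}$$ $$\times\,\delta(\bar\gamma_1+s_{11}+s_{21}-\tau_{11}+\mathrm{i}\varkappa)\,\delta(\bar\gamma_1+\bar\gamma_2+s_{11}+s_{22}-\tau_{21}-\tau_{22}).$$ The delta-function of complex argument is defined by $\int_{\mathbb{R}}dy\,\delta(y-t+\mathrm{i}c)\phi(y)=\phi(t-\mathrm{i}c)$ on Schwartz functions $\phi$ allowing analytic continuation into the strip bounded by $\mathbb{R}$ and $\mathbb{R}-\mathrm{i}c$.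
   Formalization: The Gelfand–Tsetlin pairing is given an extra factor 1/2!, since with the stated measure W_GT = 2 W_GG; the transformation formula for B_R is stated only for ϰ+ε<1/2, where the complex delta rule applies to the right Whittaker vector. *)

(* Defs.v *)
From HB Require Import structures.
From mathcomp Require Import all_boot all_order all_algebra.
From mathcomp Require Import all_classical all_reals all_analysis.
From mathcomp Require Import complex.

Set Implicit Arguments.
Unset Strict Implicit.
Unset Printing Implicit Defensive.

Import Order.TTheory GRing.Theory Num.Theory.
Import numFieldNormedType.Exports.

Local Open Scope classical_set_scope.
Local Open Scope ring_scope.
Local Open Scope complex_scope.

Local Notation Re := complex.Re.
Local Notation Im := complex.Im.

(* Functions on R^3 are written as functions of three complex variables, since
   the operators below evaluate their analytic continuations, and are restricted
   to real arguments in the integrals over R^3. *)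
Definition fun3 (R : realType) : Type := R[i] -> R[i] -> R[i] -> R[i].

Section ComplexAnalysis.
Context {R : realType}.

Definition cexp (z : R[i]) : R[i] :=
  (expR (Re z))%:C * (cos (Im z) +i* sin (Im z)).

Section Integral.
Context {d : measure_display} {T : measurableType d}.
Variables (mu : {measure set T -> \bar R}) (D : set T).

Definition cintegrable (f : T -> R[i]) : Prop :=
  mu.-integrable D (EFin \o (fun t => Re (f t))) /\
  mu.-integrable D (EFin \o (fun t => Im (f t))).

Definition cintegral (f : T -> R[i]) : R[i] :=
  (\int[mu]_(t in D) Re (f t)) +i* (\int[mu]_(t in D) Im (f t)).

End Integral.

(* Euler's integral, which converges for 0 < Re z. *)
Definition Gamma_euler (z : R[i]) : R[i] :=
  cintegral lebesgue_measure `]0, +oo[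
    (fun t : R => cexp ((z - 1) * (ln t)%:C) * (expR (- t))%:C).

(* Meromorphic continuation by the functional equation
   Gamma z = Gamma (z + n) / (z (z + 1) ... (z + n - 1)), where n is the least
   natural number with 0 < Re z + n. At a pole a factor of the denominator
   vanishes, so Gamma = 0 there and (Gamma z)^-1 is the entire function
   1 / Gamma at every z. *)
Definition Gamma (z : R[i]) : R[i] :=
  let n := if 0 < Re z then 0%N else (Num.truncn (- Re z)).+1 in
  Gamma_euler (z + n%:R) / \prod_(k < n) (z + k%:R).


Definition lebesgue3 := ((@lebesgue_measure R \x @lebesgue_measure R)
                           \x @lebesgue_measure R)%E.

Definition on_R3 (f : fun3 R) (u : R * R * R) : R[i] :=
  f (u.1.1)%:C (u.1.2)%:C (u.2)%:C.

Definition integral3 (f : fun3 R) : R[i] := cintegral lebesgue3 setT (on_R3 f).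

Definition integrable3 (f : fun3 R) : Prop := cintegrable lebesgue3 setT (on_R3 f).

End ComplexAnalysis.

Section Whittaker.
Context {R : realType}.
Variables g1 g2 g3 : R[i].


Local Notation pi' := (pi%:C : R[i]).

(** Gelfand-Tsetlin realization; the coordinates are t11, t21, t22. *)

Definition E11 : fun3 R := fun t11 t21 t22 => - 'i * t11.
Definition E22 : fun3 R := fun t11 t21 t22 => - 'i * (t21 + t22) + 'i * t11.
Definition E33 : fun3 R :=
  fun t11 t21 t22 => - 'i * (g1 + g2 + g3) + 'i * (t21 + t22).

Definition torus_GT (x1 x2 x3 : R) (psi : fun3 R) : fun3 R := fun t11 t21 t22 =>
  cexp (- (x1%:C * E11 t11 t21 t22 + x2%:C * E22 t11 t21 t22
           + x3%:C * E33 t11 t21 t22)) * psi t11 t21 t22.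

Definition psiL : fun3 R := fun t11 t21 t22 =>
  cexp (- (pi' / 2) * (t11 + t21 + t22)).

Definition psiR : fun3 R := fun t11 t21 t22 =>
  cexp (pi' / 2 * (t11 - t21 - t22))
  * \prod_(t <- [:: t21; t22]) Gamma ('i * (t - t11) + 2^-1)
  * \prod_(g <- [:: g1; g2; g3]) \prod_(t <- [:: t21; t22])
      Gamma ('i * (g - t) + 2^-1).

Definition mu_GT : fun3 R := fun t11 t21 t22 =>
  ((2 * pi') ^+ 3)^-1 *
  (cexp (pi' * (t21 + t22))
   / (Gamma ('i * t21 - 'i * t22) * Gamma ('i * t22 - 'i * t21))).

Definition integrand_GT (psi1 psi2 : fun3 R) : fun3 R := fun t11 t21 t22 =>
  mu_GT t11 t21 t22 * conjc (psi1 t11 t21 t22) * psi2 t11 t21 t22.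

(* The factor 1/2! is the Weyl group factor of the symmetry t21 <-> t22: the
   integral over R^3 counts each unordered pair {t21, t22} twice. It is absent
   from the source, where the pairing is the plain integral over R^3 against
   mu_GT; with that normalization the Gelfand-Tsetlin integral is exactly twice
   the Gauss-Givental one. For a fixed Fourier mode (p, q) dual to
   (x1 - x2, x2 - x3), the t-integral is the de Branges-Wilson integral
     int_R (prod_k Gamma(a_k + it) Gamma(a_k - it)) / |Gamma(2it)|^2 dt
       = 4 pi prod_(j<k) Gamma(a_j + a_k) / Gamma(a_0 + a_1 + a_2 + a_3)
   and the s-integral is Barnes' first lemma, which has 2 pi in place of 4 pi
   and the same product of Gamma functions. *)
Definition pairing_GT (psi1 psi2 : fun3 R) : R[i] :=
  (2`!)%:R^-1 * integral3 (integrand_GT psi1 psi2).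

Definition rho (x1 x2 x3 : R) : R := x1 - x3.

Definition W_GT (x1 x2 x3 : R) : R[i] :=
  cexp (- (rho x1 x2 x3)%:C) * pairing_GT psiL (torus_GT x1 x2 x3 psiR).

(** Modified Gauss-Givental realization; the coordinates are s11, s21, s22. *)

Definition Eh11 : fun3 R := fun s11 s21 s22 => - 'i * (g1 + s11 + s21).
Definition Eh22 : fun3 R := fun s11 s21 s22 => 'i * (- g2 + s21 - s22).
Definition Eh33 : fun3 R := fun s11 s21 s22 => 'i * (- g3 + s11 + s22).

Definition torus_GG (x1 x2 x3 : R) (phi : fun3 R) : fun3 R := fun s11 s21 s22 =>
  cexp (- (x1%:C * Eh11 s11 s21 s22 + x2%:C * Eh22 s11 s21 s22
           + x3%:C * Eh33 s11 s21 s22)) * phi s11 s21 s22.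

Definition norm_GG : R[i] := (((2 * pi : R) `^ (3 / 2))^-1)%:C.

Definition phiL : fun3 R := fun s11 s21 s22 =>
  norm_GG * Gamma ('i * (conjc g1 - conjc g2 + s11) + 2^-1)
  * Gamma ('i * (conjc g2 - conjc g3 + s22) + 2^-1)
  * Gamma ('i * (conjc g1 - conjc g3 + s11 + s21) + 1).

Definition phiR : fun3 R := fun s11 s21 s22 =>
  norm_GG * Gamma (2^-1 - 'i * s21) * Gamma (2^-1 - 'i * s11)
  * Gamma (1 - 'i * s11 - 'i * s22).

Definition integrand_GG (phi1 phi2 : fun3 R) : fun3 R := fun s11 s21 s22 =>
  conjc (phi1 s11 s21 s22) * phi2 s11 s21 s22.

Definition pairing_GG (phi1 phi2 : fun3 R) : R[i] :=
  integral3 (integrand_GG phi1 phi2).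

Definition W_GG (x1 x2 x3 : R) : R[i] :=
  cexp (- (rho x1 x2 x3)%:C) * pairing_GG phiL (torus_GG x1 x2 x3 phiR).

Definition W_GG_explicit (x1 x2 x3 : R) : R[i] :=
  cexp ('i * (g1 * x1%:C + g2 * x2%:C + g3 * x3%:C) - x1%:C + x3%:C)
  / (2 * pi') ^+ 3
  * integral3 (fun s11 s21 s22 =>
      cexp ('i * s21 * (x1 - x2)%:C + 'i * s11 * (x1 - x3)%:C
            + 'i * s22 * (x2 - x3)%:C)
      * Gamma (2^-1 - 'i * s21) * Gamma (2^-1 - 'i * s11)
      * Gamma (1 - 'i * s11 - 'i * s22)
      * Gamma (- 'i * (g1 - g3 + s11 + s21) + 1)
      * Gamma (- 'i * (g2 - g3 + s22) + 2^-1)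
      * Gamma (- 'i * (g1 - g2 + s11) + 2^-1)).

(* int dy delta (y - t + i c) phi(y) = phi (t - i c): the delta-function of
   complex argument evaluates the analytic continuation of phi at w = t - i c. *)
Definition delta_integral (w : R[i]) (phi : R[i] -> R[i]) : R[i] := phi w.

(* Integral over s = (s11, s21, s22) of
     K(t; s) delta(h1 + s11 + s21 - t11 + i kappa)
             delta(h1 + h2 + s11 + s22 - t21 - t22) phi(s);
   the first delta-function is integrated in s11, the second one in s22. *)
Definition apply_kernel (h1 h2 : R[i]) (kappa : R) (K : R[i] -> R[i] -> R[i] -> fun3 R)
    (phi : fun3 R) : fun3 R := fun t11 t21 t22 =>
  cintegral lebesgue_measure setT (fun s : R => let s21 := s%:C in
    delta_integral (t11 - 'i * kappa%:C - h1 - s21) (fun s11 =>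
      delta_integral (t21 + t22 - h1 - h2 - s11) (fun s22 =>
        K t11 t21 t22 s11 s21 s22 * phi s11 s21 s22))).

Definition kernel_R (kappa : R) (t11 t21 t22 : R[i]) : fun3 R := fun s11 s21 s22 =>
  (2 * pi')^-1
  * (cexp (pi' * (t11 - 'i * kappa%:C) / 2) / Gamma ('i * t21 - 'i * t22))
  * (Gamma ('i * (g2 - g1 - s11) + 2^-1) / Gamma (- 'i * s21 + 2^-1))
  * \prod_(t <- [:: t21; t22])
      (Gamma ('i * (t11 - t - s21) + kappa%:C)
       * Gamma ('i * (t - t11) - kappa%:C + 2^-1)
       * Gamma ('i * (g3 - t) + 2^-1)).

Definition kernel_L (kappa : R) (t11 t21 t22 : R[i]) : fun3 R := fun s11 s21 s22 =>
  (2 * pi')^-1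
  * (cexp (- (pi' * (t11 - 'i * kappa%:C) / 2)) / Gamma ('i * t21 - 'i * t22))
  * (Gamma ('i * s21 + 2^-1) / Gamma ('i * (conjc g1 - conjc g2 + s11) + 2^-1))
  * \prod_(t <- [:: t21; t22])
      (Gamma ('i * (t11 - t - s21) + kappa%:C)
       / (Gamma ('i * (t11 - t) + kappa%:C + 2^-1)
          * Gamma ('i * (t - g3) + 2^-1))).

Definition B_R (kappa : R) : fun3 R -> fun3 R :=
  apply_kernel g1 g2 kappa (kernel_R kappa).

Definition B_L (kappa : R) : fun3 R -> fun3 R :=
  apply_kernel (conjc g1) (conjc g2) kappa (kernel_L kappa).

(* A square root of mu_GT: `|half_density|^2 = mu_GT on R^3. *)
Definition half_density : fun3 R := fun t11 t21 t22 =>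
  norm_GG * cexp (pi' / 2 * (t21 + t22)) / Gamma ('i * t21 - 'i * t22).

End Whittaker.

(* Main.v *)
(** Fix the Fourier mode (p, q) dual to (x1 - x2, x2 - x3).  On the
    Gelfand-Tsetlin side, t11 = p, t21 + t22 = q, and the remaining integral over
    t21 - t22 is a de Branges-Wilson integral.  On the Gauss-Givental side, s21 is
    moved to s21 - i eps, which makes p = gamma1 + s11 + s21 real, as is
    q = gamma1 + gamma2 + s11 + s22; the remaining integral over s11 is Barnes'
    first lemma.  Both evaluate to the same quotient of Gamma functions, up to the
    factor 2 of the Weyl group.  The transformation of each Whittaker vector by B_R
    or B_L is Barnes' first lemma too, in the variable s21.

    All Gamma integrals are obtained without contour integration.  In the variable
    u = ln t, Gamma (a + i s) is a Fourier transform of exp (a u - exp u), and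
    Gamma s * w ^ (- s) is Euler's integral with the weight exp (- w exp u), by
    differentiation along the path w ^ t.  Integrating powers of w1 + w2 exp u gives
    the beta integral; Fourier inversion and Parseval then give Barnes' lemma.
    Rotating the beta integral to the negative axis produces a Poisson kernel and
    in the limit the reflection formula, hence the density
    1 / (Gamma (i y) Gamma (- i y)) = y sinh (pi y) / pi and the nonvanishing of
    Gamma.  The Wilson integral is Parseval for two beta integrals with parameter
    w = 2 cosh v + 2 i sinh u, the weight sinh being absorbed by the growth of the
    rotated integrals. *)

From HB Require Import structures.
Require Import Defs.
From mathcomp Require Import all_boot all_order all_algebra.
From mathcomp Require Import all_classical all_reals all_analysis.
From mathcomp Require Import measurable_realfun.
From mathcomp Require Import complex ring lra.

Set Implicit Arguments.
Unset Strict Implicit.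
Unset Printing Implicit Defensive.

Import Order.TTheory GRing.Theory Num.Theory.
Import numFieldNormedType.Exports.

Local Open Scope classical_set_scope.
Local Open Scope ring_scope.
Local Open Scope complex_scope.

Local Notation Re := (@complex.Re _).
Local Notation Im := (@complex.Im _).

(** * Complex-valued functions and integrals *)

(** The eight Gamma factors of Wilson's integral decay together almost like exp (- 4 pi |t|), while
    its density grows like |t| exp (2 pi |t|). Parseval for unrotated beta integrals would give the
    integral without the density. By evenness in t only t exp (2 pi t) has to be inserted. The
    exponential is shared by the four beta integrals, exp (pi t / 2) each, and this fixes the angle:
    the parameters exp (i pi / 4) and exp (- i pi / 4) still have positive real part. The factor t
    comes from comparing the parameters c and c + 1, since (c + i t) - (c - i t) = 2 i t; on the
    other side of Parseval the same comparison yields cosh u, the Jacobian of the substitution by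
    sinh u. Every interchange of integrals rests on explicit exponential bounds. Gamma decays on
    vertical lines at each rate below pi / 2; the rate 3 pi / 8 is close enough to pi / 2 for the
    Gamma factors to beat the density, both in Wilson's integral and in the Gelfand-Tsetlin
    integrand, where decay in t11 is available only through t11 - t21 and t11 - t22. *)

Section ComplexBasics.
Context {R : realType}.
Implicit Types (z w : R[i]) (x y : R).

Lemma cReD z w : Re (z + w) = Re z + Re w. Proof. by rewrite raddfD. Qed.
Lemma cImD z w : Im (z + w) = Im z + Im w. Proof. by rewrite raddfD. Qed.
Lemma cReN z : Re (- z) = - Re z. Proof. by rewrite raddfN. Qed.
Lemma cImN z : Im (- z) = - Im z. Proof. by rewrite raddfN. Qed.
Lemma cReM z w : Re (z * w) = Re z * Re w - Im z * Im w.
Proof. by case: z w => [a b] [c d]. Qed.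
Lemma cImM z w : Im (z * w) = Re z * Im w + Im z * Re w.
Proof. by case: z w => [a b] [c d] /=. Qed.
Lemma cReZ x z : Re (x%:C * z) = x * Re z.
Proof. by rewrite cReM /= mul0r subr0. Qed.
Lemma cImZ x z : Im (x%:C * z) = x * Im z.
Proof. by rewrite cImM /= mul0r addr0. Qed.

Lemma complex_ext z w : Re z = Re w -> Im z = Im w -> z = w.
Proof. by case: z w => [a b] [c d] /= -> ->. Qed.

Definition reimE := (cReD, cImD, cReN, cImN, cReZ, cImZ, cReM, cImM).

Lemma normc_ge0 z : 0 <= Normc.normc z.
Proof. by case: z => a b; rewrite /Normc.normc sqrtr_ge0. Qed.

Lemma le_Re_normc z : `|Re z| <= Normc.normc z.
Proof.
case: z => a b /=; rewrite -sqrtr_sqr ler_wsqrtr// lerDl; exact: sqr_ge0.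
Qed.

Lemma le_Im_normc z : `|Im z| <= Normc.normc z.
Proof.
case: z => a b /=; rewrite -sqrtr_sqr ler_wsqrtr// lerDr; exact: sqr_ge0.
Qed.

Lemma normc_le_ReIm z : Normc.normc z <= `|Re z| + `|Im z|.
Proof.
case: z => a b /=; rewrite -[leRHS]ger0_norm ?addr_ge0//.
rewrite -sqrtr_sqr ler_wsqrtr// sqrrD !real_normK ?num_real//.
by rewrite lerD2r lerDl mulrn_wge0// mulr_ge0.
Qed.

Lemma normcR x : Normc.normc x%:C = `|x|.
Proof. by rewrite /= expr0n/= addr0 sqrtr_sqr. Qed.

Lemma normcZ x z : Normc.normc (x%:C * z) = `|x| * Normc.normc z.
Proof. by rewrite Normc.normcM normcR. Qed.

Lemma cexpD z w : cexp (z + w) = cexp z * cexp w.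
Proof.
by apply: complex_ext; rewrite /cexp !reimE /= expRD ?cosD ?sinD; ring.
Qed.

Lemma Re_cexp z : Re (cexp z) = expR (Re z) * cos (Im z).
Proof. by rewrite /cexp cReZ. Qed.
Lemma Im_cexp z : Im (cexp z) = expR (Re z) * sin (Im z).
Proof. by rewrite /cexp cImZ. Qed.

Lemma cexp0 : cexp 0 = 1 :> R[i].
Proof. by apply: complex_ext; rewrite /cexp !reimE /= expR0 ?cos0 ?sin0 mul1r. Qed.

Lemma normc_cexp z : Normc.normc (cexp z) = expR (Re z).
Proof.
rewrite /cexp normcZ gtr0_norm ?expR_gt0//= cos2Dsin2 sqrtr1 mulr1//.
Qed.

Lemma cexp_neq0 z : cexp z != 0.
Proof.
apply/eqP => h; have := normc_cexp z; rewrite h Normc.normc0 => /eqP.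
by rewrite lt_eqF ?expR_gt0.
Qed.

Lemma cexpN z : cexp (- z) = (cexp z)^-1.
Proof.
apply: (mulfI (cexp_neq0 z)); rewrite -cexpD subrr cexp0 divff//.
exact: cexp_neq0.
Qed.

Lemma cexpR x : cexp x%:C = (expR x)%:C.
Proof. by apply: complex_ext; rewrite /cexp !reimE /= ?cos0 ?sin0; ring. Qed.

Lemma cexp_conj z : cexp (conjc z) = conjc (cexp z).
Proof.
by case: z => a b; apply: complex_ext; rewrite /cexp /= ?cosN ?sinN; ring.
Qed.

Lemma ii_m1 : 'i * 'i = -1 :> R[i].
Proof. by rewrite -expr2 sqr_i. Qed.

End ComplexBasics.

Section CMeasurable.
Context {R : realType} {d : measure_display} {T : measurableType d}.
Implicit Types (f g : T -> R[i]) (r : T -> R).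

Definition cmeas f : Prop :=
  measurable_fun setT (Re \o f) /\ measurable_fun setT (Im \o f).

Lemma cmeas_cst c : cmeas (fun=> c).
Proof. by split; exact: measurable_cst. Qed.

Lemma cmeasR r : measurable_fun setT r -> cmeas (fun t => (r t)%:C).
Proof. by move=> mr; split => //; exact: measurable_cst. Qed.

Lemma cmeasD f g : cmeas f -> cmeas g -> cmeas (fun t => f t + g t).
Proof.
move=> [f1 f2] [g1 g2]; split.
  by rewrite (_ : _ \o _ = (fun t => Re (f t) + Re (g t)));
    [exact: measurable_funD|apply/funext => t /=; rewrite cReD].
by rewrite (_ : _ \o _ = (fun t => Im (f t) + Im (g t)));
    [exact: measurable_funD|apply/funext => t /=; rewrite cImD].
Qed.

Lemma cmeasN f : cmeas f -> cmeas (fun t => - f t).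
Proof.
move=> [f1 f2]; split.
  by rewrite (_ : _ \o _ = (fun t => - (Re (f t))));
    [exact: measurableT_comp|apply/funext => t /=; rewrite cReN].
by rewrite (_ : _ \o _ = (fun t => - (Im (f t))));
    [exact: measurableT_comp|apply/funext => t /=; rewrite cImN].
Qed.

Lemma cmeasM f g : cmeas f -> cmeas g -> cmeas (fun t => f t * g t).
Proof.
move=> [f1 f2] [g1 g2]; split.
  rewrite (_ : _ \o _ = (fun t => Re (f t) * Re (g t) - Im (f t) * Im (g t)));
    last by apply/funext => t /=; rewrite cReM.
  by apply: measurable_funB; exact: measurable_funM.
rewrite (_ : _ \o _ = (fun t => Re (f t) * Im (g t) + Im (f t) * Re (g t)));
    last by apply/funext => t /=; rewrite cImM.
by apply: measurable_funD; exact: measurable_funM.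
Qed.

Lemma cmeas_Re f : cmeas f -> measurable_fun setT (fun t => Re (f t)).
Proof. by case. Qed.

Lemma cmeas_Im f : cmeas f -> measurable_fun setT (fun t => Im (f t)).
Proof. by case. Qed.

Lemma cmeas_cexp f : cmeas f -> cmeas (fun t => cexp (f t)).
Proof.
move=> [f1 f2]; apply: cmeasM.
  by apply: cmeasR; apply: measurableT_comp => //; exact: f1.
split => /=; [rewrite (_ : _ \o _ = (fun t => cos (Im (f t))))|
  rewrite (_ : _ \o _ = (fun t => sin (Im (f t))))] => //;
  apply: measurableT_comp f2 => //;
  apply: continuous_measurable_fun; [exact: continuous_cos|exact: continuous_sin].
Qed.

Lemma cmeas_ext f g : f =1 g -> cmeas f -> cmeas g.
Proof. by move=> /funext ->. Qed.

Lemma cmeas_normc f : cmeas f -> measurable_fun setT (fun t => Normc.normc (f t)).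
Proof.
move=> [f1 f2].
rewrite (_ : (fun t => _) = (fun t => Num.sqrt (Re (f t) ^+ 2 + Im (f t) ^+ 2))); last first.
  by apply/funext => t; case: (f t).
apply: measurableT_comp.
  by apply: continuous_measurable_fun; exact: sqrt_continuous.
by apply: measurable_funD; apply: measurable_funX.
Qed.

End CMeasurable.

Lemma cmeas_comp {R : realType} d1 d2 (T1 : measurableType d1) (T2 : measurableType d2)
  (f : T2 -> R[i]) (h : T1 -> T2) : cmeas f -> measurable_fun setT h ->
  cmeas (fun t => f (h t)).
Proof.
move=> [f1 f2] mh; split.
  exact: (measurableT_comp f1 mh).
exact: (measurableT_comp f2 mh).
Qed.

Section CIntegral.
Context {R : realType} {d : measure_display} {T : measurableType d}.
Variable mu : {measure set T -> \bar R}.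
Implicit Types (f g : T -> R[i]).

Local Notation int f := (cintegral mu setT f).
Local Notation intble f := (cintegrable mu setT f).

Lemma cintegrable_meas f : intble f -> cmeas f.
Proof.
by move=> [i1 i2]; split; apply/measurable_EFinP; exact: measurable_int i1 || exact: measurable_int i2.
Qed.

Lemma eq_cintegral f g : f =1 g -> int f = int g.
Proof. by move=> /funext ->. Qed.

Lemma cintegrable_bound f (g : T -> R) : cmeas f ->
  mu.-integrable setT (EFin \o g) -> (forall t, Normc.normc (f t) <= g t) ->
  intble f.
Proof.
move=> [f1 f2] ig fg; split.
  apply: (le_integrable _ _ _ ig) => //; first exact/measurable_EFinP.
  by move=> t _ /=; rewrite lee_fin (le_trans (le_Re_normc _))// (le_trans (fg t))// ler_norm.
apply: (le_integrable _ _ _ ig) => //; first exact/measurable_EFinP.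
by move=> t _ /=; rewrite lee_fin (le_trans (le_Im_normc _))// (le_trans (fg t))// ler_norm.
Qed.

Lemma cintegrable_normc f : intble f ->
  mu.-integrable setT (EFin \o (fun t => Normc.normc (f t))).
Proof.
move=> fi; have [i1 i2] := fi; have := cintegrable_meas fi => mf.
have := integrableD measurableT (integrable_abse i1) (integrable_abse i2).
apply: le_integrable => //; first by apply/measurable_EFinP; exact: cmeas_normc.
move=> t _ /=; rewrite lee_fin (ger0_norm (normc_ge0 _)) (le_trans (normc_le_ReIm _))//.
exact: ler_norm.
Qed.

Lemma cintegrableD f g : intble f -> intble g -> intble (fun t => f t + g t).
Proof.
move=> [f1 f2] [g1 g2]; split.
  have := integrableD measurableT f1 g1; apply: eq_integrable => // t _ /=.
  by rewrite cReD.
have := integrableD measurableT f2 g2; apply: eq_integrable => // t _ /=.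
by rewrite cImD.
Qed.

Lemma cintegralD f g : intble f -> intble g ->
  int (fun t => f t + g t) = int f + int g.
Proof.
move=> [f1 f2] [g1 g2]; apply: complex_ext; rewrite /cintegral /=.
  by under eq_Rintegral do rewrite cReD; exact: RintegralD.
by under eq_Rintegral do rewrite cImD; exact: RintegralD.
Qed.

Lemma cintegrableZ (c : R[i]) f : intble f -> intble (fun t => c * f t).
Proof.
move=> fi.
have ig := integrableZl measurableT (Normc.normc c) (cintegrable_normc fi).
apply: (@cintegrable_bound _ (fun t => Normc.normc c * Normc.normc (f t))) => //.
  by apply: cmeasM; [exact: cmeas_cst|exact: cintegrable_meas].
by move=> t; rewrite Normc.normcM.
Qed.

Lemma cintegralZ (c : R[i]) f : intble f -> int (fun t => c * f t) = c * int f.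
Proof.
move=> [f1 f2]; rewrite /cintegral; apply: complex_ext; rewrite ?reimE /=.
  under eq_Rintegral do rewrite cReM.
  rewrite RintegralB//; last 2 first.
    exact: (integrableZl measurableT (Re c) f1).
    exact: (integrableZl measurableT (Im c) f2).
  by rewrite !RintegralZl.
under eq_Rintegral do rewrite cImM.
rewrite RintegralD//; last 2 first.
  exact: (integrableZl measurableT (Re c) f2).
  exact: (integrableZl measurableT (Im c) f1).
by rewrite !RintegralZl.
Qed.

Lemma cintegralZr (c : R[i]) f : intble f -> int (fun t => f t * c) = int f * c.
Proof.
by move=> fi; rewrite mulrC -cintegralZ//; apply: eq_cintegral => t; rewrite mulrC.
Qed.

Lemma cintegralN f : intble f -> int (fun t => - f t) = - int f.
Proof.
move=> fi; rewrite -mulN1r -cintegralZ//.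
by apply: eq_cintegral => t; rewrite mulN1r.
Qed.

Lemma cintegrableN f : intble f -> intble (fun t => - f t).
Proof.
move=> /(cintegrableZ (-1)); rewrite (_ : (fun t => _) = (fun t => - f t))//.
by apply/funext => t; rewrite mulN1r.
Qed.

Lemma cintegralB f g : intble f -> intble g ->
  int (fun t => f t - g t) = int f - int g.
Proof.
by move=> fi gi; rewrite cintegralD ?cintegralN//; exact: cintegrableN.
Qed.

(** The factor 2 is the price of estimating the real and the imaginary part separately; it reappears
    in [ED2_int], [ED3_int] and [Gamma_decay]. *)
Lemma normc_cintegral_le f (g : T -> R) : cmeas f ->
  mu.-integrable setT (EFin \o g) -> (forall t, Normc.normc (f t) <= g t) ->
  Normc.normc (int f) <= 2 * (\int[mu]_t g t)%R.
Proof.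
move=> mf ig fg; have [i1 i2] := cintegrable_bound mf ig fg.
apply: (le_trans (normc_le_ReIm _)); rewrite mulr_natl mulr2n /cintegral /=.
apply: lerD.
  apply: (le_trans (le_normr_Rintegral measurableT i1)).
  apply: le_Rintegral => //; first exact: (integrable_norm i1).
  by move=> t _; exact: (le_trans (le_Re_normc _)).
apply: (le_trans (le_normr_Rintegral measurableT i2)).
apply: le_Rintegral => //; first exact: (integrable_norm i2).
by move=> t _; exact: (le_trans (le_Im_normc _)).
Qed.

Definition ccvg (u : nat -> R[i]) (l : R[i]) : Prop :=
  Re (u n) @[n --> \oo] --> Re l /\ Im (u n) @[n --> \oo] --> Im l.

Lemma ccvg_unique u l l' : ccvg u l -> ccvg u l' -> l = l'.
Proof.
move=> [a b] [a' b']; apply: complex_ext.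
  exact: (cvg_unique _ a a').
exact: (cvg_unique _ b b').
Qed.

(** Measurability and domination of the limit [f] are inherited from the sequence, so only the
    [f_ n] have to be controlled. The real theorem is applied to each component. *)
Lemma cdominated (f_ : nat -> T -> R[i]) f (g : T -> R) :
  (forall n, cmeas (f_ n)) -> (forall t, ccvg (f_ ^~ t) (f t)) ->
  mu.-integrable setT (EFin \o g) -> (forall n t, Normc.normc (f_ n t) <= g t) ->
  ccvg (fun n => int (f_ n)) (int f).
Proof.
move=> mf cf ig fg.
have real (h : R[i] -> R) (hle : forall z, `|h z| <= Normc.normc z)
  (mh : forall n, measurable_fun setT (h \o f_ n))
  (ch : forall t, h (f_ n t) @[n --> \oo] --> h (f t)) :
  (\int[mu]_t (h (f_ n t)))%R @[n --> \oo] --> (\int[mu]_t (h (f t)))%R.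
  have hi n : mu.-integrable setT (EFin \o (h \o f_ n)).
    apply: (le_integrable _ _ _ ig) => //; first exact/measurable_EFinP.
    move=> t _ /=; rewrite lee_fin (le_trans (hle _))// (le_trans (fg n t))//.
    exact: ler_norm.
  have mhf : measurable_fun setT (h \o f).
    apply: (measurable_fun_cvg (h := fun n => h \o f_ n)) => // t _.
    exact: ch.
  have hfi : mu.-integrable setT (EFin \o (h \o f)).
    apply: (le_integrable _ _ _ ig) => //; first exact/measurable_EFinP.
    move=> t _ /=; rewrite lee_fin (le_trans _ (ler_norm _))//.
    have c2 : `|h (f_ n t)| @[n --> \oo] --> `|h (f t)| by apply: cvg_norm; exact: ch.
    rewrite -(cvg_lim _ c2)//; apply: limr_le.
      by apply/cvg_ex; eexists; exact: c2.
    by apply: nearW => n; rewrite (le_trans (hle _)).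
  rewrite /Rintegral; apply: fine_cvg; rewrite fineK; last exact: integrable_fin_num.
  apply: (@dominated_cvg _ _ _ mu setT measurableT
    (fun n t => (h (f_ n t))%:E) (fun t => (h (f t))%:E) (EFin \o g)) => //.
  - by move=> n; apply/measurable_EFinP; exact: mh.
  - by move=> t _; apply: cvg_EFin; [exact: nearW|exact: ch].
  - by move=> n t _ /=; rewrite lee_fin (le_trans (hle _)).
split; rewrite /cintegral /=.
- apply: real => [z|n|t]; [exact: le_Re_normc|by case: (mf n)|by case: (cf t)].
- apply: real => [z|n|t]; [exact: le_Im_normc|by case: (mf n)|by case: (cf t)].
Qed.

End CIntegral.

(** * Changes of variables on the real line *)

Section LebesgueReal.
Context {R : realType}.
Local Notation leb := (@lebesgue_measure R).

(** Uniqueness of Lebesgue measure: the pushforward scaled by |a| gives each half-open interval its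
    length, which determines it on all measurable sets. *)
Lemma pushforward_affine (a b : R) (a0 : a != 0) (A : set (measurableTypeR R)) :
  measurable A ->
  leb A = (`|a|%:E * leb ((fun x => a * x + b)%R @^-1` A))%E.
Proof.
move=> mA.
have mphi : measurable_fun [set: measurableTypeR R] ((fun x => a * x + b) : measurableTypeR R -> measurableTypeR R).
  by apply: measurable_funD => //; exact: measurable_funM.
pose phi : {mfun (measurableTypeR R) >-> (measurableTypeR R)} :=
  HB.pack ((fun x => a * x + b) : measurableTypeR R -> measurableTypeR R)
   (isMeasurableFun.Build _ _ _ _ _ mphi).
have -> : (`|a|%:E * leb ((fun x => a * x + b)%R @^-1` A))%E =
   mscale (NngNum (normr_ge0 a)) (pushforward leb phi) A by [].
apply: lebesgue_measure_unique => // X [[u v] _ <-] /=.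
rewrite /mscale /= /pushforward.
have an0 : 0 < `|a| by rewrite normr_gt0.
case: (ltrgtP 0 a) a0 => // ha _.
  have -> : (fun x => a * x + b) @^-1` [set` `]u, v] ] = `]((u - b) / a), ((v - b) / a)]%classic.
    by apply/seteqP; split => x /=; rewrite !in_itv/= ltr_pdivrMr// ler_pdivlMr//
      ltrBlDr lerBrDr mulrC.
  rewrite !lebesgue_measure_itv/= !lte_fin ltr_pM2r ?invr_gt0// ltrD2r.
  case: ifPn => _; last by rewrite mule0.
  rewrite -!EFinD -EFinM gtr0_norm//; congr EFin; field; exact: lt0r_neq0.
(* A negative slope exchanges the endpoints, so the preimage is closed on the left and open on the
   right; the length is the same. *)
have -> : (fun x => a * x + b) @^-1` [set` `]u, v] ] = `[((v - b) / a), ((u - b) / a)[%classic.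
  by apply/seteqP; split => x /=; rewrite !in_itv/= ltr_ndivlMr// ler_ndivrMr//
      ltrBlDr lerBrDr mulrC andbC.
rewrite !lebesgue_measure_itv/= !lte_fin ltr_nM2r ?invr_lt0// ltrD2r.
case: ifPn => _; last by rewrite mule0.
rewrite -!EFinD -EFinM ltr0_norm//; congr EFin; field; exact: ltr0_neq0.
Qed.

Lemma integral_affine (a b : R) (f : R -> R) : a != 0 -> measurable_fun setT f ->
  (forall x, 0 <= f x) ->
  (\int[leb]_x (f x)%:E = `|a|%:E * \int[leb]_x (f (a * x + b)%R)%:E)%E.
Proof.
move=> a0 mf f0.
have mphi : measurable_fun [set: measurableTypeR R] ((fun x => a * x + b) : measurableTypeR R -> measurableTypeR R).
  by apply: measurable_funD => //; exact: measurable_funM.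
pose phi : {mfun (measurableTypeR R) >-> (measurableTypeR R)} :=
  HB.pack ((fun x => a * x + b) : measurableTypeR R -> measurableTypeR R)
   (isMeasurableFun.Build _ _ _ _ _ mphi).
rewrite (@eq_measure_integral _ _ _ setT (mscale (NngNum (normr_ge0 a)) (pushforward leb phi))); last first.
  by move=> A mA _; exact: (pushforward_affine b a0 mA).
rewrite ge0_integral_mscale//=; last 2 first.
  exact/measurable_EFinP.
  by move=> x _; rewrite lee_fin.
rewrite ge0_integral_pushforward//=; first exact/measurable_EFinP.
by move=> x _; rewrite lee_fin.
Qed.

Lemma integrable_affine (a b : R) (f : R -> R) : a != 0 ->
  leb.-integrable setT (EFin \o f) -> leb.-integrable setT (EFin \o (fun x => f (a * x + b))).
Proof.
move=> a0 /integrableP[mf fi].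
have {}mf : measurable_fun setT f by exact/measurable_EFinP.
apply/integrableP; split.
  apply/measurable_EFinP.
  apply: (measurableT_comp mf).
  by apply: measurable_funD => //; exact: measurable_funM.
move: fi; rewrite (@integral_affine a b (fun x => `|f x|))//; last first.
  exact: measurableT_comp.
rewrite /= => h; rewrite ltNge; apply/negP; rewrite leye_eq => /eqP E.
by move: h; rewrite E gt0_muley ?ltxx// lte_fin normr_gt0.
Qed.

Lemma Rintegral_affine (a b : R) (f : R -> R) : a != 0 ->
  leb.-integrable setT (EFin \o f) ->
  (\int[leb]_x f (a * x + b) = `|a|^-1 * \int[leb]_x f x)%R.
Proof.
move=> a0 fi.
have mf : measurable_fun setT f by apply/measurable_EFinP; exact: measurable_int fi.
have an0 : `|a| != 0 by rewrite normr_eq0.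
rewrite /Rintegral.
have -> : (\int[leb]_x (f x)%:E = `|a|%:E * \int[leb]_x (f (a * x + b)%R)%:E)%E.
  rewrite integralE [X in (_ = _ * X)%E]integralE.
  rewrite (_ : (fun x => (f x)%:E) = EFin \o f)// funerpos funerneg.
  rewrite (_ : (fun x => (f (a * x + b)%R)%:E) = EFin \o (fun x => f (a * x + b)))//.
  rewrite funerpos funerneg.
  rewrite [X in (X - _ = _)%E](integral_affine b a0 (measurable_funrpos mf) (@funrpos_ge0 _ _ f)).
  rewrite [X in (_ - X = _)%E](integral_affine b a0 (measurable_funrneg mf) (@funrneg_ge0 _ _ f)).
  have fi2 := integrable_affine b a0 fi.
  have Nfin : (\int[leb]_x (EFin \o (fun x0 : R => f (a * x0 + b))^\-%R) x)%E \is a fin_num.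
    have := integrable_neg_fin_num measurableT fi2.
    by rewrite (_ : (EFin \o _)^\-%E = EFin \o (fun x => f (a * x + b))^\-) ?funerneg.
  rewrite [RHS]muleBr//.
  by apply: fin_num_adde_defl; rewrite fin_numN.
rewrite fineM//; last by have := integrable_affine b a0 fi; exact: integrable_fin_num.
by rewrite /= mulrA mulVf// mul1r.
Qed.

Lemma integral_growing (f : R -> R) : leb.-integrable setT (EFin \o f) ->
  (\int[leb]_(x in `[(- n%:R)%R, n%:R%R]) (f x)%:E @[n --> \oo] --> \int[leb]_x (f x)%:E)%E.
Proof.
move=> fi; under eq_cvg do rewrite integral_mkcond.
have mf := measurable_int _ fi.
apply: (@dominated_cvg _ _ _ leb setT measurableT _ _ (fun x => `|(f x)%:E|%E)) => //.
- by move=> n; apply/(measurable_restrictT _ _).1 => //; exact: measurable_funTS.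
- move=> x _; apply: cvg_near_cst; near=> n.
  rewrite /= patchE ifT// inE/= in_itv/=.
  have : `|x| <= n%:R by near: n; exact: nbhs_infty_ger.
  by rewrite ler_norml.
- exact: (integrable_abse fi).
- by move=> n x _; rewrite /= patchE; case: ifPn => // _; rewrite abse0 lee_fin.
Unshelve. all: end_near. Qed.

(** The fundamental theorem on [- n, n] gives F n - F (- n), and both terms tend to 0. This is the
    source of all integrations by parts on the line. *)
Lemma integral_derivative_eq0 (F f : R -> R) : (forall x : R, is_derive x (1 : R) F (f x)) ->
  continuous f -> leb.-integrable setT (EFin \o f) ->
  F n%:R @[n --> \oo] --> (0 : R) -> F (- n%:R) @[n --> \oo] --> (0 : R) ->
  (\int[leb]_x f x = 0)%R.
Proof.
move=> dF cf fi F1 F2.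
have h := integral_growing fi.
rewrite /Rintegral.
suff -> : (\int[leb]_x (f x)%:E = 0)%E by [].
apply: (cvg_unique _ h) => //.
have hF : ((F n%:R - F (- n%:R))%:E @[n --> \oo] --> (0 : R)%:E)%E.
  apply/fine_cvgP; split; first exact: nearW.
  by rewrite -[X in _ --> X](subrr 0); exact: cvgB.
apply: cvg_trans hF.
apply: near_eq_cvg; near=> n.
have n0 : - n%:R < n%:R :> R.
  by rewrite gtrN// ltr0n; near: n; exists 1%N.
rewrite EFinB (@continuous_FTC2 _ f F)//.
- exact: continuous_subspaceT.
- split.
  + by move=> x _; apply: ex_derive.
  + apply: cvg_at_right_filter; apply: differentiable_continuous.
    by apply/derivable1_diffP; apply: ex_derive.
  + apply: cvg_at_left_filter; apply: differentiable_continuous.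
    by apply/derivable1_diffP; apply: ex_derive.
- by move=> x _; rewrite derive1E; apply: derive_val.
Unshelve. all: end_near. Qed.

Section Substitution.
Variables (F f : R -> R) (D : set R).
Hypothesis incrF : forall x y, x < y -> F x < F y.
Hypothesis dF : forall x : R, is_derive x (1 : R) F (f x).
Hypothesis cf : continuous f.
Hypothesis f_ge0 : forall x, 0 <= f x.
Hypothesis mD : measurable (D : set (measurableTypeR R)).
Hypothesis DF : D = \bigcup_n `[F (- n%:R), F n%:R]%classic.

Let cF : continuous F.
Proof.
move=> x; apply: differentiable_continuous.
by apply/derivable1_diffP; apply: ex_derive.
Qed.

Let derF : F^`()%classic = f.
Proof. by apply/funext => x; rewrite derive1E; apply: derive_val. Qed.

(** The substitution rule on segments is applied to [- n, n] and its image, and both sides converge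
    by monotone convergence, since the images exhaust [D]. The two instances used later are [expR]
    onto the open half line and [csinh2] onto the whole line. *)
Lemma ge0_substitution_increasing (G : R -> R) :
  {in D, continuous G} -> measurable_fun D G -> (forall x, 0 <= G x) ->
  measurable_fun setT (G \o F) ->
  (\int[leb]_(x in D) (G x)%:E = \int[leb]_x (G (F x) * f x)%:E)%E.
Proof.
move=> cG mG G0 mGF.
have leF x y : x <= y -> F x <= F y.
  by rewrite le_eqVlt => /orP[/eqP->//|/incrF/ltW].
have h1 : (\int[leb]_(x in `[F (- n%:R)%R, F n%:R%R]) (G x)%:E @[n --> \oo] -->
   \int[leb]_(x in D) (G x)%:E)%E.
  rewrite [in X in _ --> X]DF; apply: ge0_nondecreasing_set_cvg_integral => //.
  - move=> n m nm; apply/subsetPset => x /=; rewrite !in_itv/= => /andP[x1 x2].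
    rewrite (le_trans _ x1) ?(le_trans x2) ?leF// ?lerN2 ler_nat//.
  - move=> n; apply/measurable_EFinP; apply: measurable_funS mG => //.
    by rewrite DF => x xn; exists n.
  - by move=> n x _; rewrite lee_fin.
have h2 : (\int[leb]_(x in `[(- n%:R)%R, n%:R%R]) (G (F x) * f x)%:E @[n --> \oo] -->
   \int[leb]_x (G (F x) * f x)%:E)%E.
  have -> : [set: measurableTypeR R] = \bigcup_n `[- n%:R, n%:R]%classic :> set (measurableTypeR R).
    apply/esym; rewrite -subTset => x _ /=; exists (Num.truncn `|x|).+1 => //.
    by rewrite /= in_itv/= -ler_norml ltW// Num.Theory.truncnS_gt.
  apply: ge0_nondecreasing_set_cvg_integral => //.
  - move=> n m nm; apply/subsetPset => x /=; rewrite !in_itv/= => /andP[x1 x2].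
    by rewrite (le_trans _ x1) ?(le_trans x2)// ?lerN2 ler_nat//.
  - move=> n; apply/measurable_EFinP; apply: measurable_funTS; apply: measurable_funM => //.
    exact: continuous_measurable_fun.
  - by move=> n x _; rewrite lee_fin mulr_ge0.
apply: (cvg_unique _ h1) => //; apply: cvg_trans h2.
apply: near_eq_cvg; near=> n.
have n0 : - n%:R <= n%:R :> R by rewrite lerNl oppr_le0 ler0n || rewrite ge0_cp.
rewrite (@integration_by_substitution_increasing _ F G (- n%:R) n%:R)//.
- by rewrite derF.
- by move=> x y _ _; exact: incrF.
- by rewrite derF => x _; exact: cf.
- by rewrite derF; apply/cvg_ex; exists (f (- n%:R)); apply: cvg_at_right_filter; exact: cf.
- by rewrite derF; apply/cvg_ex; exists (f n%:R); apply: cvg_at_left_filter; exact: cf.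
- split.
  + by move=> x _; apply: ex_derive.
  + by apply: cvg_at_right_filter; exact: cF.
  + by apply: cvg_at_left_filter; exact: cF.
- apply: continuous_in_subspaceT => x xn; apply: cG.
  by move: xn; rewrite !inE => xn; rewrite DF; exists n.
Unshelve. all: end_near. Qed.

Lemma substitution_increasing (G : R -> R) :
  {in D, continuous G} -> measurable_fun D G -> measurable_fun setT (G \o F) ->
  (\int[leb]_(x in D) (G x)%:E = \int[leb]_x (G (F x) * f x)%:E)%E.
Proof.
move=> cG mG mGF; rewrite integralE [RHS]integralE.
have cpos : continuous (fun y : R => Num.max y 0).
  by move=> y; apply: continuous_max; [exact: cvg_id|exact: cvg_cst].
have cneg : continuous (fun y : R => Num.max (- y) 0).
  by move=> y; apply: continuous_max; [exact: continuousN|exact: cvg_cst].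
congr (_ - _)%E.
  rewrite (_ : (fun x => (G x)%:E) = EFin \o G)// funerpos ge0_substitution_increasing//.
  - apply: eq_integral => x _; rewrite (_ : (fun x => (G (F x) * f x)%:E) = EFin \o (fun x => G (F x) * f x))//.
    by rewrite funerpos /= /funrpos maxr_pMl// mul0r.
  - by move=> x xD; exact: (continuous_comp (cG _ xD) (cpos _)).
  - exact: measurable_funrpos.
  - exact: (measurable_funrpos mGF).
rewrite (_ : (fun x => (G x)%:E) = EFin \o G)// funerneg ge0_substitution_increasing//.
- apply: eq_integral => x _; rewrite (_ : (fun x => (G (F x) * f x)%:E) = EFin \o (fun x => G (F x) * f x))//.
  by rewrite funerneg /= /funrneg maxr_pMl// mul0r mulNr.
- by move=> x xD; exact: (continuous_comp (cG _ xD) (cneg _)).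
- exact: measurable_funrneg.
- exact: (measurable_funrneg mGF).
Qed.

End Substitution.

End LebesgueReal.

(** * Exponentially decaying functions *)

Notation cint := (cintegral (@lebesgue_measure _) setT).
Notation cintble := (cintegrable (@lebesgue_measure _) setT).

Section Decay.
Context {R : realType}.
Local Notation leb := (@lebesgue_measure R).
Local Notation RM := (measurableTypeR R).

Definition edec (c x : R) : R := expR (- (c * `|x|)).

Lemma edec_ge0 c x : 0 <= edec c x. Proof. exact: expR_ge0. Qed.

Lemma continuous_edec c : continuous (edec c).
Proof.
move=> x; apply: continuous_comp; last exact: continuous_expR.
apply: continuousN; apply: (@continuousM _ _ (cst c)); first exact: cst_continuous.
exact: norm_continuous.
Qed.

Lemma measurable_edec c : measurable_fun setT (edec c).
Proof. by apply: continuous_measurable_fun; exact: continuous_edec. Qed.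

Lemma integral_edec c : 0 < c ->
  (\int[leb]_x (edec c x)%:E = (2 / c)%:E)%E.
Proof.
move=> c0; rewrite ge0_symfun_integralT//; last 3 first.
- by move=> x; exact: edec_ge0.
- exact: continuous_edec.
- by move=> x; rewrite /edec /= normrN.
rewrite -set_itvcy.
under eq_integral.
  move=> x; rewrite inE/= in_itv/= andbT => x0.
  rewrite /edec ger0_norm//.
  over.
have dG (x : R) : is_derive x (1 : R) (fun x => - c^-1 * expR (- (c * x))) (expR (- (c * x))).
  apply: is_derive_eq.
  by rewrite /GRing.scale /=; field; exact: lt0r_neq0.
rewrite (@ge0_continuous_FTC2y _ (fun x => expR (- (c * x))) (fun x => - c^-1 * expR (- (c * x))) 0 0)//.
- rewrite mulr0 oppr0 expR0 mulr1 -EFinB sub0r opprK -EFinM//.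
- apply: continuous_subspaceT => x.
  apply: continuous_comp; last exact: continuous_expR.
  by apply: continuousN; apply: mulrl_continuous.
- rewrite -(mulr0 (- c^-1)); apply: cvgMr.
  have := @cvgr_expR R.
  move=> h; apply: (@cvg_comp _ _ _ (fun x => c * x) (fun x => expR (- x)) +oo%R +oo%R _ _ h).
  apply/cvgryPge => A; apply: filterS (nbhs_pinfty_ge (num_real (c^-1 * A))) => y.
  by rewrite ler_pdivrMl.
- have : {for (0 : R), continuous (fun x => - c^-1 * expR (- (c * x)))}.
    by apply: differentiable_continuous; apply/derivable1_diffP; have [] := dG 0.
  by move=> h; apply: cvg_at_right_filter; exact: h.
- by move=> x _; rewrite derive1E; have [_] := dG x.
Qed.

Lemma integrable_edec c : 0 < c -> leb.-integrable setT (EFin \o edec c).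
Proof.
move=> c0; apply/integrableP; split.
  by apply/measurable_EFinP; exact: measurable_edec.
under eq_integral do rewrite /= ger0_norm ?edec_ge0//.
by rewrite integral_edec// ltry.
Qed.

Lemma Rintegral_edec c : 0 < c -> (\int[leb]_x edec c x = 2 / c)%R.
Proof. by move=> c0; rewrite /Rintegral integral_edec. Qed.

(* Exponential decay in one, two and three real variables: these classes are
   stable under products, sections, partial integrals and linear changes of
   variables, so integrability and Fubini come for free on them. *)
Definition ED1 (f : R -> R[i]) : Prop :=
  @cmeas R _ RM f /\
  exists C c, [/\ 0 <= C, 0 < c & forall x, Normc.normc (f x) <= C * edec c x].

Definition ED2 (f : R -> R -> R[i]) : Prop :=
  @cmeas R _ (RM * RM)%type (fun p => f p.1 p.2) /\
  exists C c, [/\ 0 <= C, 0 < c &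
    forall x y, Normc.normc (f x y) <= C * (edec c x * edec c y)].

Definition ED3 (f : R -> R -> R -> R[i]) : Prop :=
  @cmeas R _ (RM * RM * RM)%type (fun p => f p.1.1 p.1.2 p.2) /\
  exists C c, [/\ 0 <= C, 0 < c &
    forall x y z, Normc.normc (f x y z) <= C * (edec c x * edec c y * edec c z)].

Lemma ED1_integrable f : ED1 f -> cintble f.
Proof.
move=> [mf [C [c [C0 c0 fb]]]].
exact: (cintegrable_bound mf (integrableZl measurableT C (integrable_edec c0)) fb).
Qed.

Lemma edec_le c c' x : c' <= c -> edec c x <= edec c' x.
Proof. by move=> cc; rewrite ler_expR lerN2 ler_wpM2r. Qed.

Lemma edec_le1 c x : 0 <= c -> edec c x <= 1.
Proof. by move=> c0; rewrite -expR0 ler_expR oppr_le0 mulr_ge0. Qed.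

Lemma ED2_fst f x : ED2 f -> ED1 (f x).
Proof.
move=> [mf [C [c [C0 c0 fb]]]]; split.
  exact: (cmeas_comp mf (measurable_pair1 x)).
exists (C * edec c x), c; split => //; first by rewrite mulr_ge0 ?edec_ge0.
by move=> y; rewrite -mulrA.
Qed.

Lemma ED2_swap f : ED2 f -> ED2 (fun x y => f y x).
Proof.
move=> [mf [C [c [C0 c0 fb]]]]; split.
  have := @cmeas_comp _ _ _ (RM * RM)%type (RM * RM)%type _ (fun p => (p.2, p.1)) mf.
  by apply; apply: measurable_fun_pair.
by exists C, c; split => // x y; rewrite [edec c x * _]mulrC.
Qed.

Lemma ED2_snd f y : ED2 f -> ED1 (f ^~ y).
Proof. by move=> /ED2_swap/ED2_fst; apply. Qed.

Lemma integrable_edec2 c : 0 < c ->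
  (leb \x leb)%E.-integrable setT (EFin \o (fun p : RM * RM => edec c p.1 * edec c p.2)).
Proof.
move=> c0; apply/integrable12ltyP => /=.
  apply/measurable_EFinP; apply: measurable_funM.
    exact: (measurableT_comp (measurable_edec c)).
  exact: (measurableT_comp (measurable_edec c)).
under eq_integral => x _.
  under eq_integral do rewrite /= ger0_norm ?mulr_ge0 ?edec_ge0// EFinM.
  rewrite ge0_integralZl//; last 3 first.
    - by apply/measurable_EFinP; exact: measurable_edec.
    - by move=> y _; rewrite lee_fin edec_ge0.
    - by rewrite lee_fin edec_ge0.
  rewrite integral_edec// muleC.
  over.
rewrite ge0_integralZl//; last 3 first.
  - by apply/measurable_EFinP; exact: measurable_edec.
  - by move=> y _; rewrite lee_fin edec_ge0.
  - by rewrite lee_fin divr_ge0// ltW.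
by rewrite integral_edec// -EFinM ltry.
Qed.

Lemma ED2_integrable f : ED2 f ->
  cintegrable (leb \x leb)%E setT (fun p : RM * RM => f p.1 p.2).
Proof.
move=> [mf [C [c [C0 c0 fb]]]].
apply: (cintegrable_bound mf (integrableZl measurableT C (integrable_edec2 c0))).
by move=> p; exact: fb.
Qed.

Section Fubini.
Context d1 d2 (T1 : measurableType d1) (T2 : measurableType d2).
Variables (m1 : {sigma_finite_measure set T1 -> \bar R})
          (m2 : {sigma_finite_measure set T2 -> \bar R}).
Variable f : T1 -> T2 -> R[i].
Hypothesis fi : cintegrable (m1 \x m2)%E setT (fun p : T1 * T2 => f p.1 p.2).
Hypothesis fi1 : forall x, cintegrable m2 setT (f x).

Let real (h : T1 -> T2 -> R) :
  (m1 \x m2)%E.-integrable setT (EFin \o (fun p : T1 * T2 => h p.1 p.2)) ->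
  (forall x, m2.-integrable setT (EFin \o h x)) ->
  m1.-integrable setT (EFin \o (fun x => \int[m2]_y h x y)%R) /\
  (\int[(m1 \x m2)%E]_p h p.1 p.2 = \int[m1]_x \int[m2]_y h x y)%R.
Proof.
move=> hi hi1.
have E x : (\int[m2]_y (h x y))%R%:E = fubini_F m2 (EFin \o (fun p : T1 * T2 => h p.1 p.2)) x.
  rewrite /Rintegral fineK//; apply: integrable_fin_num => //; exact: (hi1 x).
split.
  by apply: eq_integrable (integrable_fubini_F hi) => // x _; rewrite -E.
rewrite /Rintegral -(integral12_prod_meas1 hi); congr fine.
by apply: eq_integral => x _; rewrite -E.
Qed.

Lemma cfubini_integrable : cintegrable m1 setT (fun x => cintegral m2 setT (f x)).
Proof.
have [fi_1 fi_2] := fi; split.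
  by apply: (real (h := fun x y => Re (f x y)) fi_1 _).1 => x; case: (fi1 x).
by apply: (real (h := fun x y => Im (f x y)) fi_2 _).1 => x; case: (fi1 x).
Qed.

Lemma cfubini : cintegral (m1 \x m2)%E setT (fun p : T1 * T2 => f p.1 p.2) =
  cintegral m1 setT (fun x => cintegral m2 setT (f x)).
Proof.
have [fi_1 fi_2] := fi; apply: complex_ext; rewrite /cintegral /=.
  by apply: (real (h := fun x y => Re (f x y)) fi_1 _).2 => x; case: (fi1 x).
by apply: (real (h := fun x y => Im (f x y)) fi_2 _).2 => x; case: (fi1 x).
Qed.

End Fubini.

Lemma ED2_int f : ED2 f -> ED1 (fun x => cint (f x)).
Proof.
move=> fe; split.
  apply: cintegrable_meas; apply: cfubini_integrable.
    exact: ED2_integrable.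
  by move=> x; apply: ED1_integrable; exact: ED2_fst.
have [mf [C [c [C0 c0 fb]]]] := fe.
(* Here 2 / c is the integral of [edec c], and the outer 2 is the loss of [normc_cintegral_le]. The
   rate c survives in the remaining variable. *)
exists (2 * (C * (2 / c))), c; split => //.
  by rewrite mulr_ge0// mulr_ge0// divr_ge0// ltW.
move=> x.
have [mfx _] := ED2_fst x fe.
have ig := integrableZl measurableT (C * edec c x) (integrable_edec c0).
apply: (le_trans (normc_cintegral_le mfx ig _)).
- by move=> y; rewrite -mulrA.
- rewrite RintegralZl//; last exact: integrable_edec.
  rewrite Rintegral_edec// le_eqVlt; apply/orP; left; apply/eqP; ring.
Qed.

Lemma ED2_fubini f : ED2 f ->
  cint (fun x => cint (f x)) = cint (fun y => cint (f ^~ y)).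
Proof.
move=> fe.
have h := @cfubini _ _ _ _ leb leb f (ED2_integrable fe) (fun x => ED1_integrable (ED2_fst x fe)).
rewrite -h.
have [[i1 i2] fs] := (ED2_integrable fe, ED2_swap fe).
have [[j1 j2]] := ED2_integrable fs.
apply: complex_ext; rewrite /cintegral /= /Rintegral.
  rewrite -(integral21_prod_meas1 i1); congr fine; apply: eq_integral => y _.
  rewrite /fubini_G fineK//; apply: integrable_fin_num => //.
  by case: (ED1_integrable (ED2_fst y fs)).
rewrite -(integral21_prod_meas1 i2); congr fine; apply: eq_integral => y _.
rewrite /fubini_G fineK//; apply: integrable_fin_num => //.
by case: (ED1_integrable (ED2_fst y fs)).
Qed.

Lemma ED3_fst2 f x y : ED3 f -> ED1 (f x y).
Proof.
move=> [mf [C [c [C0 c0 fb]]]]; split.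
  exact: (cmeas_comp mf (measurable_pair1 (x, y))).
exists (C * (edec c x * edec c y)), c; split => //.
  by rewrite !mulr_ge0 ?edec_ge0.
by move=> z; rewrite -mulrA.
Qed.

Lemma ED3_perm213 f : ED3 f -> ED3 (fun x y z => f y x z).
Proof.
move=> [mf [C [c [C0 c0 fb]]]]; split.
  have := @cmeas_comp _ _ _ (RM * RM * RM)%type (RM * RM * RM)%type _
    (fun p => ((p.1.2, p.1.1), p.2)) mf.
  apply; apply: measurable_fun_pair => //; apply: measurable_fun_pair.
    exact: measurableT_comp.
  exact: measurableT_comp.
by exists C, c; split => // x y z; rewrite [edec c x * _]mulrC.
Qed.

Lemma ED3_perm132 f : ED3 f -> ED3 (fun x y z => f x z y).
Proof.
move=> [mf [C [c [C0 c0 fb]]]]; split.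
  have := @cmeas_comp _ _ _ (RM * RM * RM)%type (RM * RM * RM)%type _
    (fun p => ((p.1.1, p.2), p.1.2)) mf.
  apply; apply: measurable_fun_pair => //; last exact: measurableT_comp.
  by apply: measurable_fun_pair => //; exact: measurableT_comp.
by exists C, c; split => // x y z; rewrite mulrAC.
Qed.

Lemma ED3_fst f x : ED3 f -> ED2 (f x).
Proof.
move=> [mf [C [c [C0 c0 fb]]]]; split.
  have := @cmeas_comp _ _ _ (RM * RM)%type (RM * RM * RM)%type _
    (fun p => ((x, p.1), p.2)) mf.
  by apply; apply: measurable_fun_pair => //; apply: measurable_fun_pair.
exists (C * edec c x), c; split => //.
  by rewrite !mulr_ge0 ?edec_ge0.
by move=> y z; apply: (le_trans (fb x y z)); rewrite -!mulrA.
Qed.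

(** The squares of an increasing exhaustion of the line exhaust the plane: a point with coordinates
    in F n and F m lies in the square of index max n m. *)
Lemma lebesgue2_sigma_finite : sigma_finite setT (leb \x leb)%E.
Proof.
have /sigma_finiteP[F [TF ndF Foo]] := sigma_finiteT leb.
exists (fun n => F n `*` F n).
  apply/esym; rewrite -subTset => -[x y] _.
  have [n _ Fnx] : (\bigcup_n F n) x by rewrite -TF.
  have [m _ Fmy] : (\bigcup_n F n) y by rewrite -TF.
  exists (maxn n m) => //; split => /=.
    by have /subsetPset := ndF _ _ (leq_maxl n m); apply.
  by have /subsetPset := ndF _ _ (leq_maxr n m); apply.
move=> k; have [mF Fk] := Foo k; split; first exact: measurableX.
by rewrite product_measure1E// lte_mul_pinfty// ge0_fin_numE.
Qed.

(* The canonical sigma-finite structure of a product measure is only found for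
   subprobabilities, so it is packed by hand for the plane. *)
Definition lebesgue2 : {sigma_finite_measure set (RM * RM)%type -> \bar R} :=
  HB.pack (leb \x leb)%E
    (Measure_isSigmaFinite.Build _ _ _ (leb \x leb)%E lebesgue2_sigma_finite).

Lemma integrable_edec3 c : 0 < c ->
  (leb \x leb \x leb)%E.-integrable setT
    (EFin \o (fun p : RM * RM * RM => edec c p.1.1 * edec c p.1.2 * edec c p.2)).
Proof.
move=> c0.
have mf : measurable_fun setT
    (EFin \o (fun p : RM * RM * RM => edec c p.1.1 * edec c p.1.2 * edec c p.2)).
  apply/measurable_EFinP; apply: measurable_funM; last first.
    exact: (measurableT_comp (measurable_edec c)).
  apply: measurable_funM.
    by apply: (measurableT_comp (measurable_edec c)); exact: measurableT_comp.
  by apply: (measurableT_comp (measurable_edec c)); exact: measurableT_comp.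
apply: ((@integrable12ltyP _ _ _ _ R lebesgue2 leb _ mf).2).
have /integrableP[me ie] := integrable_edec2 c0.
rewrite (@eq_integral _ _ _ _ _ (fun p : RM * RM => (2 / c)%:E *
    (EFin \o (fun p : RM * RM => (edec c p.1 * edec c p.2)%R)) p)%E); last first.
  move=> x _.
  under eq_integral do rewrite /= ger0_norm ?mulr_ge0 ?edec_ge0// EFinM.
  rewrite ge0_integralZl//; last 3 first.
    - by apply/measurable_EFinP; exact: measurable_edec.
    - by move=> y _; rewrite lee_fin edec_ge0.
    - by rewrite lee_fin mulr_ge0 ?edec_ge0.
  by rewrite integral_edec// muleC.
rewrite ge0_integralZl//; last 2 first.
  - by move=> y _; rewrite lee_fin mulr_ge0 ?edec_ge0.
  - by rewrite lee_fin divr_ge0// ltW.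
rewrite lte_mul_pinfty//; first by rewrite lee_fin divr_ge0// ltW.
apply: le_lt_trans ie.
by under [leRHS]eq_integral do rewrite /= ger0_norm ?mulr_ge0 ?edec_ge0//.
Qed.

Lemma ED3_integrable f : ED3 f ->
  cintegrable (leb \x leb \x leb)%E setT (fun p : RM * RM * RM => f p.1.1 p.1.2 p.2).
Proof.
move=> [mf [C [c [C0 c0 fb]]]].
apply: (cintegrable_bound mf (integrableZl measurableT C (integrable_edec3 c0))).
by move=> p; exact: fb.
Qed.

Lemma ED3_int f : ED3 f -> ED2 (fun x y => cint (f x y)).
Proof.
move=> fe; split.
  apply: (@cintegrable_meas _ _ _ (leb \x leb)%E).
  apply: (@cfubini_integrable _ _ _ _ lebesgue2 leb (fun p => f p.1 p.2)).
    exact: ED3_integrable.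
  by move=> x; apply: ED1_integrable; exact: ED3_fst2.
have [mf [C [c [C0 c0 fb]]]] := fe.
exists (2 * (C * (2 / c))), c; split => //.
  by rewrite mulr_ge0// mulr_ge0// divr_ge0// ltW.
move=> x y.
have [mfx _] := ED3_fst2 x y fe.
have ig := integrableZl measurableT (C * (edec c x * edec c y)) (integrable_edec c0).
apply: (le_trans (normc_cintegral_le mfx ig _)).
- by move=> z; rewrite -mulrA.
- rewrite RintegralZl//; last exact: integrable_edec.
  rewrite Rintegral_edec// le_eqVlt; apply/orP; left; apply/eqP; ring.
Qed.

Lemma ED3_fubini f : ED3 f ->
  cintegral (leb \x leb \x leb)%E setT (fun p : RM * RM * RM => f p.1.1 p.1.2 p.2) =
  cint (fun x => cint (fun y => cint (f x y))).
Proof.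
move=> fe.
rewrite (@cfubini _ _ _ _ lebesgue2 leb (fun p => f p.1 p.2)) //; first last.
- by move=> x; apply: ED1_integrable; exact: ED3_fst2.
- exact: ED3_integrable.
have fe2 := ED3_int fe.
exact: (@cfubini _ _ _ _ leb leb (fun x y => cint (f x y)) (ED2_integrable fe2)
  (fun x => ED1_integrable (ED2_fst x fe2))).
Qed.

End Decay.

(** * Continuity, differentiation and dominated convergence *)

Section MeasurableTactic.
Context {R : realType} {d : measure_display} {T : measurableType d}.
Implicit Type f : T -> R.

Lemma meas_expR f : measurable_fun setT f -> measurable_fun setT (fun t => expR (f t)).
Proof. exact: measurableT_comp. Qed.
Lemma meas_cos f : measurable_fun setT f -> measurable_fun setT (fun t => cos (f t)).
Proof.
by apply: measurableT_comp; apply: continuous_measurable_fun; exact: continuous_cos.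
Qed.
Lemma meas_sin f : measurable_fun setT f -> measurable_fun setT (fun t => sin (f t)).
Proof.
by apply: measurableT_comp; apply: continuous_measurable_fun; exact: continuous_sin.
Qed.
Lemma meas_atan f : measurable_fun setT f -> measurable_fun setT (fun t => atan (f t)).
Proof.
by apply: measurableT_comp; apply: continuous_measurable_fun => x; exact: continuous_atan.
Qed.
Lemma meas_ln f : measurable_fun setT f -> measurable_fun setT (fun t => ln (f t)).
Proof. exact: measurableT_comp. Qed.
Lemma meas_N f : measurable_fun setT f -> measurable_fun setT (fun t => - f t).
Proof. exact: measurableT_comp. Qed.
(** Positivity allows the inverse to be written as exp (- ln), which reduces the claim to functions
    already treated. *)
Lemma meas_inv f : (forall t, 0 < f t) -> measurable_fun setT f ->
  measurable_fun setT (fun t => (f t)^-1).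
Proof.
move=> f0 mf; rewrite (_ : (fun t => _) = (fun t => expR (- ln (f t)))).
  by apply: meas_expR; apply: meas_N; exact: meas_ln.
by apply/funext => t; rewrite expRN lnK ?posrE.
Qed.

Lemma cmeas_conjc (f : T -> R[i]) : cmeas f -> cmeas (fun t => conjc (f t)).
Proof.
move=> [f1 f2]; split.
  rewrite (_ : _ \o _ = Re \o f)//.
  by apply/funext => t /=; case: (f t).
rewrite (_ : _ \o _ = (fun t => - Im (f t))); last by apply/funext => t /=; case: (f t).
exact: meas_N.
Qed.
End MeasurableTactic.

Section ContDeriv.
Context {R : realType}.
Implicit Types (f g : R -> R[i]) (r : R -> R).

Definition ccontat f (x : R) : Prop :=
  {for x, continuous (Re \o f)} /\ {for x, continuous (Im \o f)}.

Lemma ccontat_cst (c : R[i]) x : ccontat (fun=> c) x.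
Proof. by split; exact: cst_continuous. Qed.

Lemma ccontatR r x : {for x, continuous r} -> ccontat (fun x => (r x)%:C) x.
Proof. by split => //; exact: cst_continuous. Qed.

Lemma ccontatD f g x : ccontat f x -> ccontat g x -> ccontat (fun x => f x + g x) x.
Proof.
move=> [f1 f2] [g1 g2]; split.
  rewrite (_ : _ \o _ = (Re \o f) \+ (Re \o g)); first exact: continuousD.
  by apply/funext => y /=; rewrite cReD.
rewrite (_ : _ \o _ = (Im \o f) \+ (Im \o g)); first exact: continuousD.
by apply/funext => y /=; rewrite cImD.
Qed.

Lemma ccontatM f g x : ccontat f x -> ccontat g x -> ccontat (fun x => f x * g x) x.
Proof.
move=> [f1 f2] [g1 g2]; split.
  rewrite (_ : _ \o _ = ((Re \o f) \* (Re \o g)) \- ((Im \o f) \* (Im \o g))).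
    by apply: continuousB; exact: continuousM.
  by apply/funext => y /=; rewrite cReM.
rewrite (_ : _ \o _ = ((Re \o f) \* (Im \o g)) \+ ((Im \o f) \* (Re \o g))).
  by apply: continuousD; exact: continuousM.
by apply/funext => y /=; rewrite cImM.
Qed.

Lemma ccontatN f x : ccontat f x -> ccontat (fun x => - f x) x.
Proof.
move=> /(ccontatM (ccontat_cst (-1) x)); rewrite (_ : (fun x => _) = (fun x => - f x))//.
by apply/funext => y; rewrite mulN1r.
Qed.

Lemma ccontat_cexp f x : ccontat f x -> ccontat (fun x => cexp (f x)) x.
Proof.
move=> [f1 f2]; rewrite /cexp; apply: ccontatM.
  by apply: ccontatR; apply: continuous_comp f1 _; exact: continuous_expR.
split => /=.
  by apply: continuous_comp f2 _; exact: continuous_cos.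
by apply: continuous_comp f2 _; exact: continuous_sin.
Qed.

Definition is_cderive f (x : R) (l : R[i]) : Prop :=
  is_derive x (1 : R) (Re \o f) (Re l) /\ is_derive x (1 : R) (Im \o f) (Im l).

Lemma is_cderive_eq f x l l' : is_cderive f x l -> l = l' -> is_cderive f x l'.
Proof. by move=> h <-. Qed.

Lemma is_cderive_ext f g x l : f =1 g -> is_cderive f x l -> is_cderive g x l.
Proof. by move=> /funext ->. Qed.

Lemma is_cderive_cst (c : R[i]) x : is_cderive (fun=> c) x 0.
Proof. by split; exact: is_derive_cst. Qed.

Lemma is_cderiveR r x (l : R) : is_derive x (1 : R) r l ->
  is_cderive (fun x => (r x)%:C) x l%:C.
Proof. by split => //; exact: is_derive_cst. Qed.

Lemma is_cderive_id x : is_cderive (fun x => x%:C) x 1.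
Proof. by apply: is_cderiveR; exact: is_derive_id. Qed.

Lemma is_cderiveD f g x l m : is_cderive f x l -> is_cderive g x m ->
  is_cderive (fun x => f x + g x) x (l + m).
Proof.
move=> [f1 f2] [g1 g2]; split.
  rewrite (_ : _ \o _ = (Re \o f) \+ (Re \o g)); first by rewrite cReD; exact: is_deriveD.
  by apply/funext => y /=; rewrite cReD.
rewrite (_ : _ \o _ = (Im \o f) \+ (Im \o g)); first by rewrite cImD; exact: is_deriveD.
by apply/funext => y /=; rewrite cImD.
Qed.

Lemma is_cderiveM f g x l m : is_cderive f x l -> is_cderive g x m ->
  is_cderive (fun x => f x * g x) x (l * g x + f x * m).
Proof.
move=> [f1 f2] [g1 g2]; split.
  rewrite (_ : _ \o _ = ((Re \o f) \* (Re \o g)) \- ((Im \o f) \* (Im \o g))); last first.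
    by apply/funext => y /=; rewrite cReM.
  apply: (is_derive_eq (is_deriveB (is_deriveM f1 g1) (is_deriveM f2 g2))).
  by rewrite !reimE /GRing.scale /=; ring.
rewrite (_ : _ \o _ = ((Re \o f) \* (Im \o g)) \+ ((Im \o f) \* (Re \o g))); last first.
  by apply/funext => y /=; rewrite cImM.
apply: (is_derive_eq (is_deriveD (is_deriveM f1 g2) (is_deriveM f2 g1))).
by rewrite !reimE /GRing.scale /=; ring.
Qed.

Lemma is_cderiveN f x l : is_cderive f x l -> is_cderive (fun x => - f x) x (- l).
Proof.
move=> /(is_cderiveM (is_cderive_cst (-1) x)) h.
apply: (is_cderive_eq (is_cderive_ext _ h)); first by move=> y; rewrite mulN1r.
by rewrite mul0r add0r mulN1r.
Qed.

Lemma is_cderive_cexp f x l : is_cderive f x l ->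
  is_cderive (fun x => cexp (f x)) x (l * cexp (f x)).
Proof.
move=> [f1 f2].
have he := is_derive1_comp (is_derive_expR (Re (f x))) f1.
have hc := is_derive1_comp (is_derive_cos (Im (f x))) f2.
have hs := is_derive1_comp (is_derive_sin (Im (f x))) f2.
split.
  rewrite (_ : _ \o _ = (expR \o (Re \o f)) \* (cos \o (Im \o f))); last first.
    by apply/funext => y; exact: Re_cexp.
  apply: (is_derive_eq (is_deriveM he hc)).
  by rewrite /cexp !reimE /GRing.scale /=; ring.
rewrite (_ : _ \o _ = (expR \o (Re \o f)) \* (sin \o (Im \o f))); last first.
  by apply/funext => y; exact: Im_cexp.
apply: (is_derive_eq (is_deriveM he hs)).
by rewrite /cexp !reimE /GRing.scale /=; ring.
Qed.

Lemma is_cderive_cont f x l : is_cderive f x l -> ccontat f x.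
Proof.
move=> [[/derivable1_diffP f1 _] [/derivable1_diffP f2 _]].
by split; [exact: differentiable_continuous f1|exact: differentiable_continuous f2].
Qed.

(** The constancy argument that solves the differential equations in [GI_P] and [gaussFTE], by the
    mean value theorem for each component. *)
Lemma is_cderive0_eq f (a b : R) : a <= b ->
  (forall x, a <= x <= b -> is_cderive f x 0) -> f a = f b.
Proof.
move=> ab h; apply: complex_ext.
  have /(_ _ _)[] := @MVT_segment R (Re \o f) (fun=> 0) a b ab.
  - by move=> x; rewrite in_itv/= => /andP[/ltW ax /ltW xb]; apply: (h x _).1; rewrite ax.
  - apply: derivable_within_continuous => x; rewrite in_itv/= => xab.
    by have [[]] := h x xab.
  - by move=> c _ /=; rewrite mul0r => /subr0_eq.
have /(_ _ _)[] := @MVT_segment R (Im \o f) (fun=> 0) a b ab.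
- by move=> x; rewrite in_itv/= => /andP[/ltW ax /ltW xb]; apply: (h x _).2; rewrite ax.
- apply: derivable_within_continuous => x; rewrite in_itv/= => xab.
  by have [_ []] := h x xab.
- by move=> c _ /=; rewrite mul0r => /subr0_eq.
Qed.

End ContDeriv.

Section CInt.
Context {R : realType}.
Local Notation RM := (measurableTypeR R).
Implicit Types (f F : R -> R[i]).

Lemma cintble_affine f (a b : R) : a != 0 -> cintble f -> cintble (fun x => f (a * x + b)).
Proof.
by move=> a0 [f1 f2]; split; [exact: (integrable_affine b a0 f1)|exact: (integrable_affine b a0 f2)].
Qed.

Lemma cint_affine f (a b : R) : a != 0 -> cintble f ->
  cint (fun x => f (a * x + b)) = (`|a|^-1)%:C * cint f.
Proof.
move=> a0 [f1 f2]; apply: complex_ext; rewrite ?reimE /cintegral /=.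
  exact: (Rintegral_affine b a0 f1).
exact: (Rintegral_affine b a0 f2).
Qed.

Lemma cint_shift f (b : R) : cintble f -> cint (fun x => f (x + b)) = cint f.
Proof.
move=> fi; have := @cint_affine f 1 b (oner_neq0 _) fi.
rewrite normr1 invr1 mul1r => <-; apply: eq_cintegral => x; by rewrite mul1r.
Qed.

Lemma cintble_shift f (b : R) : cintble f -> cintble (fun x => f (x + b)).
Proof.
move=> fi; have := @cintble_affine f 1 b (oner_neq0 _) fi.
by under eq_fun do rewrite mul1r.
Qed.

Lemma cint_opp f : cintble f -> cint (fun x => f (- x)) = cint f.
Proof.
move=> fi; have := @cint_affine f (-1) 0 _ fi.
rewrite oppr_eq0 oner_neq0 normrN normr1 invr1 mul1r => /(_ isT) <-.
by apply: eq_cintegral => x; rewrite mulN1r addr0.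
Qed.

Lemma cintble_opp f : cintble f -> cintble (fun x => f (- x)).
Proof.
move=> fi; have := @cintble_affine f (-1) 0 _ fi.
rewrite oppr_eq0 oner_neq0 => /(_ isT).
by under eq_fun do rewrite mulN1r addr0.
Qed.

Lemma ccont_meas f : (forall x, ccontat f x) -> @cmeas R _ RM f.
Proof.
by move=> h; split; apply: continuous_measurable_fun => x; have [] := h x.
Qed.

Lemma cvg_edec (c : R) : 0 < c -> edec c n%:R @[n --> \oo] --> (0 : R).
Proof.
move=> c0; rewrite /edec.
under eq_cvg do rewrite ger0_norm// -mulNr expRM_natr.
by apply: cvg_expr; rewrite ger0_norm ?expR_ge0// expR_lt1 oppr_lt0.
Qed.

(** Integration by parts in the form used below: [F] is the product whose derivative is split, and
    its exponential bound removes the boundary terms. *)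
Lemma cint_derivative_eq0 F f : (forall x, is_cderive F x (f x)) ->
  (forall x, ccontat f x) -> cintble f ->
  (exists C c, 0 < c /\ forall x, Normc.normc (F x) <= C * edec c x) ->
  cint f = 0.
Proof.
move=> dF cf [f1 f2] [C [c [c0 Fb]]].
have h0 (h : R[i] -> R) (hn : forall z, `|h z| <= Normc.normc z) :
   h (F n%:R) @[n --> \oo] --> (0 : R) /\ h (F (- n%:R)) @[n --> \oo] --> (0 : R).
  have cz : C * edec c n%:R @[n --> \oo] --> (0 : R).
    by rewrite -(mulr0 C); apply: cvgMr; exact: cvg_edec.
  have key (u : nat -> R) : (forall n, `|u n| <= C * edec c n%:R) -> u n @[n --> \oo] --> (0 : R).
    move=> ub.
    apply: (@squeeze_cvgr _ _ _ _ (fun n => - (C * edec c n%:R)) (fun n => C * edec c n%:R) u) => //.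
      by apply: nearW => n; have := ub n; rewrite ler_norml.
    by rewrite -oppr0; exact: cvgN.
  split; apply: key => n; rewrite (le_trans (hn _))// (le_trans (Fb _))//.
  by rewrite /edec normrN.
apply: complex_ext; rewrite /cintegral /=.
  apply: (@integral_derivative_eq0 _ (Re \o F) (Re \o f)) => //.
  - by move=> x; have [] := dF x.
  - by move=> x; have [] := cf x.
  - by have [] := h0 Re (@le_Re_normc R).
  - by have [] := h0 Re (@le_Re_normc R).
apply: (@integral_derivative_eq0 _ (Im \o F) (Im \o f)) => //.
- by move=> x; have [] := dF x.
- by move=> x; have [] := cf x.
- by have [] := h0 Im (@le_Im_normc R).
- by have [] := h0 Im (@le_Im_normc R).
Qed.

End CInt.

(** * Euler's integral and complex powers *)

Ltac rmeas := repeat first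
  [ assumption
  | lazymatch goal with
    | |- measurable_fun _ (fun _ => ?c) => exact: measurable_cst
    | |- measurable_fun _ (fun x => x) => exact: measurable_id
    | |- measurable_fun _ (fun x => x.1) => exact: measurable_fst
    | |- measurable_fun _ (fun x => x.2) => exact: measurable_snd
    | |- measurable_fun _ (fun x => x.1.1) => exact: (measurableT_comp measurable_fst measurable_fst)
    | |- measurable_fun _ (fun x => x.1.2) => exact: (measurableT_comp measurable_snd measurable_fst)
    | |- measurable_fun _ (fun x => _ + _) => apply: measurable_funD
    | |- measurable_fun _ (fun x => _ * _) => apply: measurable_funM
    | |- measurable_fun _ (fun x => - _) => apply: meas_N
    | |- measurable_fun _ (fun x => expR _) => apply: meas_expR
    | |- measurable_fun _ (fun x => cos _) => apply: meas_cos
    | |- measurable_fun _ (fun x => sin _) => apply: meas_sin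
    | |- measurable_fun _ (fun x => atan _) => apply: meas_atan
    | |- measurable_fun _ (fun x => ln _) => apply: meas_ln
    | |- measurable_fun _ expR => exact: measurable_expR
    | |- measurable_fun _ _ => first [exact: measurable_id | exact: mulrl_measurable]
    end ].
Ltac cmeas := repeat first
  [ assumption
  | lazymatch goal with
    | |- cmeas (fun _ => ?c) => apply: cmeas_cst
    | |- cmeas (fun x => _ + _) => apply: cmeasD
    | |- cmeas (fun x => _ * _) => apply: cmeasM
    | |- cmeas (fun x => - _) => apply: cmeasN
    | |- cmeas (fun x => cexp _) => apply: cmeas_cexp
    | |- cmeas (fun x => conjc _) => apply: cmeas_conjc
    | |- cmeas (fun x => (_)%:C) => apply: cmeasR; rmeas
    | |- cmeas (real_complex _) => apply: cmeasR; exact: measurable_id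
    end ].
Ltac ccont := repeat first
  [ assumption
  | lazymatch goal with
    | |- ccontat (fun _ => ?c) _ => apply: ccontat_cst
    | |- ccontat (fun x => _ + _) _ => apply: ccontatD
    | |- ccontat (fun x => _ * _) _ => apply: ccontatM
    | |- ccontat (fun x => - _) _ => apply: ccontatN
    | |- ccontat (fun x => cexp _) _ => apply: ccontat_cexp
    end ].

Section GammaIntegral.
Context {R : realType}.
Local Notation leb := (@lebesgue_measure R).
Local Notation RM := (measurableTypeR R).
Implicit Types (s w z : R[i]) (u x y : R).

(* Euler's integrand in the variable u = ln t, so that the integral [GI s w] is
   Gamma s * w ^ (- s). *)
Definition gexp s w u : R[i] := cexp (s * u%:C - w * (expR u)%:C).

Lemma normc_gexp s w u : Normc.normc (gexp s w u) = expR (Re s * u - Re w * expR u).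
Proof. by rewrite /gexp normc_cexp !reimE /= !mulr0 !subr0. Qed.

Lemma gexp_bound x y : 0 < x -> 0 < y -> exists C c, [/\ 0 <= C, 0 < c &
  forall u, expR (x * u - y * expR u) <= C * edec c u].
Proof.
move=> x0 y0; exists (expR ((x + 1) ^+ 2 / (2 * y))), (Num.min x 1); split.
- exact: expR_ge0.
- by rewrite lt_min x0 ltr01.
move=> u; rewrite /edec -expRD ler_expR.
have K0 : 0 <= (x + 1) ^+ 2 / (2 * y) by rewrite divr_ge0 ?sqr_ge0// mulr_ge0// ltW.
have e0 := expR_ge0 u.
have [u0|u0] := leP 0 u.
  rewrite ger0_norm//.
  have h1 : Num.min x 1 * u <= u by rewrite ler_piMl// ge_min lexx orbT.
  have h2 : u ^+ 2 / 2 <= expR u.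
    have := @expR_ge1Dxn R u 1 u0; rewrite (_ : 2`!%:R = 2)// => h.
    by apply: le_trans h; rewrite lerDr.
  have h3 : y * (u ^+ 2 / 2) <= y * expR u by rewrite ler_wpM2l// ltW.
  have h4 : 0 <= (y * u - (x + 1)) ^+ 2 / (2 * y).
    by rewrite divr_ge0 ?sqr_ge0// mulr_ge0// ltW.
  have h5 : (y * u - (x + 1)) ^+ 2 / (2 * y) =
    y * (u ^+ 2 / 2) - (x + 1) * u + (x + 1) ^+ 2 / (2 * y) by field; exact: lt0r_neq0.
  rewrite h5 in h4; lra.
rewrite ltr0_norm//.
have h1 : x * u <= Num.min x 1 * u by rewrite ler_wnM2r ?(ltW u0)// ge_min lexx.
have h2 : 0 <= y * expR u by rewrite mulr_ge0// ltW.
lra.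
Qed.

Lemma cmeas_gexp s w : @cmeas R _ RM (gexp s w).
Proof. by rewrite /gexp; cmeas. Qed.

Lemma gexp_ED1 s w : 0 < Re s -> 0 < Re w -> ED1 (gexp s w).
Proof.
move=> s0 w0; split; first exact: cmeas_gexp.
have [C [c [C0 c0 h]]] := gexp_bound s0 w0.
by exists C, c; split => // u; rewrite normc_gexp.
Qed.

Lemma is_cderive_gexp s w u :
  is_cderive (gexp s w) u ((s - w * (expR u)%:C) * gexp s w u).
Proof.
apply: is_cderive_cexp.
apply: (is_cderive_eq (is_cderiveD (is_cderiveM (is_cderive_cst s u) (is_cderive_id u))
  (is_cderiveN (is_cderiveM (is_cderive_cst w u) (is_cderiveR (is_derive_expR u)))))).
by rewrite !mul0r !add0r mulr1.
Qed.

Lemma ccontat_gexp s w u : ccontat (gexp s w) u.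
Proof. exact: (is_cderive_cont (is_cderive_gexp s w u)). Qed.

Lemma gexpS s w u : gexp (s + 1) w u = (expR u)%:C * gexp s w u.
Proof. by rewrite /gexp -cexpR -cexpD; congr cexp; ring. Qed.

Definition GI s w : R[i] := cint (gexp s w).

(** The difference of the two sides is the integral of the derivative of [gexp s w]. At w = 1 this
    is the functional equation of Gamma. *)
Lemma GI_rec s w : 0 < Re s -> 0 < Re w -> s * GI s w = w * GI (s + 1) w.
Proof.
move=> s0 w0.
have s10 : 0 < Re (s + 1) by rewrite cReD /= addr_gt0.
have i1 := ED1_integrable (gexp_ED1 s0 w0).
have i2 := ED1_integrable (gexp_ED1 s10 w0).
apply/eqP; rewrite -subr_eq0; apply/eqP.
rewrite -cintegralZ// -cintegralZ// -cintegralB; last 2 first.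
  exact: cintegrableZ.
  exact: cintegrableZ.
apply: (@cint_derivative_eq0 _ (gexp s w)).
- move=> u; apply: (is_cderive_eq (is_cderive_gexp s w u)).
  by rewrite gexpS; ring.
- by move=> u; ccont; exact: ccontat_gexp.
- by apply: cintegrableD; [|apply: cintegrableN]; exact: cintegrableZ.
- by have [_ [C [c [_ c0 h]]]] := gexp_ED1 s0 w0; exists C, c.
Qed.

(** Substitution t = exp u, where the Jacobian exp u raises the exponent z - 1 to z. The identity
    holds for every [z], because the extended real integrals of the positive and negative parts
    agree before [fine] is applied. *)
Lemma Gamma_eulerE z : Gamma_euler z = GI z 1.
Proof.
have DE : `]0, +oo[%classic = \bigcup_n `[expR (- n%:R), expR n%:R]%classic :> set R.
  apply/seteqP; split => x /=.
    rewrite in_itv/= andbT => x0; exists (Num.truncn `|ln x|).+1 => //.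
    rewrite /= in_itv/= -[x]lnK ?posrE// !ler_expR -ler_norml expRK.
    exact/ltW/Num.Theory.truncnS_gt.
  move=> [n _] /=; rewrite !in_itv/= andbT => /andP[h _].
  by apply: lt_le_trans h; exact: expR_gt0.
pose g t := cexp ((z - 1) * (ln t)%:C) * (expR (- t))%:C.
have gE u : g (expR u) * (expR u)%:C = gexp z 1 u.
  rewrite /g /gexp expRK -[(expR (- expR u))%:C]cexpR -[X in _ * X]cexpR -!cexpD.
  by congr cexp; rewrite rmorphN /=; ring.
have cg t : 0 < t -> ccontat g t.
  move=> t0; rewrite /g; ccont.
    by apply: ccontatR; exact: continuous_ln.
  apply: ccontatR; apply: continuous_comp; first exact: continuousN.
  exact: continuous_expR.
have mg : @cmeas R _ RM g by rewrite /g; cmeas.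
have mge : @cmeas R _ RM (g \o expR).
  by apply: (cmeas_comp mg); exact: measurable_expR.
have real (h : R[i] -> R) (hZ : forall (a : R) c, h (c * a%:C) = h c * a)
    (ch : forall t, 0 < t -> {for t, continuous (h \o g)})
    (mh : measurable_fun setT (h \o g)) (mhe : measurable_fun setT ((h \o g) \o expR)) :
    (\int[leb]_(t in `]0%R, +oo[) h (g t) = \int[leb]_u h (gexp z 1 u))%R.
  rewrite /Rintegral; congr fine.
  rewrite (@substitution_increasing _ expR expR _ _ _ _ _ _ DE (h \o g)) => //=.
  - by apply: eq_integral => u _; rewrite -hZ gE.
  - by move=> x y xy; rewrite ltr_expR.
  - exact: continuous_expR.
  - by move=> t; rewrite inE/= in_itv/= andbT => t0; exact: ch.
  - exact: measurable_funTS.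
apply: complex_ext.
  apply: (real (@complex.Re R)) => [a c|t t0||]; [by rewrite mulrC cReZ mulrC|by have [] := cg t t0|
    by case: mg|by case: mge].
apply: (real (@complex.Im R)) => [a c|t t0||]; [by rewrite mulrC cImZ mulrC|by have [] := cg t t0|
    by case: mg|by case: mge].
Qed.

Lemma GammaE z : 0 < Re z -> Gamma z = GI z 1.
Proof.
by move=> z0; rewrite /Gamma z0 big_ord0 divr1 addr0 Gamma_eulerE.
Qed.

Lemma GammaS z : 0 < Re z -> Gamma (z + 1) = z * Gamma z.
Proof.
move=> z0; have z1 : 0 < Re (z + 1) by rewrite cReD /= addr_gt0.
have o1 : 0 < Re (1 : R[i]) by rewrite /= ltr01.
by rewrite (GammaE z0) (GammaE z1) (GI_rec z0 o1) mul1r.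
Qed.

(** On the imaginary axis the definition of [Gamma] takes n = 1, that is, one step of the functional
    equation. At y = 0 the convention that the inverse of 0 is 0 matches the value 0 at a pole. *)
Lemma Gamma_Re0 y : Gamma ('i * y%:C) = Gamma ('i * y%:C + 1) / ('i * y%:C).
Proof.
have r0 : Re ('i * y%:C) = 0 :> R by rewrite /= mul0r mul1r subr0 || rewrite /=; ring.
rewrite {1}/Gamma r0 ltxx oppr0 Num.Theory.truncn0 /= big_ord1 addr0 /Gamma.
by rewrite cReD r0 add0r ltr01 big_ord0 divr1 addr0.
Qed.

(* The principal logarithm on 0 < Re w, where arg w = atan (Im w / Re w), and the
   power w ^ (- s). *)
Definition Plog w : R[i] := ln (Normc.normc w) +i* atan (Im w / Re w).
Definition P s w : R[i] := cexp (- (s * Plog w)).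

Lemma normc_Re_gt0 w : 0 < Re w -> 0 < Normc.normc w.
Proof. by move=> w0; apply: (lt_le_trans w0); rewrite (le_trans _ (le_Re_normc w))// ler_norm. Qed.

Lemma cexp_Plog w : 0 < Re w -> cexp (Plog w) = w.
Proof.
case: w => a b /= a0.
have n0 := @normc_Re_gt0 (a +i* b) a0.
have ss : Num.sqrt (a ^+ 2 + b ^+ 2) = a * Num.sqrt (1 + (b / a) ^+ 2).
  rewrite -[X in X * _]gtr0_norm// -sqrtr_sqr -sqrtrM ?sqr_ge0//; congr Num.sqrt.
  by field; exact: lt0r_neq0.
have sp : 0 < Num.sqrt (1 + (b / a) ^+ 2).
  by rewrite sqrtr_gt0 ltr_pwDl// sqr_ge0.
have c0 : cos (atan (b / a)) != 0 by rewrite cos_atan invr_eq0 gt_eqF.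
have st : sin (atan (b / a)) = (b / a) * cos (atan (b / a)).
  by rewrite -{2}[b / a]atanK /tan divfK.
apply: complex_ext; rewrite ?Re_cexp ?Im_cexp /= lnK ?posrE// ?st cos_atan ss; field.
  by rewrite gt_eqF.
by rewrite (gt_eqF a0) gt_eqF.
Qed.

Lemma atan_bounds x : - (pi / 2) < atan x < pi / 2.
Proof. by rewrite atan_gtNpi2 atan_ltpi2. Qed.

End GammaIntegral.

(** * Rotation of the contour in Euler's integral *)

Section Rotation.
Context {R : realType}.
Local Notation leb := (@lebesgue_measure R).
Local Notation RM := (measurableTypeR R).
Implicit Types (s w z : R[i]) (u x y : R).

Lemma is_cderive_int (f df : R -> R -> R[i]) (u v a : R) (G : R -> R) :
  u < a < v -> (forall t, u < t < v -> cintble (f t)) ->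
  (forall t y, u < t < v -> is_cderive (fun t => f t y) t (df t y)) ->
  leb.-integrable setT (EFin \o G) ->
  (forall t y, u < t < v -> Normc.normc (df t y) <= G y) ->
  is_cderive (fun t => cint (f t)) a (cint (df a)).
Proof.
move=> uav fi fd iG bG.
have G0 y : 0 <= G y by apply: le_trans (bG a y uav); exact: normc_ge0.
have real (h : R[i] -> R) (hn : forall z, `|h z| <= Normc.normc z)
  (hi : forall t, u < t < v -> leb.-integrable setT (EFin \o (fun y => h (f t y))))
  (hd : forall t y, u < t < v -> is_derive t (1 : R) (fun t => h (f t y)) (h (df t y))) :
  is_derive a (1 : R) (fun t => \int[leb]_y h (f t y))%R (\int[leb]_y h (df a y))%R.
  have Ia : `]u, v[%classic a by rewrite /= in_itv.
  have I1 x : `]u, v[%classic x -> leb.-integrable setT (EFin \o (fun y => h (f x y))).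
    by rewrite /= in_itv/=; exact: hi.
  have I2 x y : `]u, v[%classic x -> [set: RM] y -> derivable (fun t => h (f t y)) x 1.
    by rewrite /= in_itv/= => ux _; have [] := hd x y ux.
  have I3 x y : `]u, v[%classic x -> [set: RM] y -> `|partial1of2 (fun t y => h (f t y)) x y| <= G y.
    rewrite /= in_itv/= => ux _; rewrite partial1of2E; have [_ ->] := hd x y ux.
    exact: le_trans (hn _) (bG _ _ ux).
  have D1 := derivable_under_integral measurableT Ia I1 I2 G0 iG I3.
  have D2 := differentiation_under_integral measurableT Ia I1 I2 G0 iG I3.
  apply: DeriveDef => //.
  rewrite -derive1E D2; apply: eq_Rintegral => y _.
  by rewrite partial1of2E; have [_ ->] := hd a y uav.
split.
  apply: (real (@complex.Re R)); first exact: le_Re_normc.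
    by move=> t ut; have [] := fi t ut.
  by move=> t y ut; have [] := fd t y ut.
apply: (real (@complex.Im R)); first exact: le_Im_normc.
  by move=> t ut; have [] := fi t ut.
by move=> t y ut; have [] := fd t y ut.
Qed.

Lemma integrable_gexp_norm x y : 0 < x -> 0 < y ->
  leb.-integrable setT (EFin \o (fun u => expR (x * u - y * expR u))).
Proof.
move=> x0 y0; have := @gexp_ED1 R x%:C y%:C x0 y0.
move=> /ED1_integrable/cintegrable_normc; apply: eq_integrable => // u _.
by congr EFin; exact: normc_gexp.
Qed.

(* The derivative of [fun t => GI s (w ^ t)] is [- s * Log w] times the function
   itself, so that [GI s (w ^ t) * w ^ (s * t)] is constant. *)
Lemma GI_P s w : 0 < Re s -> 0 < Re w -> GI s w = GI s 1 * P s w.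
Proof.
move=> s0 w0; set L := Plog w; set l := Re L; set th := Im L.
have thb : `|th| < pi / 2 by rewrite ltr_norml atan_bounds.
have pi0 := @pi_gt0 R.
(* The margin [del] keeps (1 + del) |th| below pi / 2, so the path w ^ t stays in the right half
   plane on an open interval around [0, 1], where differentiation under the integral is possible. *)
pose del := (pi / 2 - `|th|) / pi.
have del0 : 0 < del by rewrite divr_gt0// subr_gt0.
have del1 : del <= 1 / 2.
  by rewrite ler_pdivrMr// mul1r mulrC gerBl.
have phib : (1 + del) * `|th| < pi / 2.
  have h1 : del * `|th| <= del * (pi / 2) by rewrite ler_wpM2l// ltW.
  have h2 : del * pi = pi / 2 - `|th| by rewrite /del divfK// gt_eqF.
  have h3 : del * (pi / 2) = (del * pi) / 2 by ring.
  by rewrite h3 h2 in h1; rewrite mulrDl mul1r; lra.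
pose W (t : R) := cexp (t%:C * L).
(* A lower bound for Re (w ^ t) uniform in t, using |t| <= 2 in the modulus and monotonicity of cos
   in the angle. It makes the dominating function exp (Re (s + 1) u - rho exp u) independent of
   t. *)
pose rho := expR (- (2 * `|l|)) * cos ((1 + del) * `|th|).
have dth0 : 0 <= (1 + del) * `|th| by rewrite mulr_ge0// addr_ge0// ltW.
have rho0 : 0 < rho.
  rewrite mulr_gt0 ?expR_gt0// cos_gt0_pihalf// phib andbT.
  by apply: lt_le_trans dth0; rewrite oppr_lt0 divr_gt0.
have Wn (t : R) : - del < t < 1 + del -> Normc.normc (W t) <= expR (2 * `|l|).
  move=> /andP[t1 t2]; rewrite normc_cexp cReZ ler_expR.
  have tn : `|t| <= 2 by rewrite ler_norml; apply/andP; split; lra.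
  by apply: (le_trans (ler_norm _)); rewrite normrM ler_wpM2r.
have WRe (t : R) : - del < t < 1 + del -> rho <= Re (W t).
  move=> /andP[t1 t2]; rewrite Re_cexp cReZ cImZ.
  have tn : `|t| <= 1 + del by rewrite ler_norml; apply/andP; split; lra.
  apply: ler_pM => //.
  - by rewrite cos_ge0_pihalf// (ltW phib) andbT (le_trans _ dth0)// oppr_le0 divr_ge0// ltW.
  - rewrite ler_expR lerNl -mulNr (le_trans (ler_norm _))// normrM normrN ler_wpM2r//.
    by apply: (le_trans tn); lra.
  - have -> : cos (t * Im L) = cos (`|t| * `|th|) by rewrite -normrM -/th; case: (ger0P (t * th)) => // _; rewrite cosN.
    have tt : `|t| * `|th| <= (1 + del) * `|th| by rewrite ler_wpM2r.
    have [->//|neq] := eqVneq (`|t| * `|th|) ((1 + del) * `|th|).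
    have a1 : `|t| * `|th| \in `[0, pi] by rewrite in_itv/= mulr_ge0//=; lra.
    have a2 : (1 + del) * `|th| \in `[0, pi] by rewrite in_itv/= dth0/=; lra.
    by rewrite ltW// ltr_cos// lt_neqAle neq.
have Wpos (t : R) : - del < t < 1 + del -> 0 < Re (W t).
  by move=> /WRe; exact: lt_le_trans.
have s10 : 0 < Re (s + 1) by rewrite cReD /= addr_gt0.
have dJ (t : R) : - del < t < 1 + del ->
    is_cderive (fun t => GI s (W t)) t (- (L * (s * GI s (W t)))).
  move=> tI; rewrite (GI_rec s0 (Wpos t tI)).
  have -> : - (L * (W t * GI (s + 1) (W t))) =
      cint (fun u => - (L * W t) * gexp (s + 1) (W t) u).
    rewrite cintegralZ; last by apply: ED1_integrable; apply: gexp_ED1 => //; exact: Wpos.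
    by rewrite -/(GI _ _); ring.
  have iG := integrable_gexp_norm s10 rho0.
  apply: (@is_cderive_int (fun t => gexp s (W t))
    (fun t u => - (L * W t) * gexp (s + 1) (W t) u) (- del) (1 + del) t
    (fun u => (Normc.normc L * expR (2 * `|l|)) * expR (Re (s + 1) * u - rho * expR u))) => //.
  - by move=> r rI; apply: ED1_integrable; apply: gexp_ED1 => //; exact: Wpos.
  - move=> r y rI; rewrite /gexp.
    have dW : is_cderive W r (L * W r).
      apply: is_cderive_cexp; apply: (is_cderive_eq (is_cderiveM (is_cderive_id r) (is_cderive_cst L r))).
      by rewrite mul1r mulr0 addr0.
    apply: (is_cderive_eq (is_cderive_cexp (is_cderiveD (is_cderive_cst (s * y%:C) r)
      (is_cderiveN (is_cderiveM dW (is_cderive_cst (expR y)%:C r)))))).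
    by rewrite -/(gexp s (W r) y) -/(gexp (s + 1) (W r) y) gexpS; ring.
  - exact: (integrableZl measurableT _ iG).
  - move=> r y rI; rewrite Normc.normcM normcN normc_gexp Normc.normcM.
    apply: ler_pM; rewrite ?mulr_ge0 ?normc_ge0 ?expR_ge0//.
      by rewrite ler_wpM2l ?normc_ge0// Wn.
    by rewrite ler_expR lerD2l lerN2 ler_wpM2r ?expR_ge0// WRe.
have dH (t : R) : 0 <= t <= 1 ->
    is_cderive (fun t => cexp (s * L * t%:C) * GI s (W t)) t 0.
  move=> /andP[t0 t1]; have tI : - del < t < 1 + del by apply/andP; split; lra.
  apply: (is_cderive_eq (is_cderiveM (is_cderive_cexp (is_cderiveM
     (is_cderive_cst (s * L) t) (is_cderive_id t))) (dJ t tI))).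
  by ring.
have := @is_cderive0_eq R _ 0 1 ler01 dH.
rewrite /W mulr0 cexp0 !mul1r mul0r cexp0 mulr1 (cexp_Plog w0) => ->.
by rewrite mulrAC /P -cexpD subrr cexp0 mul1r.
Qed.

End Rotation.

(** * Decay of the Gamma function on vertical lines *)

Section PowerGamma.
Context {R : realType}.
Local Notation leb := (@lebesgue_measure R).
Local Notation RM := (measurableTypeR R).
Implicit Types (s w z : R[i]) (u x y t : R).

Lemma GI_Gamma s w : 0 < Re s -> 0 < Re w -> GI s w = Gamma s * P s w.
Proof. by move=> s0 w0; rewrite GI_P// -GammaE. Qed.

Lemma Plog_cexp z : - (pi / 2) < Im z < pi / 2 -> Plog (cexp z) = z.
Proof.
case: z => x y /= yb.
rewrite /Plog normc_cexp Re_cexp Im_cexp /= expRK -mulf_div divff ?mul1r ?gt_eqF ?expR_gt0//.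
by rewrite -/(tan y) tanK// in_itv/=.
Qed.

Lemma cos_gt0_lt_pihalf y : `|y| < pi -> 0 < cos y -> `|y| < pi / 2.
Proof.
move=> yp; have -> : cos y = cos `|y| by case: (ger0P y) => // _; rewrite cosN.
apply: contraTT; rewrite -!leNgt => h.
have pi0 := @pi_gt0 R.
rewrite -cos_pihalf; have [->//|neq] := eqVneq (pi / 2) `|y|.
have a1 : `|y| \in `[0, pi] by rewrite in_itv/= normr_ge0 ltW.
have a2 : (pi / 2 : R) \in `[(0 : R), pi] by rewrite in_itv/=; apply/andP; split; lra.
by rewrite ltW// ltr_cos// lt_neqAle neq.
Qed.

(** Each argument lies strictly within pi / 2, so the sum lies within pi; a product with positive
    real part then has cos of the sum positive, which forces the sum within pi / 2. Hence no
    multiple of 2 pi i appears. *)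
Lemma Plog_mul w1 w2 : 0 < Re w1 -> 0 < Re w2 -> 0 < Re (w1 * w2) ->
  Plog (w1 * w2) = Plog w1 + Plog w2.
Proof.
move=> h1 h2 h12; rewrite -[in LHS](cexp_Plog h1) -[in LHS](cexp_Plog h2) -cexpD.
apply: Plog_cexp; rewrite -ltr_norml; apply: cos_gt0_lt_pihalf.
  have := atan_bounds (Im w1 / Re w1); have := atan_bounds (Im w2 / Re w2).
  by move=> /andP[a b] /andP[c d]; rewrite cImD /= ltr_norml; apply/andP; split; lra.
have : 0 < Re (cexp (Plog w1 + Plog w2)) by rewrite cexpD !cexp_Plog.
by rewrite Re_cexp pmulr_rgt0 ?expR_gt0.
Qed.

Lemma P_mul s w1 w2 : 0 < Re w1 -> 0 < Re w2 -> 0 < Re (w1 * w2) ->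
  P s (w1 * w2) = P s w1 * P s w2.
Proof. by move=> h1 h2 h12; rewrite /P Plog_mul// mulrDr opprD cexpD. Qed.

Lemma P_real s x : 0 < x -> P s x%:C = cexp (- (s * (ln x)%:C)).
Proof.
move=> x0; rewrite /P /Plog normcR /= mul0r atan0 gtr0_norm//.
Qed.

Lemma PD s s' w : P (s + s') w = P s w * P s' w.
Proof. by rewrite /P mulrDl opprD cexpD. Qed.

Lemma P1_inv w : 0 < Re w -> P 1 w = w^-1.
Proof. by move=> w0; rewrite /P mul1r cexpN cexp_Plog. Qed.

Lemma P_cexp s z : - (pi / 2) < Im z < pi / 2 -> P s (cexp z) = cexp (- (s * z)).
Proof. by move=> h; rewrite /P Plog_cexp. Qed.

Lemma P_bound s w m : 0 < Re w -> 0 <= Re s -> expR m <= Normc.normc w ->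
  Normc.normc (P s w) <= expR (`|Im s| * (pi / 2)) * expR (- (Re s * m)).
Proof.
move=> w0 s0 mw; rewrite /P normc_cexp -expRD ler_expR cReN cReM /=.
have n0 := normc_Re_gt0 w0.
have h1 : Re s * m <= Re s * ln (Normc.normc w).
  by rewrite ler_wpM2l// -ler_expR lnK.
have h2 : Im s * atan (Im w / Re w) <= `|Im s| * (pi / 2).
  apply: (le_trans (ler_norm _)); rewrite normrM ler_wpM2l// ltW// ltr_norml.
  exact: atan_bounds.
lra.
Qed.

Lemma cmeas_P s {d} {T : measurableType d} (f : T -> R[i]) : cmeas f ->
  (forall p, 0 < Re (f p)) -> cmeas (fun p => P s (f p)).
Proof.
move=> mf f0; rewrite /P; apply: cmeas_cexp; apply: cmeasN; apply: cmeasM.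
  exact: cmeas_cst.
split => /=; rewrite /comp /Plog /=.
  by apply: meas_ln; exact: cmeas_normc.
apply: meas_atan; apply: measurable_funM; first exact: cmeas_Im.
by apply: meas_inv => //; exact: cmeas_Re.
Qed.

Lemma ccontat_P s (f : R -> R[i]) x : ccontat f x -> 0 < Re (f x) ->
  ccontat (fun x => P s (f x)) x.
Proof.
move=> [f1 f2] f0; rewrite /P; apply: ccontat_cexp; apply: ccontatN; apply: ccontatM.
  exact: ccontat_cst.
split; rewrite /comp /Plog /=.
  rewrite (_ : (fun x => _) = (fun x => ln (Num.sqrt (Re (f x) * Re (f x) + Im (f x) * Im (f x))))); last first.
    by apply/funext => y; case: (f y).
  apply: continuous_comp; last first.
    by apply: continuous_ln; rewrite sqrtr_gt0 -!expr2 ltr_pwDl ?sqr_ge0// exprn_gt0.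
  apply: continuous_comp; last exact: sqrt_continuous.
  exact: (continuousD (continuousM f1 f1) (continuousM f2 f2)).
apply: continuous_comp; last exact: continuous_atan.
have fn0 : (Re \o f) x != 0 by rewrite gt_eqF.
exact: (continuousM f2 (continuousV fn0 f1)).
Qed.

Lemma ccont_int (f : R -> R -> R[i]) (G : R -> R) a :
  (forall t, @cmeas R _ RM (f t)) -> (forall t u, ccontat (f ^~ u) t) ->
  leb.-integrable setT (EFin \o G) -> (forall t u, Normc.normc (f t u) <= G u) ->
  ccontat (fun t => cint (f t)) a.
Proof.
move=> mf cf iG bG.
have aI : a \in `]a - 1, a + 1[%classic by rewrite inE /= in_itv/=; lra.
have fi t : cintble (f t) by exact: cintegrable_bound (mf t) iG (bG t).
split.
  apply: (@continuity_under_integral R _ _ leb (fun t u => Re (f t u)) setT measurableT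
    (a - 1) (a + 1) _ _ G iG _ a aI).
  - by move=> x _; have [] := fi x.
  - by apply: aeW => u _ t _; have [] := cf t u.
  - by move=> x _; apply: aeW => u _; exact: le_trans (le_Re_normc _) (bG x u).
apply: (@continuity_under_integral R _ _ leb (fun t u => Im (f t u)) setT measurableT
    (a - 1) (a + 1) _ _ G iG _ a aI).
- by move=> x _; have [] := fi x.
- by apply: aeW => u _ t _; have [] := cf t u.
- by move=> x _; apply: aeW => u _; exact: le_trans (le_Im_normc _) (bG x u).
Qed.

Lemma ReDi a t : Re (a + 'i * t%:C) = Re a.
Proof. by rewrite cReD cReM /=; ring. Qed.

Lemma ImDi a t : Im (a + 'i * t%:C) = Im a + t.
Proof. by rewrite cImD cImM /=; ring. Qed.

Lemma Gamma_vert_cont a t : 0 < Re a -> ccontat (fun t => Gamma (a + 'i * t%:C)) t.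
Proof.
move=> a0.
rewrite (_ : (fun t => _) = (fun t => cint (gexp (a + 'i * t%:C) 1))); last first.
  by apply/funext => y; rewrite GammaE// ReDi.
apply: (@ccont_int _ (fun u => expR (Re a * u - 1 * expR u))).
- by move=> y; exact: cmeas_gexp.
- move=> y u; rewrite /gexp; ccont.
  exact: (is_cderive_cont (is_cderive_id y)).
- exact: integrable_gexp_norm.
- by move=> y u; rewrite normc_gexp ReDi.
Qed.

Lemma cmeas_Gamma a {d} {T : measurableType d} (r : T -> R) : 0 < Re a ->
  measurable_fun setT r -> cmeas (fun p => Gamma (a + 'i * (r p)%:C)).
Proof.
move=> a0 mr; apply: (@cmeas_comp _ _ _ T RM (fun t => Gamma (a + 'i * t%:C))) => //.
by apply: ccont_meas => t; exact: Gamma_vert_cont.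
Qed.

(** Evaluate [GI_Gamma] at w = exp (i e) with e = th or e = - th. The power of w has modulus exp (e
    (Im a + t)), while the integral is bounded uniformly in t because Re w = cos th > 0. Choosing e
    with the sign of t gives decay at rate th. *)
Lemma Gamma_decay a (th : R) : 0 < Re a -> 0 <= th < pi / 2 ->
  exists2 C, 0 <= C & forall t, Normc.normc (Gamma (a + 'i * t%:C)) <= C * expR (- (th * `|t|)).
Proof.
move=> a0 /andP[th0 thp].
have c0 : 0 < cos th.
  by rewrite cos_gt0_pihalf// thp (lt_le_trans _ th0)// oppr_lt0 divr_gt0// pi_gt0.
have key (t e : R) : e = th \/ e = - th ->
    Normc.normc (Gamma (a + 'i * t%:C)) * expR (e * (Im a + t)) <=
    2 * (\int[leb]_u expR (Re a * u - cos th * expR u))%R.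
  move=> he.
  have eb : - (pi / 2) < Im ('i * e%:C : R[i]) < pi / 2.
    rewrite -ltr_norml cImM /= mul0r add0r mul1r.
    by case: he => ->; rewrite ?normrN ger0_norm.
  have ec : cos (Im ('i * e%:C : R[i])) = cos th.
    by rewrite cImM /= mul0r add0r mul1r; case: he => ->; rewrite ?cosN.
  have er : Re ('i * e%:C : R[i]) = 0 by rewrite cReM /=; ring.
  have w0 : 0 < Re (cexp ('i * e%:C : R[i])).
    by rewrite Re_cexp ec er expR0 mul1r.
  have s0 : 0 < Re (a + 'i * t%:C) by rewrite ReDi.
  have -> : expR (e * (Im a + t)) = Normc.normc (P (a + 'i * t%:C) (cexp ('i * e%:C))).
    rewrite P_cexp// normc_cexp; congr expR.
    by rewrite cReN cReM ReDi ImDi er cImM /=; ring.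
  rewrite -Normc.normcM -GI_Gamma//.
  have iG := integrable_gexp_norm a0 c0.
  apply: (normc_cintegral_le (cmeas_gexp _ _) iG) => u.
  by rewrite normc_gexp ReDi Re_cexp er expR0 mul1r ec.
pose K : R := (2 * (\int[leb]_u expR (Re a * u - cos th * expR u))%R).
have K0 : 0 <= K.
  by rewrite mulr_ge0// Rintegral_ge0// => u _; exact: expR_ge0.
exists (K * expR (th * `|Im a|)); first by rewrite mulr_ge0 ?expR_ge0.
move=> t.
have hh (e : R) : e = th \/ e = - th -> th * `|t| - th * `|Im a| <= e * (Im a + t) ->
    Normc.normc (Gamma (a + 'i * t%:C)) <= K * expR (th * `|Im a|) * expR (- (th * `|t|)).
  move=> he hle; have : _ <= K := key t e he; rewrite -ler_pdivlMr ?expR_gt0// => h.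
  apply: (le_trans h); rewrite -expRN -mulrA -expRD ler_wpM2l// ler_expR; lra.
have ia := ler_wpM2l th0 (ler_norm (Im a)).
have ia' : th * (- Im a) <= th * `|Im a| by rewrite ler_wpM2l// -normrN ler_norm.
rewrite mulrN in ia'.
have [t0|t0] := leP 0 t.
  by apply: (hh th); [left|rewrite ger0_norm// mulrDr; lra].
by apply: (hh (- th)); [right|rewrite ltr0_norm// mulNr mulrDr mulrN; lra].
Qed.

Lemma Gamma_ED1 a : 0 < Re a -> ED1 (fun t => Gamma (a + 'i * t%:C)).
Proof.
move=> a0; split; first by apply: cmeas_Gamma => //; exact: measurable_id.
have pi0 := @pi_gt0 R.
have [|C C0 h] := @Gamma_decay a (pi / 4) a0; first by lra.
exists C, (pi / 4); split => //; first lra.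
Qed.

End PowerGamma.

(** * The beta integral *)

Section FubiniDominated.
Context {R : realType}.
Local Notation leb := (@lebesgue_measure R).
Local Notation RM := (measurableTypeR R).

Lemma cfubini_swap (F : R -> R -> R[i]) :
  cintegrable (leb \x leb)%E setT (fun p : RM * RM => F p.1 p.2) ->
  (forall x, cintble (F x)) -> (forall y, cintble (F ^~ y)) ->
  cint (fun x => cint (F x)) = cint (fun y => cint (F ^~ y)).
Proof.
move=> fi f1 f2.
rewrite -(@cfubini _ _ _ _ _ leb leb F fi f1).
have [i1 i2] := fi.
apply: complex_ext; rewrite /cintegral /= /Rintegral.
  rewrite -(integral21_prod_meas1 i1); congr fine; apply: eq_integral => y _.
  by rewrite /fubini_G fineK//; apply: integrable_fin_num => //; case: (f2 y).
rewrite -(integral21_prod_meas1 i2); congr fine; apply: eq_integral => y _.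
by rewrite /fubini_G fineK//; apply: integrable_fin_num => //; case: (f2 y).
Qed.

Lemma integrable_prod (f g : R -> R) : leb.-integrable setT (EFin \o f) ->
  leb.-integrable setT (EFin \o g) ->
  (leb \x leb)%E.-integrable setT (EFin \o (fun p : RM * RM => f p.1 * g p.2)).
Proof.
move=> /integrableP[mf fi] /integrableP[mg gi].
have mf' : measurable_fun setT f by exact/measurable_EFinP.
have mg' : measurable_fun setT g by exact/measurable_EFinP.
have mfg : measurable_fun setT (EFin \o (fun p : RM * RM => f p.1 * g p.2)).
  apply/measurable_EFinP; apply: measurable_funM.
    exact: (measurableT_comp mf').
  exact: (measurableT_comp mg').
apply: ((@integrable12ltyP _ _ _ _ R leb leb _ mfg).2).
rewrite (@eq_integral _ _ _ _ _ (fun x : RM => (\int[leb]_y `|(g y)%:E|) * `|(f x)%:E|)%E).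
  rewrite ge0_integralZl//; last 2 first.
    by apply: measurableT_comp.
    by apply: integral_ge0.
  by rewrite lte_mul_pinfty//; [apply: integral_ge0|rewrite ge0_fin_numE//; apply: integral_ge0].
move=> x _.
under eq_integral do rewrite /= normrM EFinM.
rewrite (@ge0_integralZl_EFin _ _ _ leb setT measurableT (fun y => `|g y|%:E))//.
- exact: muleC.
- by apply/measurable_EFinP; exact: measurableT_comp.
Qed.

(** For kernels in which an oscillating factor couples x and y, with a product bound by integrable
    functions that need not decay exponentially. *)
Lemma cfubini_dom (F : R -> R -> R[i]) (f g : R -> R) :
  @cmeas R _ (RM * RM)%type (fun p => F p.1 p.2) ->
  leb.-integrable setT (EFin \o f) -> leb.-integrable setT (EFin \o g) ->
  (forall x y, Normc.normc (F x y) <= f x * g y) ->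
  cint (fun x => cint (F x)) = cint (fun y => cint (F ^~ y)).
Proof.
move=> mF fi gi Fb; apply: cfubini_swap.
- by apply: (cintegrable_bound mF (integrable_prod fi gi)) => p; exact: Fb.
- move=> x; apply: (cintegrable_bound _ (integrableZl measurableT (f x) gi)) => //.
  exact: (cmeas_comp mF (measurable_pair1 x)).
- move=> y.
  have ig : leb.-integrable setT (EFin \o (fun x => f x * g y)).
    have := integrableZl measurableT (g y) fi; apply: eq_integrable => // x _.
    by rewrite /= -EFinM mulrC.
  apply: (cintegrable_bound _ ig) => //.
  exact: (cmeas_comp mF (measurable_pair2 y)).
Qed.

End FubiniDominated.

(** * Further closure properties of the decay classes, and the coordinates u + v, u - v *)

Section Decay2.
Context {R : realType}.
Local Notation leb := (@lebesgue_measure R).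
Local Notation RM := (measurableTypeR R).

Lemma ED1M_bdd (f g : R -> R[i]) : @cmeas R _ RM g -> (exists K, forall x, Normc.normc (g x) <= K) ->
  ED1 f -> ED1 (fun x => f x * g x).
Proof.
move=> mg [K gK] [mf [C [c [C0 c0 fb]]]]; split; first exact: cmeasM.
have K0 : 0 <= K by apply: le_trans (gK 0); exact: normc_ge0.
exists (C * K), c; split => //; first exact: mulr_ge0.
move=> x; rewrite Normc.normcM mulrAC.
by apply: ler_pM => //; exact: normc_ge0.
Qed.

Lemma ED1_bdd (f : R -> R[i]) : ED1 f -> exists K, forall x, Normc.normc (f x) <= K.
Proof.
move=> [mf [C [c [C0 c0 fb]]]]; exists C => x; apply: (le_trans (fb x)).
by rewrite ler_piMr// edec_le1// ltW.
Qed.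

Lemma ED1M (f g : R -> R[i]) : ED1 f -> ED1 g -> ED1 (fun x => f x * g x).
Proof. by move=> fe ge; apply: ED1M_bdd => //; [case: ge|exact: ED1_bdd]. Qed.

Lemma ED1_opp (f : R -> R[i]) : ED1 f -> ED1 (fun x => f (- x)).
Proof.
move=> [mf [C [c [C0 c0 fb]]]]; split.
  apply: (@cmeas_comp _ _ _ RM RM f) => //; apply: meas_N; exact: measurable_id.
by exists C, c; split => // x; rewrite (le_trans (fb _))// /edec normrN.
Qed.

Lemma ED1_ext (f g : R -> R[i]) : f =1 g -> ED1 f -> ED1 g.
Proof. by move=> /funext ->. Qed.

Lemma ED2_ext (f g : R -> R -> R[i]) : (forall x y, f x y = g x y) -> ED2 f -> ED2 g.
Proof. by move=> h; rewrite (_ : f = g)//; apply/funext => x; apply/funext => y. Qed.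

Lemma ED3_ext (f g : R -> R -> R -> R[i]) : (forall x y z, f x y z = g x y z) -> ED3 f -> ED3 g.
Proof.
move=> h; rewrite (_ : f = g)//; apply/funext => x; apply/funext => y.
by apply/funext => z.
Qed.

Lemma ED2_prod (f g : R -> R[i]) : ED1 f -> ED1 g -> ED2 (fun x y => f x * g y).
Proof.
move=> [mf [C [c [C0 c0 fb]]]] [mg [D [d [D0 d0 gb]]]]; split.
  apply: cmeasM.
    exact: (cmeas_comp mf measurable_fst).
  exact: (cmeas_comp mg measurable_snd).
exists (C * D), (Num.min c d); split; [exact: mulr_ge0|by rewrite lt_min c0|].
move=> x y; rewrite Normc.normcM mulrACA.
apply: ler_pM; rewrite ?normc_ge0//.
  by apply: (le_trans (fb x)); rewrite ler_wpM2l// edec_le// ge_min lexx.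
by apply: (le_trans (gb y)); rewrite ler_wpM2l// edec_le// ge_min lexx orbT.
Qed.

(** The lower bound on |p| + |q| is coercivity of the change of variables: the rate c becomes c * k,
    and the offset [K] is absorbed by the constant. *)
Lemma ED2_comp (F : R -> R -> R[i]) (p q : R -> R -> R) (k K : R) : 0 < k ->
  measurable_fun [set: RM * RM] (fun z : RM * RM => p z.1 z.2) ->
  measurable_fun [set: RM * RM] (fun z : RM * RM => q z.1 z.2) ->
  (forall x y, k * (`|x| + `|y|) - K <= `|p x y| + `|q x y|) ->
  ED2 F -> ED2 (fun x y => F (p x y) (q x y)).
Proof.
move=> k0 mp mq hpq [mF [C [c [C0 c0 Fb]]]]; split.
  have := @cmeas_comp _ _ _ (RM * RM)%type (RM * RM)%type _
    (fun z => (p z.1 z.2, q z.1 z.2)) mF.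
  by apply; exact: measurable_fun_pair.
exists (C * expR (c * K)), (c * k); split; rewrite ?mulr_ge0 ?expR_ge0 ?mulr_gt0//.
move=> x y; apply: (le_trans (Fb _ _)); rewrite -mulrA ler_wpM2l//.
rewrite /edec -!expRD ler_expR.
by have := ler_wpM2l (ltW c0) (hpq x y); rewrite !mulrBr !mulrDr !mulrA; lra.
Qed.

Lemma ED2_sumdiff (F : R -> R -> R[i]) : ED2 F -> ED2 (fun u v => F (u + v) (u - v)).
Proof.
move=> FE; apply: (@ED2_comp F (fun u v => u + v) (fun u v => u - v) 1 0) => //.
- by rmeas.
- by rmeas.
- move=> x y; rewrite mul1r subr0.
  case: (ger0P x) => hx; case: (ger0P y) => hy; case: (ger0P (x + y)) => h1;
  case: (ger0P (x - y)) => h2; lra.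
Qed.

(** The factor 2 is the Jacobian of (u, v) -> (u + v, u - v). It is obtained from one-dimensional
    changes of variables and Fubini: q = x + y at fixed y, then y = q / 2 - v at fixed q, and
    finally q = 2 u. *)
Lemma cint_sumdiff (F : R -> R -> R[i]) : ED2 F ->
  cint (fun x => cint (F x)) = 2 * cint (fun u => cint (fun v => F (u + v) (u - v))).
Proof.
move=> FE; rewrite (ED2_fubini FE).
pose H q y := F (q - y) y.
have HE : ED2 H.
  apply: (@ED2_comp F (fun q y => q - y) (fun q y => y) (1/2) 0) => //.
  - by rmeas.
  - by rmeas.
  - move=> x y; rewrite subr0.
    case: (ger0P x) => hx; case: (ger0P y) => hy; case: (ger0P (x - y)) => h2; lra.
transitivity (cint (fun y => cint (H ^~ y))).
  apply: eq_cintegral => y; rewrite -(@cint_shift _ (F ^~ y) (- y))//.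
  by apply: ED1_integrable; exact: ED2_snd.
rewrite -(ED2_fubini HE).
have E q : cint (H q) = cint (fun v => F (q / 2 + v) (q / 2 - v)).
  have := @cint_affine _ (H q) (-1) (q / 2) _ (ED1_integrable (ED2_fst q HE)).
  rewrite oppr_eq0 oner_neq0 normrN normr1 invr1 mul1r => /(_ isT) <-.
  by apply: eq_cintegral => v; rewrite /H; congr F; [field|ring].
have HI := ED2_int HE.
have := @cint_affine _ (fun q => cint (H q)) 2 0 _ (ED1_integrable HI).
rewrite pnatr_eq0/= => /(_ isT) h.
have -> : cint (fun q => cint (H q)) = 2 * (`|2|^-1%:C * cint (fun q => cint (H q))).
  rewrite ger0_norm// rmorphV ?unitfE ?pnatr_eq0//= mulrA.
  by rewrite (_ : (2 : R)%:C = 2) ?rmorph_nat// divff ?mul1r// pnatr_eq0.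
rewrite -h; congr (2 * _); apply: eq_cintegral => u; rewrite E.
by apply: eq_cintegral => v; congr F; field.
Qed.

End Decay2.

Section Beta.
Context {R : realType}.
Local Notation leb := (@lebesgue_measure R).
Local Notation RM := (measurableTypeR R).
Implicit Types (s w z S : R[i]).

Lemma beta_ED2 z S w1 w2 : 0 < Re z -> 0 < Re (S - z) -> 0 < Re w1 -> 0 < Re w2 ->
  ED2 (fun u r => gexp (S - z) w1 r * gexp z w2 (u + r)).
Proof.
move=> z0 Sz0 w10 w20.
have h := ED2_prod (gexp_ED1 Sz0 w10) (gexp_ED1 z0 w20).
apply: (@ED2_comp _ _ (fun u r => r) (fun u r => u + r) (1/2) 0 _ _ _ _ h) => //.
- by rmeas.
- by rmeas.
- move=> x y; rewrite subr0.
  case: (ger0P x) => hx; case: (ger0P y) => hy; case: (ger0P (x + y)) => h2; lra.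
Qed.

(** In the product of the two Euler integrals, shift one variable by the other: the exponents z and
    S - z add up to S, and the inner integral in r is [GI S] at w1 + w2 exp u. This is the beta
    integral of x ^ (z - 1) (w1 + w2 x) ^ (- S) multiplied by Gamma S. *)
Lemma beta_ED1 z S w1 w2 : 0 < Re z -> 0 < Re (S - z) -> 0 < Re w1 -> 0 < Re w2 ->
  ED1 (fun u => cexp (z * u%:C) * GI S (w1 + w2 * (expR u)%:C)) /\
  cint (fun u => cexp (z * u%:C) * GI S (w1 + w2 * (expR u)%:C)) = GI z w2 * GI (S - z) w1.
Proof.
move=> z0 Sz0 w10 w20.
have E := beta_ED2 z0 Sz0 w10 w20.
have S0 : 0 < Re S by have := addr_gt0 z0 Sz0; rewrite -cReD addrC subrK.
have F u : cint (fun r => gexp (S - z) w1 r * gexp z w2 (u + r)) =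
    cexp (z * u%:C) * GI S (w1 + w2 * (expR u)%:C).
  rewrite /GI -cintegralZ; last first.
    apply: ED1_integrable; apply: gexp_ED1 => //.
    by rewrite cReD cReM /= mulr0 subr0 addr_gt0// mulr_gt0// expR_gt0.
  apply: eq_cintegral => r; rewrite /gexp -!cexpD expRD rmorphD rmorphM; congr cexp.
  by ring.
split.
  by apply: ED1_ext (ED2_int E) => u; rewrite F.
transitivity (cint (fun u => cint (fun r => gexp (S - z) w1 r * gexp z w2 (u + r)))).
  by apply: eq_cintegral => u; rewrite F.
rewrite (ED2_fubini E) /GI -cintegralZ; last first.
  by apply: ED1_integrable; exact: gexp_ED1.
apply: eq_cintegral => r.
rewrite cintegralZ; last first.
  by apply: (@cintble_shift _ (gexp z w2) r); apply: ED1_integrable; exact: gexp_ED1.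
have Es : cint (fun u => gexp z w2 (u + r)) = cint (gexp z w2).
  by apply: (@cint_shift _ (gexp z w2) r); apply: ED1_integrable; exact: gexp_ED1.
by rewrite Es mulrC.
Qed.

End Beta.

(** * Fourier inversion *)

Section GaussFourier.
Context {R : realType}.
Local Notation leb := (@lebesgue_measure R).
Local Notation RM := (measurableTypeR R).

Lemma gauss_edec (c x : R) : gauss_fun x <= expR (c ^+ 2 / 4) * edec c x.
Proof.
rewrite /gauss_fun /edec -expRD ler_expR.
have : 0 <= (`|x| - c / 2) ^+ 2 by exact: sqr_ge0.
rewrite sqrrB real_normK ?num_real//; lra.
Qed.

Definition gauss_wave (v s : R) : R[i] := (gauss_fun s)%:C * cexp ('i * (v * s)%:C).

Lemma normc_wave (x : R) : Normc.normc (cexp ('i * x%:C)) = 1 :> R.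
Proof. by rewrite normc_cexp cReM /= mul0r mulr0 subrr expR0. Qed.

Lemma normc_gauss_wave v s : Normc.normc (gauss_wave v s) = gauss_fun s.
Proof. by rewrite normcZ normc_wave mulr1 ger0_norm// gauss_fun_ge0. Qed.

Lemma measurable_gauss : measurable_fun [set: RM] (@gauss_fun R).
Proof. exact: measurable_gauss_fun. Qed.

Lemma cmeas_gauss_wave v : @cmeas R _ RM (gauss_wave v).
Proof.
by rewrite /gauss_wave; cmeas; exact: measurable_gauss.
Qed.

Lemma is_cderive_gauss_wave v s :
  is_cderive (gauss_wave v) s ((- (2 * s))%:C * gauss_wave v s + 'i * v%:C * gauss_wave v s).
Proof.
have dg : is_derive s (1 : R) (@gauss_fun R) (- (2 * s) * gauss_fun s).
  by rewrite /gauss_fun; apply: is_derive_eq; rewrite /GRing.scale /=; ring.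
have dl : is_cderive (fun s => 'i * (v * s)%:C) s ('i * v%:C).
  have h := is_cderiveM (is_cderive_cst ('i * v%:C) s) (is_cderive_id s).
  apply: (is_cderive_eq (is_cderive_ext _ h)); last by ring.
  by move=> y; rewrite rmorphM /=; ring.
apply: (is_cderive_eq (is_cderiveM (is_cderiveR dg) (is_cderive_cexp dl))).
by rewrite /gauss_wave rmorphM /=; ring.
Qed.

Definition gaussFT v := cint (gauss_wave v).

Lemma gauss_wave_int v : cintble (gauss_wave v).
Proof.
apply: (cintegrable_bound (cmeas_gauss_wave v) (@integrableT_gauss R)) => s.
by rewrite normc_gauss_wave.
Qed.

Lemma gauss_wave_bound v s :
  Normc.normc (s%:C * gauss_wave v s) <= expR 1 * edec 1 s.
Proof.
rewrite normcZ normc_gauss_wave.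
have h1 : `|s| <= expR `|s| by apply: le_trans (expR_ge1Dx _); rewrite lerDr.
have h2 := gauss_edec 2 s.
apply: (le_trans (ler_pM _ _ h1 h2)) => //; first exact: gauss_fun_ge0.
rewrite /edec -!expRD ler_expR; lra.
Qed.

Lemma gauss_wave_int1 v : cintble (fun s => s%:C * gauss_wave v s).
Proof.
have ie := integrableZl measurableT (expR 1) (@integrable_edec R 1 ltr01).
apply: (cintegrable_bound _ ie) => [|s]; last exact: gauss_wave_bound.
apply: cmeasM; last exact: cmeas_gauss_wave.
by apply: cmeasR; exact: measurable_id.
Qed.

Lemma gauss_by_parts v :
  cint (fun s => s%:C * gauss_wave v s) = 'i * v%:C / 2 * gaussFT v.
Proof.
have h0 : cint (fun s => (- 2) * (s%:C * gauss_wave v s) + 'i * v%:C * gauss_wave v s) = 0.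
  apply: (@cint_derivative_eq0 _ (gauss_wave v)).
  - move=> s; apply: (is_cderive_eq (is_cderive_gauss_wave v s)).
    by rewrite rmorphN rmorphM /= rmorph_nat; ring.
  - have cw s := is_cderive_cont (is_cderive_gauss_wave v s).
    move=> s; ccont; last exact: cw.
      exact: (is_cderive_cont (is_cderive_id s)).
    exact: cw.
  - apply: cintegrableD; apply: cintegrableZ; first exact: gauss_wave_int1.
    exact: gauss_wave_int.
  - exists (expR (1 ^+ 2 / 4)), 1; split => // s.
    by rewrite normc_gauss_wave; exact: gauss_edec.
move: h0; rewrite cintegralD; last 2 first.
- by apply: cintegrableZ; exact: gauss_wave_int1.
- by apply: cintegrableZ; exact: gauss_wave_int.
rewrite cintegralZ; last exact: gauss_wave_int1.
rewrite cintegralZ; last exact: gauss_wave_int.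
rewrite -/(gaussFT v) => h.
have n2 : (2 : R[i]) != 0 by rewrite pnatr_eq0.
apply: (mulfI n2).
have -> : 2 * ('i * v%:C / 2 * gaussFT v) = 'i * v%:C * gaussFT v by field.
by apply/eqP; rewrite eq_sym -subr_eq0 addrC -mulNr h.
Qed.

Lemma is_cderive_gaussFT v : is_cderive gaussFT v (- (v%:C / 2) * gaussFT v).
Proof.
have -> : - (v%:C / 2) * gaussFT v = cint (fun s => 'i * (s%:C * gauss_wave v s)).
  rewrite cintegralZ; last exact: gauss_wave_int1.
  rewrite gauss_by_parts.
  have -> : 'i * ('i * v%:C / 2 * gaussFT v) = 'i * 'i * (v%:C / 2 * gaussFT v) by ring.
  by rewrite ii_m1; ring.
have ie := integrableZl measurableT (expR 1) (@integrable_edec R 1 ltr01).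
apply: (@is_cderive_int _ gauss_wave (fun v s => 'i * (s%:C * gauss_wave v s)) (v - 1) (v + 1) v
  (fun s => expR 1 * edec 1 s)) => //.
- by apply/andP; split; lra.
- by move=> t _; exact: gauss_wave_int.
- move=> t s _.
  have dl : is_cderive (fun v => 'i * (v * s)%:C) t ('i * s%:C).
    have h := is_cderiveM (is_cderive_cst ('i * s%:C) t) (is_cderive_id t).
    apply: (is_cderive_eq (is_cderive_ext _ h)); last by ring.
    by move=> y; rewrite rmorphM /=; ring.
  apply: (is_cderive_eq (is_cderiveM (is_cderive_cst (gauss_fun s)%:C t) (is_cderive_cexp dl))).
  by rewrite /gauss_wave; ring.
- move=> t s _; rewrite Normc.normcM (_ : Normc.normc 'i = 1 :> R) ?mul1r.
    exact: gauss_wave_bound.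
  by rewrite /= expr0n/= expr1n add0r sqrtr1.
Qed.

(** By [is_cderive_gaussFT], multiplication by the integrating factor exp (v^2 / 4) gives a
    constant, and its value at 0 is the Gaussian integral. *)
Lemma gaussFTE v : gaussFT v = (Num.sqrt pi * gauss_fun (v / 2))%:C.
Proof.
have dH t : is_cderive (fun t => cexp ((t ^+ 2 / 4)%:C) * gaussFT t) t 0.
  have dq : is_derive t (1 : R) (fun t => t ^+ 2 / 4) (t / 2).
    by apply: is_derive_eq; rewrite /GRing.scale /=; field.
  apply: (is_cderive_eq (is_cderiveM (is_cderive_cexp (is_cderiveR dq)) (is_cderive_gaussFT t))).
  by rewrite rmorphM fmorphV rmorph_nat /=; ring.
have H0 : cexp ((v ^+ 2 / 4)%:C) * gaussFT v = cexp (((0 : R) ^+ 2 / 4)%:C) * gaussFT 0.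
  have [v0|v0] := leP 0 v.
    by apply/esym; apply: (@is_cderive0_eq _ (fun t => cexp ((t ^+ 2 / 4)%:C) * gaussFT t)).
  by apply: (@is_cderive0_eq _ (fun t => cexp ((t ^+ 2 / 4)%:C) * gaussFT t)) => //; exact: ltW.
have G0 : gaussFT 0 = (Num.sqrt pi)%:C.
  rewrite /gaussFT; have -> : gauss_wave 0 = (fun s => (gauss_fun s)%:C).
    by apply/funext => s; rewrite /gauss_wave mul0r mulr0 cexp0 mulr1.
  apply: complex_ext; rewrite /cintegral /=.
    by rewrite /Rintegral integralT_gauss.
  by rewrite /Rintegral integral0.
rewrite expr0n/= mul0r cexp0 mul1r G0 in H0.
rewrite rmorphM /= -H0 mulrAC -{1}[gaussFT v]mul1r; congr (_ * _).
rewrite /gauss_fun -!cexpR -cexpD -cexp0; congr cexp.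
by rewrite -rmorphD /= (_ : _ + _ = 0)//; field.
Qed.

(** The product of sqrt pi and 2 sqrt pi is the origin of the constant 2 pi in Fourier inversion. *)
Lemma gaussFT_int : cintble gaussFT /\ cint gaussFT = (2 * pi)%:C.
Proof.
have i1 : leb.-integrable setT (EFin \o (fun v => gauss_fun (v / 2 : R))).
  have := @integrable_affine R (2^-1) 0 (@gauss_fun R) _ (@integrableT_gauss R).
  rewrite invr_eq0 pnatr_eq0 => /(_ isT); apply: eq_integrable => // v _ /=.
  by rewrite addr0 mulrC.
have E : gaussFT = fun v => (Num.sqrt pi)%:C * (gauss_fun (v / 2))%:C.
  by apply/funext => v; rewrite gaussFTE rmorphM.
have i2 : cintble (fun v => (gauss_fun (v / 2 : R))%:C).
  by split => //=; exact: integrable0.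
split; first by rewrite E; exact: cintegrableZ.
rewrite E cintegralZ//.
have -> : cint (fun v => (gauss_fun (v / 2 : R))%:C) = (2 * Num.sqrt pi)%:C.
  apply: complex_ext; rewrite /cintegral /=; last by rewrite /Rintegral integral0.
  have := @Rintegral_affine R (2^-1) 0 (@gauss_fun R) _ (@integrableT_gauss R).
  rewrite invr_eq0 pnatr_eq0 => /(_ isT).
  rewrite [in RHS]/Rintegral integralT_gauss/= ger0_norm// invrK => <-.
  by apply: eq_Rintegral => v _; rewrite addr0 mulrC.
by rewrite -rmorphM /= mulrCA -expr2 sqr_sqrtr ?pi_ge0.
Qed.

End GaussFourier.

Section FourierInversion.
Context {R : realType}.
Local Notation leb := (@lebesgue_measure R).
Local Notation RM := (measurableTypeR R).

Lemma cvg_scale0 (x v : R) : x + v / n.+1%:R @[n --> \oo] --> x.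
Proof.
rewrite -[X in _ --> X]addr0; apply: cvgD; first exact: cvg_cst.
rewrite -(mulr0 v); apply: cvgMr; exact: cvg_harmonic.
Qed.

Lemma ccvg_cont (f : R -> R[i]) (x : R) (u : nat -> R) : ccontat f x ->
  u n @[n --> \oo] --> x -> ccvg (fun n => f (u n)) (f x).
Proof.
move=> [f1 f2] ux; split.
  exact: (cvg_comp _ _ ux f1).
exact: (cvg_comp _ _ ux f2).
Qed.

Lemma ccvgM (u v : nat -> R[i]) a b : ccvg u a -> ccvg v b ->
  ccvg (fun n => u n * v n) (a * b).
Proof.
move=> [u1 u2] [v1 v2]; split.
  rewrite cReM (_ : (fun n => _) = (fun n => Re (u n) * Re (v n) - Im (u n) * Im (v n))).
    by apply: cvgB; exact: cvgM.
  by apply/funext => n; rewrite cReM.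
rewrite cImM (_ : (fun n => _) = (fun n => Re (u n) * Im (v n) + Im (u n) * Re (v n))).
  by apply: cvgD; exact: cvgM.
by apply/funext => n; rewrite cImM.
Qed.

Lemma ccvg_cst (a : R[i]) : ccvg (fun=> a) a.
Proof. by split; exact: cvg_cst. Qed.

(* The dilated Gaussians [g n] regularize the integral and tend to 1. *)
Lemma fourier_inversion (f : R -> R[i]) (K x : R) :
  let Ff := fun s : R => cint (fun u => f u * cexp ('i * (s * u)%:C)) in
  cintble f -> (forall u, Normc.normc (f u) <= K) -> ccontat f x -> cintble Ff ->
  cint (fun s => Ff s * cexp (- ('i * (s * x)%:C))) = (2 * pi)%:C * f x.
Proof.
move=> Ff fi fK fx Ffi.
have mf := cintegrable_meas fi.
have mFf := cintegrable_meas Ffi.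
have nw (y : R) : Normc.normc (cexp (- ('i * y%:C))) = 1 :> R.
  by rewrite normc_cexp cReN cReM /= mul0r mulr0 subrr oppr0 expR0.
pose g (n : nat) (s : R) : R := gauss_fun (s / n.+1%:R).
pose A n := cint (fun s => Ff s * cexp (- ('i * (s * x)%:C)) * (g n s)%:C).
have g0 n s : 0 <= g n s by exact: gauss_fun_ge0.
have g1 n s : g n s <= 1 by exact: gauss_fun_le1.
have mg n : measurable_fun [set: RM] (g n).
  apply: (measurableT_comp (@measurable_gauss R)).
  by apply: measurable_funM; [exact: measurable_id|exact: measurable_cst].
have mx : @cmeas R _ RM (fun s => cexp (- ('i * (s * x)%:C))) by cmeas.
have A1 : ccvg A (cint (fun s => Ff s * cexp (- ('i * (s * x)%:C)))).
  apply: (@cdominated _ _ _ leb _ _ (fun s => Normc.normc (Ff s))).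
  - move=> n; apply: cmeasM; first exact: cmeasM.
    exact: cmeasR.
  - move=> s; rewrite -[X in ccvg _ X]mulr1; apply: ccvgM; first exact: ccvg_cst.
    have h : ccontat (fun s : R => (gauss_fun s)%:C) 0.
      by apply: ccontatR; exact: continuous_gauss_fun.
    have := ccvg_cont h (@cvg_scale0 0 s).
    rewrite {2}/gauss_fun expr0n/= oppr0 expR0 => hh.
    rewrite (_ : (fun n => _) = (fun n => (gauss_fun (0 + s / n.+1%:R))%:C))//.
    by apply/funext => n; rewrite add0r.
  - exact: cintegrable_normc.
  - move=> n s; rewrite 2!Normc.normcM nw mulr1 normcR ger0_norm// ler_piMr//.
    exact: normc_ge0.
have n0 n : n.+1%:R != 0 :> R by rewrite pnatr_eq0.
have ig n : leb.-integrable setT (EFin \o g n).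
  have := @integrable_affine R (n.+1%:R^-1) 0 (@gauss_fun R) _ (@integrableT_gauss R).
  rewrite invr_eq0 n0 => /(_ isT); apply: eq_integrable => // v _ /=.
  by rewrite addr0 mulrC.
(* After Fubini, rescaling the inner Gaussian integral gives (n + 1) gaussFT ((n + 1) (u - x)), and
   u = x + v / (n + 1) moves all dependence on n into the argument of [f]. *)
have A2 n : A n = cint (fun v => f (x + v / n.+1%:R) * gaussFT v).
  transitivity (cint (fun s => cint (fun u => f u * (cexp ('i * (s * (u - x))%:C) * (g n s)%:C)))).
    apply: eq_cintegral => s; rewrite -mulrA -cintegralZr; last first.
      apply: (cintegrable_bound _ (cintegrable_normc fi)) => [|u].
        by apply: cmeasM => //; cmeas.
      by rewrite Normc.normcM normc_wave mulr1.
    apply: eq_cintegral => u; rewrite -mulrA; congr (_ * _).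
    rewrite mulrA -cexpD; congr (cexp _ * _).
    by rewrite mulrBr rmorphB /=; ring.
  rewrite (@cfubini_dom _ _ (g n) (fun u => Normc.normc (f u))) //; last 3 first.
  - apply: cmeasM; first exact: (cmeas_comp mf measurable_snd).
    apply: cmeasM; first by cmeas.
    by apply: cmeasR; exact: (measurableT_comp (mg n) measurable_fst).
  - exact: cintegrable_normc.
  - move=> s u; rewrite 2!Normc.normcM normc_wave mul1r normcR ger0_norm//.
    by rewrite mulrC.
  have E (u : R) : cint (fun s => f u * (cexp ('i * (s * (u - x))%:C) * (g n s)%:C)) =
     n.+1%:R%:C * (f u * gaussFT (n.+1%:R * (u - x))).
    have i3 : cintble (fun s => cexp ('i * (s * (u - x))%:C) * (g n s)%:C).
      apply: (cintegrable_bound _ (ig n)) => [|s].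
        by apply: cmeasM; [cmeas|exact: cmeasR].
      by rewrite Normc.normcM normc_wave mul1r normcR ger0_norm.
    rewrite cintegralZ// mulrCA; congr (_ * _).
    have := @cint_affine _ _ n.+1%:R 0 (n0 n) i3.
    rewrite ger0_norm// => h; rewrite /gaussFT.
    have -> : cint (gauss_wave (n.+1%:R * (u - x))) =
       cint (fun s => cexp ('i * ((n.+1%:R * s + 0) * (u - x))%:C) * (g n (n.+1%:R * s + 0))%:C).
      apply: eq_cintegral => s; rewrite /gauss_wave mulrC addr0; congr (cexp ('i * _%:C) * _).
        by ring.
      by rewrite /g mulrAC divff// mul1r.
    by rewrite h mulrA -rmorphM /= divff// mul1r.
  transitivity (cint (fun u => n.+1%:R%:C * (f u * gaussFT (n.+1%:R * (u - x))))).
    by apply: eq_cintegral => u; exact: E.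
  have gK (v : R) : Normc.normc (gaussFT v) <= Num.sqrt pi.
    rewrite gaussFTE normcR ger0_norm; last by rewrite mulr_ge0 ?sqrtr_ge0 ?gauss_fun_ge0.
    by rewrite ler_piMr ?sqrtr_ge0 ?gauss_fun_le1.
  have mG : @cmeas R _ RM (@gaussFT R) by apply: cintegrable_meas; exact: (@gaussFT_int R).1.
  have i4 : cintble (fun u => f u * gaussFT (n.+1%:R * (u - x))).
    have := integrableZl measurableT (Num.sqrt pi) (cintegrable_normc fi).
    move=> iK; apply: (cintegrable_bound _ iK) => [|u].
      apply: cmeasM => //; apply: (@cmeas_comp _ _ _ RM RM (@gaussFT R)) => //.
      by rmeas.
    by rewrite Normc.normcM mulrC ler_wpM2r ?normc_ge0.
  rewrite cintegralZ//.
  have ni : n.+1%:R^-1 != 0 :> R by rewrite invr_eq0.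
  have := @cint_affine _ _ (n.+1%:R^-1) x ni i4.
  rewrite gtr0_norm ?invr_gt0// invrK => <-.
  apply: eq_cintegral => v; congr (f _ * gaussFT _); first by rewrite addrC mulrC.
  by rewrite addrK mulrA divff// mul1r.
(* Continuity of [f] at [x] alone gives the pointwise limit, and the bound [K] gives the dominating
   function K |gaussFT v|. *)
have A3 : ccvg (fun n => cint (fun v => f (x + v / n.+1%:R) * gaussFT v))
    (cint (fun v => f x * gaussFT v)).
  have [iG _] := @gaussFT_int R.
  have mG := cintegrable_meas iG.
  have iGK := integrableZl measurableT K (cintegrable_normc iG).
  apply: (@cdominated _ _ _ leb _ _ (fun v => K * Normc.normc (gaussFT v))) => //.
  - move=> n; apply: cmeasM => //; apply: (@cmeas_comp _ _ _ RM RM f) => //.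
    apply: measurable_funD; first exact: measurable_cst.
    by apply: measurable_funM; [exact: measurable_id|exact: measurable_cst].
  - move=> v; apply: ccvgM; last exact: ccvg_cst.
    by apply: ccvg_cont => //; exact: cvg_scale0.
  - by move=> n v; rewrite Normc.normcM ler_wpM2r ?normc_ge0.
have [iG EG] := @gaussFT_int R.
rewrite cintegralZ// EG mulrC in A3.
apply: (ccvg_unique A1).
by rewrite (_ : A = (fun n => cint (fun v => f (x + v / n.+1%:R) * gaussFT v)))//; apply/funext.
Qed.

End FourierInversion.

(** * Barnes' first lemma *)

Section Barnes.
Context {R : realType}.
Implicit Types (a b c d s w z S : R[i]).

Lemma subiE a (t : R) : a - 'i * t%:C = a + 'i * (- t)%:C.
Proof. by rewrite rmorphN /=; ring. Qed.

Lemma Re_1D_expR (u : R) : 0 < Re (1 + 1 * (expR u)%:C : R[i]).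
Proof. by rewrite mul1r cReD /= addr_gt0 ?expR_gt0. Qed.

(* The Mellin transform of [x ^ a / (1 + x) ^ (a + c)] in the variable [x = e ^ u]. *)
Definition beta_fun a c (u : R) : R[i] :=
  cexp (a * u%:C) * GI (a + c) (1 + 1 * (expR u)%:C).

Lemma ReD_gt0 a c : 0 < Re a -> 0 < Re c -> 0 < Re (a + c).
Proof. by move=> a0 c0; rewrite cReD addr_gt0. Qed.

Lemma beta_funE a c u : 0 < Re a -> 0 < Re c ->
  beta_fun a c u = Gamma (a + c) * (cexp (a * u%:C) * P (a + c) (1 + 1 * (expR u)%:C)).
Proof.
move=> a0 c0; by rewrite /beta_fun (GI_Gamma (ReD_gt0 a0 c0) (Re_1D_expR u)) mulrCA.
Qed.

Lemma beta_fun_ED1 a c : 0 < Re a -> 0 < Re c -> ED1 (beta_fun a c).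
Proof.
move=> a0 c0; have o1 : 0 < Re (1 : R[i]) by rewrite /= ltr01.
have c1 : 0 < Re (a + c - a) by rewrite addrC addKr.
by have [] := beta_ED1 a0 c1 o1 o1.
Qed.

Lemma beta_fun_int a c : 0 < Re a -> 0 < Re c ->
  cint (beta_fun a c) = Gamma a * Gamma c.
Proof.
move=> a0 c0; have o1 : 0 < Re (1 : R[i]) by rewrite /= ltr01.
have c1 : 0 < Re (a + c - a) by rewrite addrC addKr.
have [_ h] := beta_ED1 a0 c1 o1 o1.
by rewrite /beta_fun h (GammaE a0) (GammaE c0) [a + c]addrC addrK.
Qed.

Lemma beta_fun_cont a c u : 0 < Re a -> 0 < Re c -> ccontat (beta_fun a c) u.
Proof.
move=> a0 c0.
rewrite (_ : beta_fun a c = (fun u => Gamma (a + c) *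
   (cexp (a * u%:C) * P (a + c) (1 + 1 * (expR u)%:C)))); last first.
  by apply/funext => y; exact: beta_funE.
have ce : ccontat (fun u : R => (expR u)%:C) u by apply: ccontatR; exact: continuous_expR.
have ci : ccontat (fun u : R => u%:C) u by exact: (is_cderive_cont (is_cderive_id u)).
apply: ccontatM; first exact: ccontat_cst.
apply: ccontatM; first by ccont.
by apply: ccontat_P; [ccont|exact: Re_1D_expR].
Qed.

Lemma beta_fun_FT a c (s : R) : 0 < Re a -> 0 < Re c ->
  cint (fun u => beta_fun a c u * cexp ('i * (s * u)%:C)) =
  Gamma (a + 'i * s%:C) * Gamma (c - 'i * s%:C).
Proof.
move=> a0 c0; rewrite subiE -beta_fun_int ?ReDi//.
apply: eq_cintegral => u; rewrite /beta_fun mulrAC -cexpD; congr (cexp _ * GI _ _).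
  by rewrite rmorphM /=; ring.
by rewrite rmorphN /=; ring.
Qed.

Lemma GammaGamma_ED1 a c : 0 < Re a -> 0 < Re c ->
  ED1 (fun s : R => Gamma (a + 'i * s%:C) * Gamma (c - 'i * s%:C)).
Proof.
move=> a0 c0; apply: ED1M; first exact: Gamma_ED1.
by apply: ED1_ext (ED1_opp (Gamma_ED1 c0)) => s; rewrite -subiE.
Qed.

Lemma mellin_inversion a c (x : R) : 0 < Re a -> 0 < Re c ->
  cint (fun s : R => Gamma (a + 'i * s%:C) * Gamma (c - 'i * s%:C) * cexp (- ('i * (s * x)%:C))) =
  (2 * pi)%:C * beta_fun a c x.
Proof.
move=> a0 c0; have E := beta_fun_ED1 a0 c0; have [K fK] := ED1_bdd E.
rewrite -(@fourier_inversion _ (beta_fun a c) K x).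
- by apply: eq_cintegral => s; rewrite beta_fun_FT.
- exact: ED1_integrable.
- exact: fK.
- exact: beta_fun_cont.
- apply: ED1_integrable; apply: ED1_ext (GammaGamma_ED1 a0 c0) => s.
  by rewrite beta_fun_FT.
Qed.

Lemma cexp_opp_wave (s u : R) : cexp ('i * (s * u)%:C) = cexp (- ('i * (s * - u)%:C)) :> R[i].
Proof. by congr cexp; rewrite mulrN rmorphN /=; ring. Qed.

(* Parseval for the beta integrals of (a, c) and (b, d), whose Mellin pairs
   multiply to the beta integral of (b + c, a + d). *)
Theorem barnes_first a b c d : 0 < Re a -> 0 < Re b -> 0 < Re c -> 0 < Re d ->
  Gamma (a + b + c + d) * cint (fun s : R =>
    Gamma (a + 'i * s%:C) * Gamma (b + 'i * s%:C) *
    Gamma (c - 'i * s%:C) * Gamma (d - 'i * s%:C)) =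
  (2 * pi)%:C * (Gamma (a + c) * Gamma (a + d) * Gamma (b + c) * Gamma (b + d)).
Proof.
move=> a0 b0 c0 d0.
pose H (s : R) := Gamma (a + 'i * s%:C) * Gamma (c - 'i * s%:C).
have HE : ED1 H by exact: GammaGamma_ED1.
pose g := beta_fun b d.
have gE : ED1 g by exact: beta_fun_ED1.
have [[mH _] [mg _]] := (HE, gE).
have HI := ED1_integrable HE; have gI := ED1_integrable gE.
have wI (f : R -> R[i]) (s : R) : cintble f -> cintble (fun u => f u * cexp ('i * (s * u)%:C)).
  move=> fi; apply: (cintegrable_bound _ (cintegrable_normc fi)) => [|u].
    by apply: cmeasM; [exact: (cintegrable_meas fi)|cmeas].
  by rewrite Normc.normcM normc_wave mulr1.
transitivity (Gamma (a + b + c + d) * cint (fun u => g u * ((2 * pi)%:C * beta_fun a c (- u)))).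
  congr (_ * _).
  transitivity (cint (fun s : R => cint (fun u => H s * g u * cexp ('i * (s * u)%:C)))).
    apply: eq_cintegral => s.
    transitivity (H s * cint (fun u => g u * cexp ('i * (s * u)%:C))).
      by rewrite /g beta_fun_FT// /H; ring.
    rewrite -cintegralZ; last exact: wI.
    by apply: eq_cintegral => u; rewrite mulrA.
  rewrite (@cfubini_dom _ _ (fun s : R => Normc.normc (H s)) (fun u => Normc.normc (g u))) //.
  - apply: eq_cintegral => u.
    transitivity (cint (fun s : R => g u * (H s * cexp (- ('i * (s * - u)%:C))))).
      by apply: eq_cintegral => s; rewrite -cexp_opp_wave [H s * g u]mulrC mulrA.
    rewrite cintegralZ; first by rewrite mellin_inversion.
    have := wI H (- u) HI => h.
    apply: (cintegrable_bound _ (cintegrable_normc HI)) => [|s].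
      by apply: cmeasM => //; cmeas.
    by rewrite -cexp_opp_wave Normc.normcM normc_wave mulr1.
  - apply: cmeasM; last by cmeas.
    by apply: cmeasM; [exact: (cmeas_comp mH measurable_fst)|exact: (cmeas_comp mg measurable_snd)].
  - exact: cintegrable_normc.
  - exact: cintegrable_normc.
  - by move=> s u; rewrite 2!Normc.normcM normc_wave mulr1.
have S0 : 0 < Re (a + b + c + d) by rewrite !ReD_gt0.
have E (u : R) : g u * ((2 * pi)%:C * beta_fun a c (- u)) =
    (2 * pi)%:C * (Gamma (a + c) * Gamma (b + d)) *
      (cexp ((b + c) * u%:C) * P (a + b + c + d) (1 + 1 * (expR u)%:C)).
  rewrite /g (beta_funE _ b0 d0) (beta_funE _ a0 c0).
  (* From 1 + exp (- u) = exp (- u) (1 + exp u): both powers now have the base 1 + exp u, so their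
     exponents add up to a + b + c + d. *)
  have -> : P (a + c) (1 + 1 * (expR (- u))%:C) =
      cexp ((a + c) * u%:C) * P (a + c) (1 + 1 * (expR u)%:C).
    have -> : 1 + 1 * (expR (- u))%:C = (expR (- u))%:C * (1 + 1 * (expR u)%:C) :> R[i].
      by rewrite !mul1r mulrDr mulr1 -rmorphM -expRD addNr expR0 rmorph1 addrC.
    rewrite P_mul ?Re_1D_expR//; last 2 first.
      by rewrite /= expR_gt0.
      by rewrite cReZ mulr_gt0 ?expR_gt0 ?Re_1D_expR.
    by rewrite P_real ?expR_gt0// expRK; congr (cexp _ * _); rewrite rmorphN /=; ring.
  have -> : a + b + c + d = (b + d) + (a + c) by ring.
  rewrite (PD (b + d) (a + c)).
  have -> : (b + c) * u%:C = b * u%:C + (a * (- u)%:C + (a + c) * u%:C).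
    by rewrite rmorphN /=; ring.
  by rewrite !cexpD; ring.
have bc0 := ReD_gt0 b0 c0; have ad0 := ReD_gt0 a0 d0.
pose Q : R[i] := (2 * pi)%:C * (Gamma (a + c) * Gamma (b + d)).
transitivity (cint (fun u => Q * beta_fun (b + c) (a + d) u)).
  rewrite -cintegralZ; last first.
    apply: ED1_integrable; apply: ED1M => //.
    have h := ED1_opp (beta_fun_ED1 a0 c0).
    apply: (ED1_ext (f := fun u => beta_fun a c (- u) * (2 * pi)%:C)).
      by move=> u; rewrite mulrC.
    apply: ED1M_bdd => //; first exact: cmeas_cst.
    by exists (Normc.normc ((2 * pi)%:C : R[i])).
  apply: eq_cintegral => u; rewrite E (beta_funE _ bc0 ad0).
  have -> : a + b + c + d = b + c + (a + d) by ring.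
  by rewrite /Q; ring.
apply: (etrans (cintegralZ Q (ED1_integrable (beta_fun_ED1 bc0 ad0)))).
rewrite (beta_fun_int bc0 ad0) /Q.
by move: (Gamma _) (Gamma _) (Gamma _) (Gamma _) (_%:C) => x y z w v; ring.
Qed.

End Barnes.

(** * The reflection formula *)

Section Reflection.
Context {R : realType}.
Local Notation leb := (@lebesgue_measure R).
Local Notation RM := (measurableTypeR R).
Implicit Types (z w : R[i]) (a b u v x t : R).

Lemma Gamma_1 : Gamma (1 : R[i]) = 1.
Proof.
rewrite GammaE ?ltr01// -Gamma_eulerE /Gamma_euler.
have E t : cexp ((1 - 1) * (ln t)%:C) * (expR (- t))%:C = (expR (- t))%:C :> R[i].
  by rewrite subrr mul0r cexp0 mul1r.
rewrite (_ : (fun t : R => cexp _ * _) = (fun t => (expR (- t))%:C)); last first.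
  by apply/funext => t; exact: E.
apply: complex_ext; rewrite /cintegral /=; last by rewrite /Rintegral integral0.
rewrite /Rintegral integral_itv_obnd_cbnd; last first.
  apply/measurable_EFinP; apply: measurable_funTS; apply: (@meas_expR _ _ RM (fun x => - x)); apply: meas_N; exact: measurable_id.
have dG (x : R) : is_derive x (1 : R) (fun x => - expR (- x)) (expR (- x)).
  by apply: is_derive_eq; rewrite /GRing.scale /=; ring.
rewrite (@ge0_continuous_FTC2y _ (fun x => expR (- x)) (fun x => - expR (- x)) 0 0)//.
- by rewrite oppr0 expR0 /= sub0r opprK.
- apply: continuous_subspaceT => x.
  by apply: continuous_comp; [exact: continuousN|exact: continuous_expR].
- by rewrite -oppr0; apply: cvgN; exact: cvgr_expR.
- have : {for (0 : R), continuous (fun x => - expR (- x))}.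
    by apply: differentiable_continuous; apply/derivable1_diffP; have [] := dG 0.
  by move=> h; apply: cvg_at_right_filter; exact: h.
- by move=> x _; rewrite derive1E; have [_] := dG x.
Qed.

Definition cauchy_fun v : R := (1 + v ^+ 2)^-1.

Lemma cauchy_den v : 0 < 1 + v ^+ 2 :> R.
Proof. by rewrite ltr_pwDl// sqr_ge0. Qed.

Lemma cauchy_fun_ge0 v : 0 <= cauchy_fun v.
Proof. by rewrite invr_ge0 ltW// cauchy_den. Qed.

Lemma continuous_cauchy_fun : continuous cauchy_fun.
Proof.
move=> v; have n0 : 1 + v ^+ 2 != 0 by rewrite gt_eqF// cauchy_den.
apply: differentiable_continuous; apply/derivable1_diffP.
apply: derivableV; first exact: n0.
by apply: ex_derive.
Qed.

Lemma integral_cauchy_fun : (\int[leb]_v (cauchy_fun v)%:E = pi%:E)%E.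
Proof.
rewrite ge0_symfun_integralT//; last 3 first.
- by move=> x; exact: cauchy_fun_ge0.
- exact: continuous_cauchy_fun.
- by move=> x; rewrite /cauchy_fun /= sqrrN.
rewrite -set_itvcy (@ge0_continuous_FTC2y _ cauchy_fun atan 0 (pi / 2))//.
- by rewrite atan0 sube0 -EFinM; congr EFin; field.
- by move=> x _; exact: cauchy_fun_ge0.
- by apply: continuous_subspaceT; exact: continuous_cauchy_fun.
- exact: cvgy_atan.
- by apply: cvg_at_right_filter; exact: continuous_atan.
- by move=> x _; rewrite derive1_atan.
Qed.

Lemma integrable_cauchy_fun (c : R) : c != 0 ->
  leb.-integrable setT (EFin \o (fun v => cauchy_fun (c * v))).
Proof.
move=> c0.
have i1 : leb.-integrable setT (EFin \o cauchy_fun).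
  apply/integrableP; split.
    by apply/measurable_EFinP; apply: continuous_measurable_fun; exact: continuous_cauchy_fun.
  under eq_integral do rewrite /= ger0_norm ?cauchy_fun_ge0//.
  by rewrite integral_cauchy_fun ltry.
have := @integrable_affine R c 0 cauchy_fun c0 i1.
by apply: eq_integrable => // v _ /=; rewrite addr0.
Qed.

Lemma Rintegral_cauchy_fun : (\int[leb]_v cauchy_fun (2^-1 * v) = 2 * pi)%R.
Proof.
have := @integrable_cauchy_fun 1 (oner_neq0 _).
rewrite (_ : (fun v => _) = cauchy_fun); last by apply/funext => v; rewrite mul1r.
move=> i1; have n2 : (2^-1 : R) != 0 by rewrite invr_eq0 pnatr_eq0.
have := @Rintegral_affine R (2^-1) 0 cauchy_fun n2 i1.
rewrite ger0_norm// invrK [X in _ = _ * X]/Rintegral integral_cauchy_fun /= => <-.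
by apply: eq_Rintegral => v _; rewrite addr0.
Qed.

(** * A Poisson kernel, its derivative, and integration by parts *)

Section Kernel.
Variables a b : R.
Hypothesis a0 : 0 < a.
Hypothesis ab1 : a ^+ 2 + b ^+ 2 = 1.

(* For a = cos phi and b = sin phi, [pker u] is sin (2 phi) / (cosh u + cos (2 phi)), a
   Poisson kernel that concentrates at u = 0 when 2 phi tends to pi. *)
Definition pker_den u : R := a ^+ 2 * (1 + expR u) ^+ 2 + b ^+ 2 * (expR u - 1) ^+ 2.
Definition pker u : R := 4 * a * b * expR u / pker_den u.
Definition pker' u : R := 4 * a * b * expR u * (1 - expR u ^+ 2) / pker_den u ^+ 2.

Lemma pker_den_ge u : a ^+ 2 * (1 + expR u) ^+ 2 <= pker_den u.
Proof. by rewrite /pker_den lerDl mulr_ge0 ?sqr_ge0. Qed.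

Lemma onePexp_gt0 u : 0 < 1 + expR u. Proof. by rewrite addr_gt0 ?expR_gt0. Qed.

Lemma pker_den_gt0 u : 0 < pker_den u.
Proof.
apply: lt_le_trans (pker_den_ge u).
by rewrite mulr_gt0 ?exprn_gt0 ?onePexp_gt0.
Qed.

Lemma logistic_edec u : expR u / (1 + expR u) ^+ 2 <= edec 1 u.
Proof.
rewrite ler_pdivrMr ?exprn_gt0 ?onePexp_gt0// /edec mul1r.
have e0 := expR_gt0 u.
have [u0|u0] := leP 0 u.
  rewrite ger0_norm// expRN.
  rewrite mulrC ler_pdivlMr// -expr2; apply: lerXn2r; rewrite ?nnegrE ?ltW ?onePexp_gt0//.
  by rewrite ltrDr.
rewrite ltr0_norm// opprK ler_peMr ?ltW//.
by rewrite exprn_egt1// ltrDl.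
Qed.

Lemma pker_bound u : `|pker u| <= 4 * `|b| / a * edec 1 u.
Proof.
rewrite /pker normrM normfV !normrM (gtr0_norm (pker_den_gt0 u)) (gtr0_norm (expR_gt0 u)).
rewrite (gtr0_norm a0) (ger0_norm (ler0n _ 4)).
have h : (pker_den u)^-1 <= (a ^+ 2 * (1 + expR u) ^+ 2)^-1.
  rewrite lef_pV2 ?posrE ?pker_den_gt0 ?pker_den_ge//.
  by rewrite mulr_gt0 ?exprn_gt0 ?onePexp_gt0.
have h2 := ler_wpM2l (_ : 0 <= 4 * a * `|b| * expR u) h.
apply: (le_trans (h2 _)).
  by rewrite !mulr_ge0// ?expR_ge0 ?ltW.
have -> : 4 * a * `|b| * expR u / (a ^+ 2 * (1 + expR u) ^+ 2) =
    4 * `|b| / a * (expR u / (1 + expR u) ^+ 2).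
  have n1 := lt0r_neq0 a0; have n2 := lt0r_neq0 (onePexp_gt0 u).
  by field; rewrite n1 n2.
rewrite ler_wpM2l ?logistic_edec//.
by rewrite divr_ge0 ?mulr_ge0// ltW.
Qed.

Lemma pker'_bound u : `|pker' u| <= 4 * `|b| / a * (a ^+ 2)^-1 * edec 1 u.
Proof.
have -> : pker' u = (1 - expR u ^+ 2) / pker_den u * pker u.
  by rewrite /pker' /pker; field; exact: lt0r_neq0 (pker_den_gt0 u).
rewrite normrM [4 * `|b| / a * _]mulrC -[X in _ <= X]mulrA.
apply: ler_pM => //; last exact: pker_bound.
rewrite normrM normfV (gtr0_norm (pker_den_gt0 u)) ler_pdivrMr ?pker_den_gt0//.
apply: (@le_trans _ _ ((1 + expR u) ^+ 2)).
  have e0 := expR_gt0 u; have e2 : 0 <= expR u ^+ 2 by exact: sqr_ge0.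
  by rewrite ler_norml; apply/andP; split; rewrite sqrrD expr1n; lra.
rewrite ler_pdivlMl ?exprn_gt0//; exact: pker_den_ge.
Qed.

Lemma is_derive_pker u : is_derive u (1 : R) pker (pker' u).
Proof.
have dn := lt0r_neq0 (pker_den_gt0 u).
have dd : is_derive u (1 : R) pker_den
   ((2 * a ^+ 2 * (1 + expR u) + 2 * b ^+ 2 * (expR u - 1)) * expR u).
  by rewrite /pker_den; apply: is_derive_eq; rewrite /GRing.scale /=; ring.
have dv := is_deriveV dn dd.
have dx : is_derive u (1 : R) (fun u => 4 * a * b * expR u) (4 * a * b * expR u).
  by apply: is_derive_eq; rewrite /GRing.scale /=; ring.
apply: (is_derive_eq (is_deriveM dx dv)).
rewrite /GRing.scale /= /pker'.
have E : pker_den u = 1 + expR u ^+ 2 + 2 * (a ^+ 2 - b ^+ 2) * expR u.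
  rewrite /pker_den -[X in X + _ ^+ 2 + _]ab1 -[X in _ + X + _]mul1r -[X in _ + X * _ + _]ab1; ring.
have E2 : (2 * a ^+ 2 * (1 + expR u) + 2 * b ^+ 2 * (expR u - 1)) * expR u =
   2 * (expR u ^+ 2) + 2 * (a ^+ 2 - b ^+ 2) * expR u.
  transitivity (2 * (a ^+ 2 + b ^+ 2) * expR u ^+ 2 + 2 * (a ^+ 2 - b ^+ 2) * expR u); first by ring.
  by rewrite ab1; ring.
rewrite E2; apply: (mulIf (expf_neq0 2 dn)); rewrite [RHS]divfK ?expf_neq0//.
rewrite mulrDl.
have -> : 4 * a * b * expR u * (- pker_den u ^- 2 * (2 * expR u ^+ 2 + 2 * (a ^+ 2 - b ^+ 2) * expR u)) * pker_den u ^+ 2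
  = - (4 * a * b * expR u * (2 * expR u ^+ 2 + 2 * (a ^+ 2 - b ^+ 2) * expR u)).
  by field.
have -> : (pker_den u)^-1 * (4 * a * b * expR u) * pker_den u ^+ 2 = 4 * a * b * expR u * pker_den u.
  by field.
by rewrite E; ring.
Qed.

Lemma continuous_pker' : continuous pker'.
Proof.
move=> u; apply: differentiable_continuous; apply/derivable1_diffP.
rewrite /pker'; apply: derivableM.
  by apply: ex_derive.
apply: derivableV; first by rewrite expf_neq0// lt0r_neq0// pker_den_gt0.
by rewrite /pker_den; apply: ex_derive.
Qed.

(** Of the rate 1 of [f], at most 1/2 is spent on the growth of the exponential, which leaves the
    rate 1/2. *)
Lemma ED1_cexp_real z (f : R -> R) (C : R) : `|Re z| <= 1 / 2 -> measurable_fun [set: RM] f ->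
  (forall u, `|f u| <= C * edec 1 u) -> ED1 (fun u => cexp (z * u%:C) * (f u)%:C).
Proof.
move=> z2 mf fb; split; first by cmeas.
have C0 : 0 <= C.
  have := le_trans (normr_ge0 _) (fb 0).
  by rewrite /edec normr0 mulr0 oppr0 expR0 mulr1.
exists C, (1 / 2); split => // u.
rewrite Normc.normcM normcR normc_cexp cReM /= mulr0 subr0 mulrC.
apply: (le_trans (ler_pM _ _ (fb u) (_ : _ <= expR (1 / 2 * `|u|)))) => //.
- rewrite ler_expR (le_trans (ler_norm _))// normrM ler_wpM2r//.
- rewrite -[X in X <= _]mulrA; apply: ler_wpM2l => //.
  by rewrite /edec -expRD ler_expR; lra.
Qed.

Lemma pker_ED1 z : `|Re z| <= 1 / 2 -> ED1 (fun u => cexp (z * u%:C) * (pker u)%:C).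
Proof.
move=> z2; apply: ED1_cexp_real => //; last exact: pker_bound.
apply: continuous_measurable_fun => u; apply: differentiable_continuous.
by apply/derivable1_diffP; have [] := is_derive_pker u.
Qed.

Lemma pker'_ED1 z : `|Re z| <= 1 / 2 -> ED1 (fun u => cexp (z * u%:C) * (pker' u)%:C).
Proof.
move=> z2; apply: ED1_cexp_real => //; last exact: pker'_bound.
by apply: continuous_measurable_fun; exact: continuous_pker'.
Qed.

Lemma pker_by_parts z : `|Re z| <= 1 / 2 ->
  cint (fun u => cexp (z * u%:C) * (pker' u)%:C) = - z * cint (fun u => cexp (z * u%:C) * (pker u)%:C).
Proof.
move=> z2; have i1 := ED1_integrable (pker'_ED1 z2); have i2 := ED1_integrable (pker_ED1 z2).
apply/eqP; rewrite mulNr -subr_eq0 opprK -cintegralZ// -cintegralD//; last exact: cintegrableZ.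
have dl u : is_cderive (fun u => z * u%:C) u z.
  apply: (is_cderive_eq (is_cderiveM (is_cderive_cst z u) (is_cderive_id u))).
  by rewrite mul0r add0r mulr1.
have cu u : ccontat (fun u : R => u%:C) u by exact: (is_cderive_cont (is_cderive_id u)).
have ck u := is_cderive_cont (is_cderiveR (is_derive_pker u)).
have ck' u : ccontat (fun u => (pker' u)%:C) u by apply: ccontatR; exact: continuous_pker'.
apply/eqP; apply: (@cint_derivative_eq0 _ (fun u => cexp (z * u%:C) * (pker u)%:C)).
- move=> u; apply: (is_cderive_eq (is_cderiveM (is_cderive_cexp (dl u)) (is_cderiveR (is_derive_pker u)))).
  by ring.
- by move=> u; ccont.
- by apply: cintegrableD => //; exact: cintegrableZ.
- by have [_ [C [c [_ c0 h]]]] := pker_ED1 z2; exists C, c.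
Qed.

End Kernel.


Definition wave_den (phi u : R) : R[i] :=
  cexp ('i * (- phi)%:C) + cexp ('i * phi%:C) * (expR u)%:C.

Lemma Re_cexp_ii phi : Re (cexp ('i * phi%:C)) = cos phi :> R.
Proof.
rewrite Re_cexp cReM cImM /= (_ : 0 * phi - 1 * 0 = 0); last by ring.
by rewrite (_ : 0 * 0 + 1 * phi = phi); [rewrite expR0 mul1r|ring].
Qed.

Lemma Im_cexp_ii phi : Im (cexp ('i * phi%:C)) = sin phi :> R.
Proof.
rewrite Im_cexp cReM cImM /= (_ : 0 * phi - 1 * 0 = 0); last by ring.
by rewrite (_ : 0 * 0 + 1 * phi = phi); [rewrite expR0 mul1r|ring].
Qed.

Lemma wave_denE phi u :
  wave_den phi u = (cos phi * (1 + expR u))%:C + 'i * (sin phi * (expR u - 1))%:C.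
Proof.
apply: complex_ext.
  rewrite /wave_den [in LHS]cReD [X in _ + X = _]cReM !Re_cexp_ii !Im_cexp_ii !reimE /= cosN; ring.
rewrite /wave_den [in LHS]cImD [X in _ + X = _]cImM !Re_cexp_ii !Im_cexp_ii !reimE /= sinN; ring.
Qed.

(* The beta integral of (1 + z, 1 - z) along the ray of argument 2 phi; the rays
   phi and - phi are subtracted in [reflection_rotated]. *)
Lemma reflection_half z phi : `|phi| < pi / 2 -> `|Re z| <= 1 / 2 ->
  ED1 (fun u => cexp (z * u%:C) * ((expR u)%:C * (wave_den phi u)^-1 ^+ 2)) /\
  cint (fun u => cexp (z * u%:C) * ((expR u)%:C * (wave_den phi u)^-1 ^+ 2)) =
  cexp (- ('i * (2 * phi)%:C * z)) * (Gamma (1 + z) * Gamma (1 - z)).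
Proof.
move=> hphi hz.
move: (hphi) (hz); rewrite ltr_norml ler_norml => /andP[p1 p2] /andP[z1 z2].
have cphi : 0 < cos phi by apply: cos_gt0_pihalf; rewrite p1.
have w1 : 0 < Re (cexp ('i * (- phi)%:C)) by rewrite Re_cexp_ii cosN.
have w2 : 0 < Re (cexp ('i * phi%:C)) by rewrite Re_cexp_ii.
have h1 : 0 < Re (1 + z) by rewrite cReD /=; lra.
have h2' : 0 < Re (1 - z) by rewrite cReD cReN /=; lra.
have S1 : 2 - (1 + z) = 1 - z by ring.
have h2 : 0 < Re (2 - (1 + z)) by rewrite S1.
have wd u : 0 < Re (wave_den phi u).
  by rewrite wave_denE !reimE /= mul0r mul1r subr0 addr0 mulr_gt0 ?addr_gt0 ?expR_gt0.
have E u : cexp (z * u%:C) * ((expR u)%:C * (wave_den phi u)^-1 ^+ 2) =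
   cexp ((1 + z) * u%:C) * GI 2 (wave_den phi u).
  have G2 : Gamma (2 : R[i]) = 1.
    by rewrite (_ : 2 = 1 + 1)// GammaS ?ltr01// mul1r Gamma_1.
  rewrite GI_Gamma//; last by rewrite /= addr_gt0.
  rewrite G2 mul1r (_ : P 2 _ = P 1 (wave_den phi u) * P 1 (wave_den phi u)); last first.
    by rewrite -PD.
  by rewrite P1_inv// mulrDl mul1r cexpD cexpR expr2; ring.
have [e1 e2] := beta_ED1 h1 h2 w1 w2.
split; first by apply: ED1_ext e1 => u; rewrite E.
transitivity (cint (fun u => cexp ((1 + z) * u%:C) * GI 2 (wave_den phi u))).
  by apply: eq_cintegral => u; exact: E.
rewrite e2 S1 (GI_Gamma h1 w2) (GI_Gamma h2' w1) !P_cexp; last 2 first.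
- by rewrite !reimE /= !(mul0r, mul1r, add0r); apply/andP; split; lra.
- by rewrite !reimE /= !(mul0r, mul1r, add0r) p1.
have -> : cexp (- ('i * (2 * phi)%:C * z)) =
    cexp (- ((1 + z) * ('i * phi%:C))) * cexp (- ((1 - z) * ('i * (- phi)%:C))).
  by rewrite -cexpD; congr cexp; rewrite rmorphM rmorphN; ring.
set A := Gamma _; set B := cexp _; set C := Gamma _; set D := cexp _; ring.
Qed.

(** The denominators for phi and - phi are complex conjugate with product [pker_den], so the
    difference of their inverse squares has an elementary numerator, and it is an exact
    derivative. *)
Lemma wave_den_pker phi u : 0 < cos phi ->
  (expR u)%:C * (wave_den phi u)^-1 ^+ 2 - (expR u)%:C * (wave_den (- phi) u)^-1 ^+ 2
  = 'i * (pker' (cos phi) (sin phi) u)%:C.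
Proof.
move=> c0; set a := cos phi; set b := sin phi; set x := expR u.
have N0 : (pker_den a b u)%:C != 0 :> R[i].
  by rewrite fmorph_eq0 gt_eqF// pker_den_gt0.
have E1 : wave_den phi u * wave_den (- phi) u = (pker_den a b u)%:C.
  rewrite !wave_denE cosN sinN -/a -/b -/x.
  apply: complex_ext; rewrite !reimE /= /pker_den -/x; ring.
have E2 : wave_den (- phi) u ^+ 2 - wave_den phi u ^+ 2 =
    'i * (4 * a * b * (1 - x ^+ 2))%:C.
  rewrite !wave_denE cosN sinN -/a -/b -/x !expr2.
  apply: complex_ext; rewrite !reimE /=; ring.
have /andP[n1 n2] : (wave_den phi u != 0) && (wave_den (- phi) u != 0).
  by rewrite -negb_or -mulf_eq0 E1.
rewrite /pker' -/x fmorph_div rmorphXn /= -E1.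
transitivity (x%:C * (wave_den (- phi) u ^+ 2 - wave_den phi u ^+ 2) /
   (wave_den phi u * wave_den (- phi) u) ^+ 2).
  by field; rewrite n1 n2.
rewrite E2 (_ : 4 * a * b * x * (1 - x ^+ 2) = x * (4 * a * b * (1 - x ^+ 2))); last by ring.
by rewrite rmorphM; ring.
Qed.

(** Subtracting [reflection_half] at phi and - phi leaves the integral against i times [pker'].
    Integration by parts moves the derivative to the exponential and produces the factor z, so that
    a positive kernel concentrating at 0 remains. *)
Lemma reflection_rotated z phi : 0 < phi < pi / 2 -> `|Re z| <= 1 / 2 ->
  (cexp (- ('i * (2 * phi)%:C * z)) - cexp ('i * (2 * phi)%:C * z)) *
    (Gamma (1 + z) * Gamma (1 - z)) =
  - 'i * z * cint (fun u => cexp (z * u%:C) * (pker (cos phi) (sin phi) u)%:C).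
Proof.
move=> /andP[p0 p1] hz.
have hp : `|phi| < pi / 2 by rewrite gtr0_norm.
have c0 : 0 < cos phi by apply: cos_gt0_pihalf; rewrite p1 andbT; lra.
have [e1 f1] := reflection_half hp hz.
have hp' : `|- phi| < pi / 2 by rewrite normrN.
have [e2 f2] := reflection_half hp' hz.
have -> : 'i * (2 * phi)%:C * z = - ('i * (2 * - phi)%:C * z).
  by rewrite mulrN rmorphN; ring.
rewrite mulrBl -f2 (_ : - (- _) = 'i * (2 * - phi)%:C * z :> R[i]) ?opprK//.
have -> : cexp ('i * (2 * - phi)%:C * z) = cexp (- ('i * (2 * phi)%:C * z)).
  by congr cexp; rewrite mulrN rmorphN; ring.
rewrite -f1 -cintegralB; [|exact: ED1_integrable|exact: ED1_integrable].
have ab1 : cos phi ^+ 2 + sin phi ^+ 2 = 1 by rewrite cos2Dsin2.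
have i2 := ED1_integrable (pker_ED1 c0 ab1 hz).
transitivity ('i * cint (fun u => cexp (z * u%:C) * (pker' (cos phi) (sin phi) u)%:C)).
  rewrite -cintegralZ; last by apply: ED1_integrable; exact: pker'_ED1.
  apply: eq_cintegral => u; rewrite -mulrBr wave_den_pker//.
  by rewrite mulrCA.
by rewrite (pker_by_parts c0 ab1 hz); ring.
Qed.

Lemma cvg_difference_quotient (f : R -> R) (d : R) (t_ : nat -> R) :
  is_derive (0 : R) (1 : R) f d -> (forall n, t_ n != 0) -> t_ n @[n --> \oo] --> (0 : R) ->
  (f (t_ n) - f 0) / t_ n @[n --> \oo] --> d.
Proof.
move=> [df <-] t0 ct.
have h : (fun h : R => h^-1 *: ((f \o shift 0) (h *: 1) - f 0)) h @[h --> 0^'] --> 'D_1 f 0 by exact: df.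
move/cvgr_dnbhsP: h => /(_ t_ (conj t0 ct)).
rewrite (_ : (fun n => _) = (fun n => (f (t_ n) - f 0) / t_ n)) //.
apply/funext => n; rewrite /GRing.scale /= mulr1 addr0 mulrC//.
Qed.

Lemma ccvgR (r : nat -> R) (l : R) : r n @[n --> \oo] --> l -> ccvg (fun n => (r n)%:C) l%:C.
Proof. by move=> h; split => //=; exact: cvg_cst. Qed.

(** A tail of the sequence 1 / (n + 1) on which sin t is comparable to t and cos t stays away from
    0. The explicit constants feed the domination that must be uniform in n. *)
Lemma small_angles : exists t_ : nat -> R,
  [/\ t_ n @[n --> \oo] --> (0 : R),
      forall n, 0 < t_ n < pi / 2,
      forall n, t_ n / 2 <= sin (t_ n) <= 2 * t_ n &
      forall n, 1 / 2 <= cos (t_ n) <= 1].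
Proof.
pose u_ (n : nat) : R := n.+1%:R^-1.
have u0 : u_ n @[n --> \oo] --> (0 : R) by exact: cvg_harmonic.
have un n : u_ n != 0 by rewrite invr_eq0 pnatr_eq0.
have up n : 0 < u_ n by rewrite invr_gt0 ltr0n.
have s0 : (sin (u_ n) - sin 0) / u_ n @[n --> \oo] --> (1 : R).
  have ds : is_derive (0 : R) (1 : R) sin 1 by rewrite -[X in is_derive _ _ _ X]cos0; exact: is_derive_sin.
  exact: (cvg_difference_quotient ds un u0).
have c0 : cos (u_ n) @[n --> \oo] --> (1 : R).
  by rewrite -cos0; exact: (cvg_comp _ _ u0 (@continuous_cos _ 0)).
have l12 : 1 / 2 < 1 :> R by lra.
have l2 : 1 < 2 :> R by lra.
have e1 := cvgr_ge _ s0 _ l12; have e2 := cvgr_le _ s0 _ l2.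
have e3 := cvgr_ge _ c0 _ l12; have e4 := cvgr_lt _ u0 _ ltr01.
have [N _ hN] : \forall n \near \oo, [&& (1 / 2 <= (sin (u_ n) - sin 0) / u_ n),
   ((sin (u_ n) - sin 0) / u_ n <= 2), (1 / 2 <= cos (u_ n)) & (u_ n < 1)].
  near=> n; apply/and4P; split; near: n; [exact: e1|exact: e2|exact: e3|exact: e4].
exists (fun n => u_ (n + N)%N).
have h n := hN (n + N)%N (leq_addl n N).
split.
- by rewrite -(cvg_shiftn N) in u0.
- move=> n; have /and4P[_ _ _ h4] := h n; rewrite up /=.
  by have := pi_ge2 R; lra.
- move=> n; move: (up (n + N)%N) (h n); move: (u_ (n + N)%N) => y y0 /and4P[h1 h2 _ _].
  move: h1 h2; rewrite sin0 subr0 ler_pdivlMr// ler_pdivrMr//.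
  by move=> h1 h2; apply/andP; split; lra.
- move=> n; have /and4P[_ _ h3 _] := h n.
  by rewrite h3 cos_le1.
Unshelve. all: by end_near.
Qed.

(** This and the next bound treat the two squares in [pker_den]. The surplus exp (|u| / 2) later
    absorbs the exponential of z u when |Re z| <= 1/2. *)
Lemma sq_onePexp_ge u : expR u * expR (`|u| / 2) <= (1 + expR u) ^+ 2.
Proof.
have e0 := expR_gt0 u.
have h1 : 0 <= expR u ^+ 2 by exact: sqr_ge0.
have [u0|u0] := leP 0 u.
  have h : expR (`|u| / 2) <= expR u by rewrite ger0_norm// ler_expR; lra.
  have := ler_wpM2l (ltW e0) h.
  by rewrite -expr2 => h2; rewrite sqrrD expr1n; lra.
have : expR u * expR (`|u| / 2) <= 1.
  by rewrite ltr0_norm// -expRD -[leRHS]expR0 ler_expR; lra.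
by move=> h; rewrite sqrrD expr1n; lra.
Qed.

(** For y >= 0 and r = exp (y / 4) the claim is the square of r^3 (y / 4) <= r^4 - 1, which follows
    from r - 1 >= y / 4 and r^3 >= 1. The case u < 0 is the one for - u multiplied by exp (2 u). *)
Lemma sq_exp_sub1_ge u : expR u * expR (`|u| / 2) * (u ^+ 2 / 16) <= (expR u - 1) ^+ 2.
Proof.
have key (y : R) : 0 <= y -> expR y * expR (y / 2) * (y ^+ 2 / 16) <= (expR y - 1) ^+ 2.
  move=> y0; set r := expR (y / 4).
  have ry : expR y = r ^+ 4.
    by rewrite /r -expRM_natl; congr expR; field.
  have ry2 : expR (y / 2) = r ^+ 2.
    by rewrite /r -expRM_natl; congr expR; field.
  have r1 : 1 + y / 4 <= r by exact: expR_ge1Dx.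
  have r0 : 0 < r by exact: expR_gt0.
  have r11 : 1 <= r by lra.
  have -> : expR y * expR (y / 2) * (y ^+ 2 / 16) = (r ^+ 3 * (y / 4)) ^+ 2.
    by rewrite ry ry2; field.
  rewrite ler_sqr ?nnegrE; last 2 first.
  - by rewrite mulr_ge0// ?divr_ge0// exprn_ge0// ltW.
  - by rewrite ry subr_ge0 exprn_ege1.
  have r3 : 1 <= r ^+ 3 by rewrite exprn_ege1.
  have := ler_wpM2l (_ : 0 <= r ^+ 3) (_ : y / 4 <= r - 1).
  rewrite mulrBr mulr1 -exprSr -ry => h; apply: (le_trans (h _ _)); lra.
have [u0|u0] := leP 0 u; first by rewrite ger0_norm//; exact: key.
have uN : 0 <= - u by lra.
have := key _ uN; rewrite ltr0_norm// sqrrN => h.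
have E : expR u * expR (- u) = 1 by rewrite expRN divff// gt_eqF// expR_gt0.
have := ler_wpM2l (sqr_ge0 (expR u)) h.
rewrite -exprMn mulrBr mulr1 E.
have -> : expR u ^+ 2 * (expR (- u) * expR (- u / 2) * (u ^+ 2 / 16)) =
  (expR u * expR (- u)) * (expR u * expR (- u / 2) * (u ^+ 2 / 16)) by ring.
by rewrite E mul1r -[X in _ <= X -> _]sqrrN opprB.
Qed.

(** At u = t v the denominator is at least (t^2 / 4) exp u exp (|u| / 2) (1 + v^2 / 16), and the
    prefactor 4 t a b is at most 8 t^2. The powers of t cancel and 32 = 8 / (1 / 4) remains. *)
Lemma pker_scaled_bound t a b v : 0 < t -> t / 2 <= a <= 2 * t -> 1 / 2 <= b <= 1 ->
  0 <= t * pker a b (t * v) <= 32 * (expR (- (`|t * v| / 2)) * cauchy_fun (4^-1 * v)).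
Proof.
move=> t0 /andP[a1 a2] /andP[b1 b2].
have a0 : 0 < a by lra.
have b0 : 0 < b by lra.
set u := t * v; have x0 := expR_gt0 u; have N0 := pker_den_gt0 b a0 u.
have -> : t * pker a b u = (t * (4 * a * b)) * expR u / pker_den a b u.
  by rewrite /pker; field; exact: lt0r_neq0.
apply/andP; split.
  by rewrite divr_ge0 ?(ltW N0)// mulr_ge0 ?(ltW x0)// !mulr_ge0// ltW.
have q0 : 0 < 1 + (4^-1 * v) ^+ 2 by exact: cauchy_den.
have e0 : 0 < expR (`|u| / 2) by exact: expR_gt0.
set D := t ^+ 2 / 4 * (expR u * expR (`|u| / 2) * (1 + (4^-1 * v) ^+ 2)).
have D0 : 0 < D by rewrite /D !mulr_gt0// ?exprn_gt0// invr_gt0.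
have ND : D <= pker_den a b u.
  have aa : (t / 2) ^+ 2 <= a ^+ 2 by rewrite ler_sqr// ?nnegrE; lra.
  have bb : (1 / 2) ^+ 2 <= b ^+ 2 by rewrite ler_sqr// ?nnegrE; lra.
  have p1 := ler_pM (sqr_ge0 _) (mulr_ge0 (ltW x0) (ltW e0)) aa (sq_onePexp_ge u).
  have p3 : 0 <= expR u * expR (`|u| / 2) * (u ^+ 2 / 16).
    apply: mulr_ge0; first by rewrite mulr_ge0// ltW.
    by rewrite divr_ge0// sqr_ge0.
  have p2 := ler_pM (sqr_ge0 _) p3 bb (sq_exp_sub1_ge u).
  apply: le_trans (lerD p1 p2); rewrite /D /u.
  by rewrite le_eqVlt; apply/orP; left; apply/eqP; field.
have n1 : t * (4 * a * b) <= 8 * t ^+ 2.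
  have h : a * b <= (2 * t) * 1 by apply: ler_pM => //; lra.
  have := ler_wpM2l (ltW t0) h; rewrite expr2; lra.
apply: (@le_trans _ _ (8 * t ^+ 2 * expR u / D)).
  apply: ler_pM.
  - by rewrite mulr_ge0 ?(ltW x0)// !mulr_ge0// ltW.
  - by rewrite invr_ge0 ltW.
  - by rewrite ler_wpM2r// ltW.
  - by rewrite lef_pV2.
rewrite expRN /cauchy_fun le_eqVlt; apply/orP; left; apply/eqP; rewrite /D; field.
by rewrite !lt0r_neq0//= ltr_pwDl// sqr_ge0.
Qed.
(** Take phi = pi / 2 - t_n in [reflection_rotated] and rescale u = t_n v. The kernel tends to 4 /
    (4 + v^2), of integral 2 pi, under the domination of [pker_scaled_bound]. The result is Gamma (1
    + z) Gamma (1 - z) = pi z / sin (pi z) with the denominator cleared. *)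
Lemma reflection z : `|Re z| <= 1 / 2 ->
  (cexp (- ('i * pi%:C * z)) - cexp ('i * pi%:C * z)) * (Gamma (1 + z) * Gamma (1 - z)) =
  - 'i * z * (2 * pi)%:C.
Proof.
move=> hz; have [t_ [t0 tp ts tc]] := small_angles.
have tpos n : 0 < t_ n by have /andP[] := tp n.
pose L (p : R) := (cexp (- ('i * p%:C * z)) - cexp ('i * p%:C * z)) * (Gamma (1 + z) * Gamma (1 - z)).
pose a_ n := sin (t_ n); pose b_ n := cos (t_ n).
have a_pos n : 0 < a_ n by have /andP[h _] := ts n; have := tpos n; rewrite /a_; lra.
have ab1 n : a_ n ^+ 2 + b_ n ^+ 2 = 1 by rewrite addrC cos2Dsin2.
pose K n := fun v : R => cexp (z * (t_ n * v)%:C) * (t_ n * pker (a_ n) (b_ n) (t_ n * v))%:C.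
have E n : L (pi - 2 * t_ n) = - 'i * z * cint (K n).
  have hp : 0 < pi / 2 - t_ n < pi / 2 by have /andP[h1 h2] := tp n; apply/andP; split; lra.
  have := reflection_rotated hp hz.
  rewrite cosB sinB cos_pihalf sin_pihalf !mul0r !mul1r add0r subr0.
  have -> : 2 * (pi / 2 - t_ n) = pi - 2 * t_ n by field.
  rewrite -/(L _) => ->; congr (_ * _).
  have i1 := ED1_integrable (pker_ED1 (a_pos n) (ab1 n) hz).
  have e1 := cint_affine 0 (lt0r_neq0 (tpos n)) i1.
  have i2 := cintble_affine 0 (lt0r_neq0 (tpos n)) i1.
  rewrite (gtr0_norm (tpos n)) in e1.
  have tn0 : (t_ n)%:C != 0 :> R[i] by rewrite fmorph_eq0 lt0r_neq0.
  transitivity ((t_ n)%:C * ((t_ n)^-1%:C * cint (fun u => cexp (z * u%:C) * (pker (a_ n) (b_ n) u)%:C))).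
    by rewrite fmorphV mulVKf.
  rewrite -e1 -cintegralZ//.
  by apply: eq_cintegral => v; rewrite /K addr0 [X in _ = _ * X]rmorphM mulrCA.
have Kb n v : Normc.normc (K n v) <= 32 * cauchy_fun (4^-1 * v).
  rewrite /K Normc.normcM normcR normc_cexp cReM /= mulr0 subr0.
  have /andP[k0 k1] := pker_scaled_bound v (tpos n) (ts n) (tc n).
  rewrite (ger0_norm k0).
  have h1 : expR (Re z * (t_ n * v)) <= expR (`|t_ n * v| / 2).
    rewrite ler_expR (le_trans (ler_norm _))// normrM mulrC ler_wpM2l//.
    by rewrite (le_trans hz)// mul1r.
  apply: (le_trans (ler_pM (expR_ge0 _) k0 h1 k1)).
  rewrite expRN mulrCA [_ / 2]mulrC mulVKf//.
have Kc v : ccvg (K ^~ v) (cauchy_fun (2^-1 * v))%:C.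
  rewrite -[X in ccvg _ X]mul1r; apply: ccvgM.
    have tv : t_ n * v @[n --> \oo] --> (0 : R).
      by rewrite -(mul0r v); apply: cvgMl.
    have cz (x : R) : ccontat (fun s : R => cexp (z * s%:C)) x.
      by apply: ccontat_cexp; exact: (ccontatM (ccontat_cst z x) (is_cderive_cont (is_cderive_id x))).
    by have := ccvg_cont (cz 0) tv; rewrite mulr0 cexp0.
  apply: ccvgR.
  have tn n : t_ n != 0 by exact: lt0r_neq0.
  have sc : a_ n / t_ n @[n --> \oo] --> (1 : R).
    have ds : is_derive (0 : R) (1 : R) sin 1 by rewrite -[X in is_derive _ _ _ X]cos0; exact: is_derive_sin.
    have := cvg_difference_quotient ds tn t0.
    by under eq_fun do rewrite sin0 subr0.
  have bc : b_ n @[n --> \oo] --> (1 : R).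
    by rewrite -cos0; exact: (cvg_comp _ _ t0 (@continuous_cos _ 0)).
  have xq : (expR (t_ n * v) - 1) / t_ n @[n --> \oo] --> v.
    have de : is_derive (0 : R) (1 : R) (fun s => expR (s * v)) v.
      by apply: is_derive_eq; rewrite /GRing.scale /= mul0r expR0; ring.
    have := cvg_difference_quotient de tn t0.
    by under eq_fun do rewrite mul0r expR0.
  have xc : expR (t_ n * v) @[n --> \oo] --> (1 : R).
    have tv : t_ n * v @[n --> \oo] --> (0 : R) by rewrite -(mul0r v); apply: cvgMl.
    by rewrite -expR0; exact: (cvg_comp _ _ tv (@continuous_expR _ 0)).
  have Q n : t_ n * pker (a_ n) (b_ n) (t_ n * v) =
     4 * (a_ n / t_ n) * b_ n * expR (t_ n * v) /
     ((a_ n / t_ n) ^+ 2 * (1 + expR (t_ n * v)) ^+ 2 + b_ n ^+ 2 * ((expR (t_ n * v) - 1) / t_ n) ^+ 2).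
    have N0 := lt0r_neq0 (pker_den_gt0 (b_ n) (a_pos n) (t_ n * v)).
    rewrite /pker; rewrite /pker_den in N0 *; move: N0 (tn n).
    move: (expR (t_ n * v)) => X; move: (a_ n) (b_ n) (t_ n) => A B T N0 T0.
    have -> : (A / T) ^+ 2 * (1 + X) ^+ 2 + B ^+ 2 * ((X - 1) / T) ^+ 2 =
      (A ^+ 2 * (1 + X) ^+ 2 + B ^+ 2 * (X - 1) ^+ 2) / T ^+ 2 by field.
    move: N0; set N := _ + _ => N0; by field; rewrite N0 T0.
  rewrite (eq_cvg _ _ Q).
  have -> : cauchy_fun (2^-1 * v) = 4 * 1 * 1 * 1 / (1 ^+ 2 * (1 + 1) ^+ 2 + 1 ^+ 2 * v ^+ 2).
    have h := lt0r_neq0 (cauchy_den (2^-1 * v)).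
    rewrite /cauchy_fun; field.
    have p : 0 < 4 + v ^+ 2 by rewrite ltr_pwDl// sqr_ge0.
    have p' : 0 < (1 + 1) ^+ 2 + v ^+ 2 by rewrite ltr_pwDl// ?sqr_ge0// exprn_gt0.
    by rewrite !lt0r_neq0.
  apply: cvgM.
    by apply: cvgM => //; apply: cvgM => //; apply: cvgM => //; exact: cvg_cst.
  apply: cvgV; first by have := sqr_ge0 v; rewrite expr1n !mul1r => h; apply: lt0r_neq0; rewrite ltr_pwDl// exprn_gt0.
  have sq (f : nat -> R) (l : R) : f n @[n --> \oo] --> l -> f n ^+ 2 @[n --> \oo] --> l ^+ 2.
    by move=> h; rewrite expr2; under eq_fun do rewrite expr2; exact: cvgM.
  apply: cvgD.
    apply: cvgM; apply: sq => //.
    by apply: cvgD => //; exact: cvg_cst.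
  by apply: cvgM; apply: sq.
have iK : leb.-integrable setT (EFin \o (fun v => 32 * cauchy_fun (4^-1 * v))).
  have n4 : (4^-1 : R) != 0 by rewrite invr_eq0 pnatr_eq0.
  exact: (integrableZl measurableT 32 (integrable_cauchy_fun n4)).
have mK n : @cmeas R _ RM (K n).
  have i1 := ED1_integrable (pker_ED1 (a_pos n) (ab1 n) hz).
  have /cintegrable_meas i2 := cintegrableZ (t_ n)%:C (cintble_affine 0 (lt0r_neq0 (tpos n)) i1).
  by apply: cmeas_ext i2 => v; rewrite /K addr0 [X in _ = _ * X]rmorphM mulrCA.
have c1 := cdominated mK Kc iK Kb.
have I : cint (fun v => (cauchy_fun (2^-1 * v))%:C) = (2 * pi)%:C :> R[i].
  apply: complex_ext; rewrite /cintegral /=; first exact: Rintegral_cauchy_fun.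
  by rewrite /Rintegral integral0.
rewrite I in c1.
have c2 := ccvgM (ccvg_cst (- 'i * z)) c1.
have cu (x : R) : ccontat (fun s : R => s%:C) x by exact: (is_cderive_cont (is_cderive_id x)).
have Lc : ccontat L pi by rewrite /L; ccont; exact: cu.
have pc : pi - 2 * t_ n @[n --> \oo] --> (pi : R).
  rewrite -[X in _ --> X]subr0 -[X in _ --> _ - X](mulr0 2).
  by apply: cvgB; [exact: cvg_cst|apply: cvgMr].
have c3 := ccvg_cont Lc pc.
rewrite (_ : (fun n => L _) = (fun n => - 'i * z * cint (K n))) in c3; last first.
  by apply/funext => n; exact: E.
exact: (ccvg_unique c3 c2).
Qed.

Lemma ii_neq0 : 'i != 0 :> R[i].
Proof. by apply/eqP => /(congr1 (@complex.Im R)) /= /eqP; rewrite oner_eq0. Qed.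

(** In the strip 1/2 <= Re z <= 3/2 a zero would make the left side of [reflection] at z - 1 vanish
    and force z = 1, where Gamma is 1. The functional equation carries this to the right by
    induction, and to 0 < Re w < 1/2 by one step. *)
Lemma Gamma_neq0 w : 0 < Re w -> Gamma w != 0.
Proof.
have strip z : 1 / 2 <= Re z <= 3 / 2 -> Gamma z != 0.
  move=> /andP[h1 h2]; apply/eqP => G0.
  have hz : `|Re (z - 1)| <= 1 / 2 by rewrite cReD cReN /= ler_norml; apply/andP; split; lra.
  have := reflection hz; rewrite (_ : 1 + (z - 1) = z) ?G0; last by ring.
  have P2 : (2 * pi)%:C != 0 :> R[i] by rewrite fmorph_eq0 gt_eqF// mulr_gt0// pi_gt0.
  rewrite mul0r mulr0 => /esym/eqP.
  rewrite mulf_eq0 (negbTE P2) orbF mulf_eq0 oppr_eq0 (negbTE ii_neq0) subr_eq0 => /eqP z1.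
  by move: G0; rewrite z1 Gamma_1 => /eqP; rewrite oner_eq0.
have big n z : 1 / 2 <= Re z <= n%:R + 3 / 2 -> Gamma z != 0.
  elim: n z => [|n IH] z /andP[h1 h2]; first by apply: strip; rewrite h1; move: h2; rewrite add0r.
  have [h3|h3] := leP (Re z) (3 / 2); first by apply: strip; rewrite h1.
  have h4 : 1 / 2 <= Re (z - 1) by rewrite cReD cReN /=; lra.
  have z1 : 0 < Re (z - 1) by apply: lt_le_trans h4; lra.
  rewrite -[z](subrK 1) GammaS// mulf_neq0//.
    by apply/eqP => e; move: z1; rewrite e ltxx.
  by apply: IH; rewrite h4 cReD cReN /=; move: h2; rewrite -natr1; lra.
have right z : 1 / 2 <= Re z -> Gamma z != 0.
  move=> h; apply: (big (Num.truncn (Re z))).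
  by rewrite h; have := truncnS_gt (Re z); rewrite -natr1; lra.
move=> w0; have [h|h] := leP (1 / 2) (Re w); first exact: right.
apply/eqP => G0; have /eqP := GammaS w0; rewrite G0 mulr0; apply/negP.
by apply: right; rewrite cReD /=; lra.
Qed.

(** At z = i y the exponentials in [reflection] are real. At y = 0 both sides are 0, thanks to the
    value 0 of [Gamma] at its pole. *)
Lemma GammaGamma_inv y :
  (Gamma ('i * y%:C) * Gamma (- ('i * y%:C)))^-1 =
  (y * (expR (pi * y) - expR (- (pi * y))) / (2 * pi))%:C :> R[i].
Proof.
have eN : - ('i * y%:C) = 'i * (- y)%:C :> R[i] by rewrite rmorphN mulrN.
rewrite eN !Gamma_Re0; have [->|y0] := eqVneq y 0.
  by rewrite mulr0 invr0 mulr0 mul0r invr0 !mul0r.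
have hz : `|Re ('i * y%:C)| <= 1 / 2 by rewrite cReM /= mul0r mulr0 subrr normr0; lra.
have := reflection hz.
have -> : - ('i * pi%:C * ('i * y%:C)) = (pi * y)%:C :> R[i].
  by rewrite mulrACA ii_m1 mulN1r opprK rmorphM.
have -> : 'i * pi%:C * ('i * y%:C) = (- (pi * y))%:C :> R[i].
  by rewrite mulrACA ii_m1 mulN1r rmorphN rmorphM.
have -> : - 'i * ('i * y%:C) = y%:C :> R[i] by rewrite mulNr mulrA ii_m1 mulN1r opprK.
rewrite !cexpR -rmorphB [1 + _]addrC eN [1 + _]addrC.
set e := (expR _ - _)%R; set G := Gamma _; set H := Gamma _ => E.
have Y0 : y%:C != 0 :> R[i] by rewrite fmorph_eq0.
have P0 : (2 * pi)%:C != 0 :> R[i] by rewrite fmorph_eq0 gt_eqF// mulr_gt0// pi_gt0.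
have /andP[e0 GH0] : (e%:C != 0) && (G * H != 0).
  by rewrite -negb_or -mulf_eq0 E mulf_neq0.
rewrite -eN.
have yy : 'i * y%:C * - ('i * y%:C) = y%:C * y%:C :> R[i].
  by rewrite mulrN mulrACA ii_m1 mulN1r opprK.
have -> : G / ('i * y%:C) * (H / - ('i * y%:C)) = (G * H) / (y%:C * y%:C).
  by rewrite mulrACA -invfM yy.
have -> : (y * e / (2 * pi))%:C = y%:C * e%:C / (2 * pi)%:C :> R[i] by rewrite fmorph_div rmorphM.
rewrite invf_div -[G * H](mulKf e0) E.
move: Y0 P0 e0; move: (2 * pi)%:C e%:C y%:C => Q F Y Y0 Q0 F0.
by field; rewrite F0 Y0 Q0.
Qed.

End Reflection.

(** * Hyperbolic substitutions *)

Section HalfLine.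
Context {R : realType}.
Local Notation leb := (@lebesgue_measure R).
Local Notation RM := (measurableTypeR R).
Implicit Types (k : R -> R[i]) (s m w A B : R[i]).

Lemma cintble_ext (f g : R -> R[i]) : f =1 g -> cintble f -> cintble g.
Proof. by move=> /funext ->. Qed.

Lemma posreal_bigcup :
  `]0, +oo[%classic = \bigcup_n `[expR (- n%:R), expR n%:R]%classic :> set R.
Proof.
apply/seteqP; split => x /=.
  rewrite in_itv/= andbT => x0; exists (Num.truncn `|ln x|).+1 => //.
  rewrite /= in_itv/= -[x]lnK ?posrE// !ler_expR -ler_norml expRK.
  exact/ltW/Num.Theory.truncnS_gt.
move=> [n _] /=; rewrite !in_itv/= andbT => /andP[h _].
by apply: lt_le_trans h; exact: expR_gt0.
Qed.

(** Twice sinh, with [ccosh2] twice cosh as its derivative; in this normalization [quarter_den_mul]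
    and [ccosh2_sumdiff] carry no numerical factors. *)
Definition csinh2 (u : R) : R := expR u - expR (- u).
Definition ccosh2 (u : R) : R := expR u + expR (- u).

Lemma ccosh2_gt0 u : 0 < ccosh2 u.
Proof. by rewrite addr_gt0// expR_gt0. Qed.

Lemma csinh2N u : csinh2 (- u) = - csinh2 u.
Proof. by rewrite /csinh2 opprK opprB. Qed.

Lemma is_derive_csinh2 u : is_derive u (1 : R) csinh2 (ccosh2 u).
Proof.
rewrite /csinh2 /ccosh2; apply: is_derive_eq; rewrite /GRing.scale /=; ring.
Qed.

Lemma continuous_csinh2 : continuous csinh2.
Proof.
move=> u; apply: differentiable_continuous; apply/derivable1_diffP.
by have [] := is_derive_csinh2 u.
Qed.

Lemma continuous_ccosh2 : continuous ccosh2.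
Proof.
move=> u; apply: differentiable_continuous; apply/derivable1_diffP.
by rewrite /ccosh2; apply: ex_derive.
Qed.

Lemma measurable_csinh2 : measurable_fun [set: RM] csinh2.
Proof. exact: continuous_measurable_fun continuous_csinh2. Qed.

Lemma measurable_ccosh2 : measurable_fun [set: RM] ccosh2.
Proof. exact: continuous_measurable_fun continuous_ccosh2. Qed.

Lemma csinh2_incr x y : x < y -> csinh2 x < csinh2 y.
Proof.
by move=> xy; rewrite /csinh2 ltrB// ltr_expR// ltrN2.
Qed.

Lemma csinh2_ge u : 0 <= u -> u <= csinh2 u.
Proof.
move=> u0; have h1 := expR_ge1Dx u.
have h2 : expR (- u) <= 1 by rewrite -[leRHS]expR0 ler_expR oppr_le0.
by rewrite /csinh2; lra.
Qed.

Lemma csinh2_bigcup :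
  setT = \bigcup_n `[csinh2 (- n%:R), csinh2 n%:R]%classic :> set R.
Proof.
apply/esym; rewrite -subTset => x _ /=; exists (Num.truncn `|x|).+1 => //.
rewrite /= in_itv/= csinh2N -ler_norml; apply: le_trans (csinh2_ge _) => //.
exact/ltW/Num.Theory.truncnS_gt.
Qed.

Section Substitutions.
Variables (F f : R -> R) (D : set R).
Hypothesis incrF : forall x y, x < y -> F x < F y.
Hypothesis dF : forall x : R, is_derive x (1 : R) F (f x).
Hypothesis cf : continuous f.
Hypothesis f_ge0 : forall x, 0 <= f x.
Hypothesis mF : measurable_fun [set: RM] F.
Hypothesis mD : measurable (D : set RM).
Hypothesis DF : D = \bigcup_n `[F (- n%:R), F n%:R]%classic.
Variable k : R -> R[i].
Hypothesis mk : @cmeas R _ RM k.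
Hypothesis k0 : forall x, ~ D x -> k x = 0.
Hypothesis ck : {in D, forall x, ccontat k x}.

Lemma cint_substitution : cint k = cint (fun u => k (F u) * (f u)%:C).
Proof.
have mge : @cmeas R _ RM (k \o F) by exact: (cmeas_comp mk mF).
have real (h : R[i] -> R) (hZ : forall (a : R) c, h (c * a%:C) = h c * a)
    (h0 : h 0 = 0)
    (ch : forall t, t \in D -> {for t, continuous (h \o k)})
    (mh : measurable_fun setT (h \o k)) (mhe : measurable_fun setT ((h \o k) \o F)) :
    (\int[leb]_t h (k t) = \int[leb]_u h (k (F u) * (f u)%:C)%R)%R.
  rewrite /Rintegral; congr fine.
  transitivity (\int[leb]_(t in D) (h (k t))%:E)%E.
    rewrite [RHS]integral_mkcond; apply: eq_integral => t _; rewrite patchE.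
    by case: ifPn => //; rewrite notin_setE => /k0 ->; rewrite h0.
  rewrite (@substitution_increasing _ F f _ _ _ _ _ _ DF (h \o k)) => //=.
  - by apply: eq_integral => u _; rewrite hZ.
  - exact: measurable_funTS.
apply: complex_ext.
  apply: (real (@complex.Re R)) => //; [by move=> a c; rewrite mulrC cReZ mulrC|
    by move=> t t0; have [] := ck t0|by case: mk|by case: mge].
apply: (real (@complex.Im R)) => //; [by move=> a c; rewrite mulrC cImZ mulrC|
    by move=> t t0; have [] := ck t0|by case: mk|by case: mge].
Qed.

Lemma cintble_substitution : cintble (fun u => k (F u) * (f u)%:C) -> cintble k.
Proof.
have mge : @cmeas R _ RM (k \o F) by exact: (cmeas_comp mk mF).
have real (h : R[i] -> R) (hZ : forall (a : R) c, h (c * a%:C) = h c * a)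
    (h0 : h 0 = 0)
    (ch : forall t, t \in D -> {for t, continuous (h \o k)})
    (mh : measurable_fun setT (h \o k)) (mhe : measurable_fun setT ((h \o k) \o F)) :
    leb.-integrable setT (EFin \o (fun u => h (k (F u) * (f u)%:C))) ->
    leb.-integrable setT (EFin \o (fun t => h (k t))).
  move=> /integrableP[_ hi]; apply/integrableP; split; first exact/measurable_EFinP.
  apply: le_lt_trans hi; rewrite le_eqVlt; apply/orP; left; apply/eqP.
  transitivity (\int[leb]_(t in D) (`|h (k t)|)%:E)%E.
    rewrite [RHS]integral_mkcond; apply: eq_integral => t _; rewrite patchE /=.
    by case: ifPn => //; rewrite notin_setE => /k0 ->; rewrite h0 normr0.
  rewrite (@ge0_substitution_increasing _ F f _ _ _ _ _ _ DF (fun t => `|h (k t)|)) => //=.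
  - by apply: eq_integral => u _; rewrite hZ normrM (ger0_norm (f_ge0 u)).
  - by move=> t tD; apply: (@cvg_norm _ _ _ _ _ (h \o k)); exact: ch.
  - by apply: measurable_funTS; exact: measurableT_comp.
  - exact: measurableT_comp mhe.
move=> [i1 i2]; split.
  apply: (real (@complex.Re R)) i1 => //; [by move=> a c; rewrite mulrC cReZ mulrC|
    by move=> t t0; have [] := ck t0|by case: mk|by case: mge].
apply: (real (@complex.Im R)) i2 => //; [by move=> a c; rewrite mulrC cImZ mulrC|
    by move=> t t0; have [] := ck t0|by case: mk|by case: mge].
Qed.

End Substitutions.

Lemma cint_sinh k : (forall x, ccontat k x) ->
  cintble (fun u => k (csinh2 u) * (ccosh2 u)%:C) ->
  cintble k /\ cint k = cint (fun u => k (csinh2 u) * (ccosh2 u)%:C).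
Proof.
move=> ck ik; have mk := ccont_meas ck.
have ge0 u : 0 <= ccosh2 u by rewrite ltW// ccosh2_gt0.
have k0 x : ~ [set: R] x -> k x = 0 by move=> h; case: h.
have ck' : {in [set: R], forall x, ccontat k x} by move=> x _; exact: ck.
split.
  exact: (cintble_substitution csinh2_incr is_derive_csinh2 continuous_ccosh2 ge0
    measurable_csinh2 measurableT csinh2_bigcup mk k0 ck' ik).
exact: (cint_substitution csinh2_incr is_derive_csinh2 continuous_ccosh2 ge0
    measurable_csinh2 measurableT csinh2_bigcup mk k0 ck').
Qed.

Lemma cint_halfline k : @cmeas R _ RM k -> (forall x, x <= 0 -> k x = 0) ->
  (forall x, 0 < x -> ccontat k x) ->
  cintble (fun u => k (expR u) * (expR u)%:C) ->
  cintble k /\ cint k = cint (fun u => k (expR u) * (expR u)%:C).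
Proof.
move=> mk k0 ck ik.
have incr x y : x < y -> expR x < expR y :> R by rewrite ltr_expR.
have k0' x : ~ `]0%R, +oo[%classic x -> k x = 0.
  by rewrite /= in_itv/= andbT => /negP; rewrite -leNgt; exact: k0.
have ck' : {in `]0%R, +oo[%classic, forall x, ccontat k x}.
  by move=> x; rewrite inE/= in_itv/= andbT; exact: ck.
have mD : measurable (`]0%R, +oo[%classic : set RM) by exact: measurable_itv.
have me : measurable_fun [set: RM] (@expR R) by exact: measurable_expR.
split.
  exact: (cintble_substitution incr (@is_derive_expR R) (@continuous_expR R) (@expR_ge0 R)
    me mD posreal_bigcup mk k0' ck' ik).
exact: (cint_substitution incr (@is_derive_expR R) (@continuous_expR R) (@expR_ge0 R)
    me mD posreal_bigcup mk k0' ck').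
Qed.

(** The function r ^ (m - 1) exp (- B r) on the half line, extended by 0. Its Fourier transform is
    [GI m] on a vertical line, which makes that line function invertible. *)
Definition gamma_density m B (r : R) : R[i] :=
  if 0 < r then cexp ((m - 1) * (ln r)%:C - B * r%:C) else 0.

Lemma gamma_density_expR m B u : gamma_density m B (expR u) * (expR u)%:C = gexp m B u.
Proof.
rewrite /gamma_density expR_gt0 expRK /gexp -[X in _ * X]cexpR -cexpD; congr cexp; ring.
Qed.

Lemma cmeas_gamma_density m B : @cmeas R _ RM (gamma_density m B).
Proof.
have mb : measurable_fun [set: RM] (fun r : R => (0 : R) < r).
  by apply: measurable_fun_ltr; [exact: measurable_cst|exact: measurable_id].
have [m1 m2] : @cmeas R _ RM (fun r => cexp ((m - 1) * (ln r)%:C - B * r%:C)) by cmeas.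
split.
  apply: (eq_measurable_fun (fun r : R => if 0 < r then Re (cexp ((m - 1) * (ln r)%:C - B * r%:C)) else 0)).
    by move=> r _; rewrite /gamma_density /comp; case: ifP.
  by apply: measurable_fun_ifT => //; exact: measurable_cst.
apply: (eq_measurable_fun (fun r : R => if 0 < r then Im (cexp ((m - 1) * (ln r)%:C - B * r%:C)) else 0)).
  by move=> r _; rewrite /gamma_density /comp; case: ifP.
by apply: measurable_fun_ifT => //; exact: measurable_cst.
Qed.

Lemma gamma_density_cont m B x : 0 < x -> ccontat (gamma_density m B) x.
Proof.
move=> x0; have cu : ccontat (fun r : R => r%:C) x by exact: (is_cderive_cont (is_cderive_id x)).
have cl : ccontat (fun r : R => (ln r)%:C) x by apply: ccontatR; exact: continuous_ln.
have [c1 c2] : ccontat (fun r => cexp ((m - 1) * (ln r)%:C - B * r%:C)) x.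
  by ccont; exact: cu.
have e (h : R[i] -> R) : {for x, continuous (fun r => h (cexp ((m - 1) * (ln r)%:C - B * r%:C)))} ->
   {for x, continuous (h \o gamma_density m B)}.
  move=> hc; rewrite /prop_for /continuous_at /= {2}/gamma_density x0.
  apply: cvg_trans hc; apply: near_eq_cvg; near=> r.
  rewrite /= /gamma_density ifT//; near: r; exact: lt_nbhsr.
by split; exact: e.
Unshelve. all: by end_near.
Qed.

Lemma gamma_density_FT m B (s : R) : 0 < Re m -> 0 < Re B ->
  cintble (fun r => gamma_density m B r * cexp ('i * (s * r)%:C)) /\
  cint (fun r => gamma_density m B r * cexp ('i * (s * r)%:C)) = GI m (B - 'i * s%:C).
Proof.
move=> m0 B0; have BB : Re (B - 'i * s%:C) = Re B by rewrite !reimE /=; ring.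
have E u : gamma_density m B (expR u) * cexp ('i * (s * expR u)%:C) * (expR u)%:C =
    gexp m (B - 'i * s%:C) u.
  rewrite mulrAC gamma_density_expR /gexp -cexpD; congr cexp; rewrite rmorphM; ring.
have i1 : cintble (gexp m (B - 'i * s%:C)).
  by apply: ED1_integrable; apply: gexp_ED1; rewrite ?BB.
have [||||h1 h2] := @cint_halfline (fun r => gamma_density m B r * cexp ('i * (s * r)%:C)).
- by apply: cmeasM; [exact: cmeas_gamma_density|cmeas].
- by move=> x x0; rewrite /gamma_density ltNge x0 mul0r.
- move=> x x0; apply: ccontatM; first exact: gamma_density_cont.
  apply: ccontat_cexp; apply: ccontatM; first exact: ccontat_cst.
  by apply: ccontatR; apply: continuousM; [exact: cvg_cst|exact: cvg_id].
- by apply: cintble_ext i1 => u; rewrite E.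
split => //; rewrite h2; apply: eq_cintegral => u; exact: E.
Qed.

Lemma gamma_density_int m B : 0 < Re m -> 0 < Re B -> cintble (gamma_density m B).
Proof.
move=> m0 B0; have [h _] := gamma_density_FT 0 m0 B0.
by apply: cintble_ext h => u; rewrite mul0r mulr0 cexp0 mulr1.
Qed.

(** The condition 1 < Re m keeps the density bounded near 0, as [fourier_inversion] demands. *)
Lemma gamma_density_bdd m B : 1 < Re m -> 0 < Re B ->
  exists K, forall r, Normc.normc (gamma_density m B r) <= K.
Proof.
move=> m1 B0; have m0 : 0 < Re (m - 1) by rewrite cReD cReN /=; lra.
have [K hK] := ED1_bdd (gexp_ED1 m0 B0).
exists K => r; rewrite /gamma_density; case: ifPn => [r0|_]; last first.
  by rewrite normcR normr0 (le_trans (normc_ge0 _) (hK 0)).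
by have := hK (ln r); rewrite /gexp lnK.
Qed.

(** The bound is put in the form expected by [P_bound]. If exp |u| <= 2 the real part b suffices;
    otherwise the imaginary part does, being at least exp |u| - 1 and hence at least half of exp
    |u|. *)
Lemma normc_csinh2_ge (b u : R) : 0 < b ->
  expR (ln (Num.min b 1 / 2) + `|u|) <= Normc.normc (b%:C + 'i * (csinh2 u)%:C).
Proof.
move=> b0; set k := Num.min b 1 / 2.
have k0 : 0 < k by rewrite divr_gt0// lt_min b0 ltr01.
have kb : 2 * k <= b by rewrite /k mulrC divfK// ge_min lexx.
have k1 : 2 * k <= 1 by rewrite /k mulrC divfK// ge_min lexx orbT.
rewrite expRD lnK//.
have h1 : b <= Normc.normc (b%:C + 'i * (csinh2 u)%:C).
  apply: le_trans (le_Re_normc _); rewrite !reimE /= (le_trans _ (ler_norm _))//; lra.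
have h2 : `|csinh2 u| <= Normc.normc (b%:C + 'i * (csinh2 u)%:C).
  by apply: le_trans (le_Im_normc _); rewrite !reimE /= (_ : 0 + _ = csinh2 u)//; ring.
have h3 : expR `|u| - 1 <= `|csinh2 u|.
  have h y : 0 <= y -> expR y - 1 <= csinh2 y.
    by move=> y0; rewrite /csinh2 lerD2l lerN2 -[leRHS]expR0 ler_expR oppr_le0.
  have [u0|u0] := leP 0 u.
    by rewrite (ger0_norm u0) (le_trans (h _ u0))// ler_norm.
  rewrite (ltr0_norm u0) -normrN -csinh2N (le_trans (h _ _)) ?ler_norm//; lra.
set N := Normc.normc _ in h1 h2 *.
have [e2|e2] := leP (expR `|u|) 2.
  have := ler_wpM2l (ltW k0) e2; lra.
have e0 := expR_gt0 `|u|.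
have h4 : k <= 1 / 2 by lra.
have := ler_wpM2r (ltW e0) h4; lra.
Qed.

(** The power decays like exp (- Re m |u|) and the Jacobian costs exp |u|, whence the rate Re m -
    1. *)
Lemma GI_csinh2_ED1 m (b : R) : 1 < Re m -> 0 < b ->
  ED1 (fun u => GI m (b%:C + 'i * (csinh2 u)%:C) * (ccosh2 u)%:C).
Proof.
move=> m1 b0; have m0 : 0 < Re m by lra.
have bb u : 0 < Re (b%:C + 'i * (csinh2 u)%:C) by rewrite !reimE /=; lra.
have E u : Gamma m * P m (b%:C + 'i * (csinh2 u)%:C) * (ccosh2 u)%:C =
   GI m (b%:C + 'i * (csinh2 u)%:C) * (ccosh2 u)%:C by rewrite GI_Gamma.
apply: ED1_ext E _; split.
  apply: cmeasM; last exact: cmeasR measurable_ccosh2.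
  apply: cmeasM; first exact: cmeas_cst.
  apply: cmeas_P => //; apply: cmeasD; first exact: cmeas_cst.
  by apply: cmeasM; [exact: cmeas_cst|exact: cmeasR measurable_csinh2].
set k := ln (Num.min b 1 / 2).
exists (Normc.normc (Gamma m) * (expR (`|Im m| * (pi / 2)) * expR (- (Re m * k))) * 2), (Re m - 1).
split; [|lra|].
  by rewrite !mulr_ge0 ?expR_ge0 ?normc_ge0.
move=> u; rewrite 2!Normc.normcM normcR (ger0_norm (ltW (ccosh2_gt0 u))).
have h := P_bound (bb u) (ltW m0) (normc_csinh2_ge u b0).
have c2 : ccosh2 u <= 2 * expR `|u|.
  have h1 : expR u <= expR `|u| by rewrite ler_expR ler_norm.
  have h2 : expR (- u) <= expR `|u| by rewrite ler_expR -normrN ler_norm.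
  by rewrite /ccosh2; lra.
apply: (le_trans (ler_pM _ _ (ler_wpM2l (normc_ge0 _) h) c2)).
- by rewrite mulr_ge0 ?normc_ge0.
- exact: ltW (ccosh2_gt0 u).
have e1 : expR (- (Re m * (k + `|u|))) = expR (- (Re m * k)) * expR (- (Re m * `|u|)).
  by rewrite -expRD; congr expR; ring.
have e2 : edec (Re m - 1) u = expR (- (Re m * `|u|)) * expR `|u|.
  by rewrite /edec -expRD; congr expR; ring.
by rewrite -/k e1 e2 le_eqVlt; apply/orP; left; apply/eqP; ring.
Qed.

Lemma GI_vertical_cont m B (s : R) : 0 < Re m -> 0 < Re B ->
  ccontat (fun s : R => GI m (B + 'i * s%:C)) s.
Proof.
move=> m0 B0; have cu : ccontat (fun r : R => r%:C) s by exact: (is_cderive_cont (is_cderive_id s)).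
rewrite (_ : (fun s : R => GI m _) = (fun s : R => Gamma m * P m (B + 'i * s%:C))); last first.
  by apply/funext => r; rewrite GI_Gamma// !reimE /=; lra.
apply: ccontatM; first exact: ccontat_cst.
apply: ccontat_P; last by rewrite !reimE /=; lra.
by ccont.
Qed.

(** With s = 2 sinh u as variable this is Fourier inversion of [gamma_density]. The substitution
    also supplies the integrability of its transform, from the exponential decay in u. *)
Lemma GI_csinh2_wave m (b x : R) : 1 < Re m -> 0 < b -> 0 < x ->
  cint (fun u => GI m (b%:C + 'i * (csinh2 u)%:C) * (ccosh2 u)%:C * cexp ('i * (csinh2 u * x)%:C)) =
  (2 * pi)%:C * gamma_density m b%:C x.
Proof.
move=> m1 b0 x0; have m0 : 0 < Re m by lra.
have B0 : 0 < Re b%:C by [].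
have e1 := GI_csinh2_ED1 m1 b0.
have mw (y : R) : @cmeas R _ RM (fun u => cexp ('i * (u * y)%:C)) by cmeas.
have nw (y : R) : Normc.normc (cexp ('i * y%:C)) = 1 :> R.
  by rewrite normc_cexp cReM /= mul0r mulr0 subrr expR0.
have ck (y : R) : ccontat (fun s : R => GI m (b%:C + 'i * s%:C)) y by exact: GI_vertical_cont.
have [i1 _] := cint_sinh ck (ED1_integrable e1).
pose k (s : R) := GI m (b%:C + 'i * s%:C) * cexp ('i * (s * x)%:C).
have ckk y : ccontat k y.
  apply: ccontatM; first exact: ck.
  apply: ccontat_cexp; apply: ccontatM; first exact: ccontat_cst.
  by apply: ccontatR; apply: continuousM; [exact: cvg_id|exact: cvg_cst].
have i2 : cintble (fun u => k (csinh2 u) * (ccosh2 u)%:C).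
  apply: (cintegrable_bound _ (cintegrable_normc (ED1_integrable e1))).
    rewrite /k; apply: cmeasM; last exact: cmeasR measurable_ccosh2.
    by apply: (cmeas_comp (ccont_meas ckk)); exact: measurable_csinh2.
  by move=> u; rewrite /k mulrAC Normc.normcM nw mulr1.
have [i3 E3] := cint_sinh ckk i2.
transitivity (cint (fun u => k (csinh2 u) * (ccosh2 u)%:C)).
  by apply: eq_cintegral => u; rewrite /k mulrAC.
rewrite -E3 -(cint_opp i3).
have [K hK] := gamma_density_bdd m1 B0.
have FT (s : R) := (gamma_density_FT s m0 B0).2.
have i4 : cintble (fun s : R => cint (fun r => gamma_density m b%:C r * cexp ('i * (s * r)%:C))).
  have := cintble_opp i1; apply: cintble_ext => s.
  by rewrite FT rmorphN mulrN.
rewrite -(fourier_inversion (gamma_density_int m0 B0) hK (gamma_density_cont m b%:C x0) i4).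
apply: eq_cintegral => s; rewrite FT /k rmorphN mulrN mulNr rmorphN mulrN //.
Qed.

(** Expanding the first factor by Euler's integral in y turns the u-integral into [GI_csinh2_wave]
    at x = exp y. The factors exp (- a exp y) and exp (- b exp y) merge, and the exponents add up to
    s + m - 1. *)
Lemma GI_sinh_convolution s m (a b : R) : 0 < Re s -> 1 < Re m -> 0 < a -> 0 < b ->
  cint (fun u => GI s (a%:C - 'i * (csinh2 u)%:C) *
                 (GI m (b%:C + 'i * (csinh2 u)%:C) * (ccosh2 u)%:C)) =
  (2 * pi)%:C * GI (s + m - 1) (a + b)%:C.
Proof.
move=> s0 m1 a0 b0; have e1 := GI_csinh2_ED1 m1 b0.
set g := fun u => GI m (b%:C + 'i * (csinh2 u)%:C) * (ccosh2 u)%:C.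
have A0 : 0 < Re a%:C by [].
have e2 := gexp_ED1 s0 A0.
have nw (y : R) : Normc.normc (cexp ('i * y%:C)) = 1 :> R.
  by rewrite normc_cexp cReM /= mul0r mulr0 subrr expR0.
pose F u y := gexp s a%:C y * cexp ('i * (csinh2 u * expR y)%:C) * g u.
have mF : @cmeas R _ (RM * RM)%type (fun p => F p.1 p.2).
  apply: cmeasM; last by apply: (cmeas_comp e1.1); exact: measurable_fst.
  apply: cmeasM; first by apply: (cmeas_comp (cmeas_gexp s a%:C)); exact: measurable_snd.
  apply: cmeas_cexp; apply: cmeasM; first exact: cmeas_cst.
  apply: cmeasR; apply: measurable_funM.
    by apply: (measurableT_comp measurable_csinh2); exact: measurable_fst.
  by apply: meas_expR; exact: measurable_snd.
have i1 := cintegrable_normc (ED1_integrable e1).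
have i2 := cintegrable_normc (ED1_integrable e2).
have Fb u y : Normc.normc (F u y) <= Normc.normc (g u) * Normc.normc (gexp s a%:C y).
  by rewrite /F 2!Normc.normcM nw mulr1 mulrC.
transitivity (cint (fun u => cint (F u))).
  apply: eq_cintegral => u; rewrite /F cintegralZr; last first.
    apply: (cintegrable_bound _ i2) => [|y]; last by rewrite Normc.normcM nw mulr1.
    by apply: cmeasM; [exact: cmeas_gexp|cmeas].
  congr (_ * _); rewrite /GI; apply: eq_cintegral => y.
  by rewrite /gexp -cexpD; congr cexp; rewrite rmorphM; ring.
rewrite (cfubini_dom mF i1 i2 Fb).
have sm : 0 < Re (s + m - 1) by rewrite !reimE /=; lra.
have ab : 0 < Re (a + b)%:C by rewrite /=; lra.
rewrite /GI -cintegralZ; last by apply: ED1_integrable; exact: gexp_ED1.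
apply: eq_cintegral => y.
transitivity (cint (fun u => gexp s a%:C y * (g u * cexp ('i * (csinh2 u * expR y)%:C)))).
  by apply: eq_cintegral => u; rewrite /F -[LHS]mulrA [X in _ * X]mulrC.
rewrite cintegralZ; last first.
  apply: (cintegrable_bound _ i1) => [|u]; last by rewrite Normc.normcM nw mulr1.
  apply: cmeasM; first exact: e1.1.
  apply: cmeas_cexp; apply: cmeasM; first exact: cmeas_cst.
  by apply: cmeasR; apply: measurable_funM; [exact: measurable_csinh2|exact: measurable_cst].
rewrite (GI_csinh2_wave m1 b0 (expR_gt0 y)) mulrCA; congr (_ * _).
rewrite /gamma_density expR_gt0 expRK /gexp -cexpD; congr cexp; rewrite rmorphD; ring.
Qed.

End HalfLine.

(** * The de Branges-Wilson integral *)

Section WilsonPair.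
Context {R : realType}.
Implicit Types (a b c d s n w : R[i]) (t u v : R).

(* The beta integral is used on the ray of argument pi / 2: this puts the factor
   exp (pi t / 2) in front of Gamma (a + i t) Gamma (b - i t), and turns the sum over
   the reflected pair into a convergent double integral. *)
Definition quarter_den u : R[i] := wave_den (pi / 4) u.

Lemma pi_quarter_bounds : 0 < (pi : R) / 4 < pi / 2.
Proof. by have := pi_gt0 R; move=> h; apply/andP; split; lra. Qed.

Lemma Re_quarter_den u : 0 < Re (quarter_den u).
Proof.
have /andP[h1 h2] := pi_quarter_bounds.
rewrite /quarter_den wave_denE !reimE /= mul0r mul1r subr0 addr0.
by rewrite mulr_gt0 ?addr_gt0 ?expR_gt0// cos_gt0_pihalf// h2 andbT; lra.
Qed.

Definition beta_wave a b t u : R[i] :=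
  cexp ((a + 'i * t%:C) * u%:C) * GI (a + b) (quarter_den u).

Lemma beta_wave_int a b t : 0 < Re a -> 0 < Re b ->
  ED1 (beta_wave a b t) /\
  cint (beta_wave a b t) = Gamma (a + 'i * t%:C) * Gamma (b - 'i * t%:C) *
    cexp ((b - a) * ('i * (pi / 4)%:C) + (pi / 2 * t)%:C).
Proof.
move=> a0 b0; have /andP[q0 q1] := pi_quarter_bounds.
have h1 : 0 < Re (a + 'i * t%:C) by rewrite ReDi.
have E1 : a + b - (a + 'i * t%:C) = b - 'i * t%:C by ring.
have h2 : 0 < Re (b - 'i * t%:C) by rewrite subiE ReDi.
have h3 : 0 < Re (a + b - (a + 'i * t%:C)) by rewrite E1.
have w1 : 0 < Re (cexp ('i * (- (pi / 4))%:C) : R[i]).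
  by rewrite Re_cexp_ii cosN cos_gt0_pihalf// q1 andbT; lra.
have w2 : 0 < Re (cexp ('i * (pi / 4)%:C) : R[i]).
  by rewrite Re_cexp_ii cos_gt0_pihalf// q1 andbT; lra.
have [e1 e2] := beta_ED1 h1 h3 w1 w2.
split; first exact: e1.
rewrite [LHS]e2 E1 (GI_Gamma h1 w2) (GI_Gamma h2 w1) !P_cexp; last 2 first.
- by rewrite !reimE /= !(mul0r, mul1r, add0r); apply/andP; split; lra.
- by rewrite !reimE /= !(mul0r, mul1r, add0r); apply/andP; split; lra.
have -> : cexp ((b - a) * ('i * (pi / 4)%:C) + (pi / 2 * t)%:C) =
   cexp (- ((a + 'i * t%:C) * ('i * (pi / 4)%:C))) *
   cexp (- ((b - 'i * t%:C) * ('i * (- (pi / 4))%:C))).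
  rewrite -cexpD; congr cexp.
  have -> : (pi / 2 * t)%:C = - ('i * 'i) * (2 * t%:C * (pi / 4)%:C) :> R[i].
    rewrite ii_m1 opprK mul1r (_ : pi / 2 * t = 2 * t * (pi / 4)); last by field.
    by rewrite !rmorphM rmorph_nat.
  by rewrite rmorphN; ring.
set A := Gamma _; set B := cexp _; set C := Gamma _; set D := cexp _; ring.
Qed.

(** Each wave contributes exp (pi t / 2), so a pair carries exp (pi t), half of the exponent 2 pi t
    in Wilson's density. The coordinates u + v and u - v prepare for [quarter_den_mul]. *)
Lemma beta_wave_pair a b c d t : 0 < Re a -> 0 < Re b -> 0 < Re c -> 0 < Re d ->
  ED2 (fun u v => beta_wave a b t (u + v) * beta_wave c d t (u - v)) /\
  Gamma (a + 'i * t%:C) * Gamma (b - 'i * t%:C) *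
    (Gamma (c + 'i * t%:C) * Gamma (d - 'i * t%:C)) *
    cexp ((b - a + (d - c)) * ('i * (pi / 4)%:C)) * cexp (pi * t)%:C =
  2 * cint (fun u => cint (fun v => beta_wave a b t (u + v) * beta_wave c d t (u - v))).
Proof.
move=> a0 b0 c0 d0.
have [e1 i1] := beta_wave_int t a0 b0; have [e2 i2] := beta_wave_int t c0 d0.
have e12 := ED2_prod e1 e2.
split; first exact: (ED2_sumdiff e12).
rewrite -(cint_sumdiff e12).
transitivity (cint (beta_wave a b t) * cint (beta_wave c d t)).
  rewrite i1 i2.
  rewrite -[LHS]mulrA (_ : cexp ((b - a + (d - c)) * ('i * (pi / 4)%:C)) * cexp (pi * t)%:C =
    cexp ((b - a) * ('i * (pi / 4)%:C) + (pi / 2 * t)%:C) *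
    cexp ((d - c) * ('i * (pi / 4)%:C) + (pi / 2 * t)%:C)); last first.
    rewrite -!cexpD; congr cexp.
    rewrite (_ : pi * t = pi / 2 * t + pi / 2 * t); last by field.
    by rewrite rmorphD; ring.
  set A := Gamma _; set B := Gamma _; set C := Gamma _; set D := Gamma _.
  set E := cexp _; set F := cexp _; ring.
rewrite -cintegralZr; last exact: ED1_integrable.
apply: eq_cintegral => x; rewrite cintegralZ//; exact: ED1_integrable.
Qed.

Definition cosh_sinh u v : R[i] := (ccosh2 v)%:C + 'i * (csinh2 u)%:C.

Lemma Re_cosh_sinh u v : 0 < Re (cosh_sinh u v).
Proof. by rewrite !reimE /= mul0r mul1r subr0 addr0 ccosh2_gt0. Qed.

Lemma cexp_quarter2 : cexp ('i * (pi / 4)%:C) * cexp ('i * (pi / 4)%:C) = 'i%R :> R[i].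
Proof.
rewrite -cexpD -mulrDr -rmorphD (_ : pi / 4 + pi / 4 = pi / 2 :> R); last by field.
by apply: complex_ext; rewrite ?Re_cexp_ii ?Im_cexp_ii ?cos_pihalf ?sin_pihalf.
Qed.

Lemma cexp_quarterV : cexp ('i * (pi / 4)%:C) * cexp ('i * (- (pi / 4))%:C) = 1 :> R[i].
Proof. by rewrite -cexpD -mulrDr -rmorphD subrr mulr0 cexp0. Qed.

(** The reason for these coordinates: the two denominators combine into a positive real factor and
    one number of positive real part, so the two powers merge into a single [GI] value. The
    constants come from exp (i pi / 4)^2 = i. *)
Lemma quarter_den_mul u v :
  quarter_den (u + v) * quarter_den (u - v) = (expR u)%:C * cosh_sinh u v.
Proof.
rewrite /quarter_den /wave_den /cosh_sinh /ccosh2 /csinh2.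
have m2 := cexp_quarter2; have mV := cexp_quarterV.
have mm : cexp ('i * (- (pi / 4))%:C) * cexp ('i * (- (pi / 4))%:C) = - 'i :> R[i].
  have i1 : 'i%R != 0 :> R[i] := ii_neq0.
  apply: (mulfI i1); rewrite -{1}m2 mulrACA mV mulr1 mulrN ii_m1 opprK //.
set W := cexp ('i * (pi / 4)%:C) in m2 mV *.
set V := cexp ('i * (- (pi / 4))%:C) in mV mm *.
have eu : expR u * expR (- u) = 1 by rewrite -expRD subrr expR0.
have ev : expR v * expR (- v) = 1 by rewrite -expRD subrr expR0.
rewrite !expRD.
have {}eu : (expR u)%:C * (expR (- u))%:C = 1 :> R[i] by rewrite -rmorphM eu.
have {}ev : (expR v)%:C * (expR (- v))%:C = 1 :> R[i] by rewrite -rmorphM ev.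
rewrite !(rmorphD, rmorphM, rmorphN) /=.
move: eu ev; set x := (expR u)%:C; set y := (expR v)%:C; set x' := (expR (- u))%:C.
set y' := (expR (- v))%:C => eu ev.
transitivity (V * V + (W * V) * (x * y + x * y') + (W * W) * (x * x) * (y * y')); first by ring.
rewrite mm mV m2 ev.
transitivity (x * (y + y') + 'i * (x * x) - 'i * (x * x')); last by ring.
by rewrite eu; ring.
Qed.

Lemma GI_pair s u v : 0 < Re s ->
  GI s (quarter_den (u + v)) * GI s (quarter_den (u - v)) =
  Gamma s * (cexp (- (s * u%:C)) * GI s (cosh_sinh u v)).
Proof.
move=> s0; have h1 := Re_quarter_den (u + v); have h2 := Re_quarter_den (u - v).
have h3 := Re_cosh_sinh u v.
have hE : 0 < Re ((expR u)%:C * cosh_sinh u v).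
  by rewrite cReZ mulr_gt0// expR_gt0.
have hW : 0 < Re (quarter_den (u + v) * quarter_den (u - v)) by rewrite quarter_den_mul.
have hu : 0 < Re (expR u)%:C by rewrite /= expR_gt0.
rewrite (GI_Gamma s0 h1) (GI_Gamma s0 h2) (GI_Gamma s0 h3).
transitivity (Gamma s * Gamma s * (P s (quarter_den (u + v)) * P s (quarter_den (u - v)))).
  by move: (P s _) (P s _) (Gamma s) => x y z; ring.
rewrite -P_mul// quarter_den_mul P_mul// P_real ?expR_gt0// expRK.
by move: (P s _) (cexp _) (Gamma s) => x y z; ring.
Qed.

Lemma ED2_cst (k : R[i]) (f : R -> R -> R[i]) : ED2 f -> ED2 (fun x y => k * f x y).
Proof.
move=> [mf [C [c [C0 c0 h]]]]; split; first by apply: cmeasM => //; exact: cmeas_cst.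
exists (Normc.normc k * C), c; split => //; first by rewrite mulr_ge0 ?normc_ge0.
by move=> x y; rewrite Normc.normcM -mulrA ler_wpM2l ?normc_ge0.
Qed.

Definition wilson_kernel s w u v : R[i] := cexp (w * v%:C) * GI s (cosh_sinh u v).

Lemma ED2D (f g : R -> R -> R[i]) : ED2 f -> ED2 g -> ED2 (fun x y => f x y + g x y).
Proof.
move=> [mf [C [c [C0 c0 h]]]] [mg [D [e [D0 e0 k]]]]; split; first exact: cmeasD.
exists (C + D), (Num.min c e); split; [by rewrite addr_ge0|by rewrite lt_min c0|].
move=> x y; apply: (le_trans (le_normcD _ _)).
have e1 (z : R) : edec c z <= edec (Num.min c e) z by apply: edec_le; rewrite ge_min lexx.
have e2 (z : R) : edec e z <= edec (Num.min c e) z by apply: edec_le; rewrite ge_min lexx orbT.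
rewrite mulrDl lerD// ?(le_trans (h _ _))// ?(le_trans (k _ _))// ler_wpM2l// ler_pM// ?edec_ge0//.
Qed.

Lemma cint_lin2 (p q : R[i]) (f g : R -> R[i]) : cintble f -> cintble g ->
  p * cint f - q * cint g = cint (fun x => p * f x - q * g x).
Proof.
move=> fi gi; rewrite (cintegralB (cintegrableZ p fi) (cintegrableZ q gi)).
by rewrite (cintegralZ p fi) (cintegralZ q gi).
Qed.

(** With the parameters of the second wave swapped, the dependence on t reduces to exp (2 i t u).
    The double integral is therefore a Fourier transform in u at the frequency 2 t. *)
Lemma beta_wave_sum a b t u v : 0 < Re a -> 0 < Re b ->
  beta_wave a b t (u + v) * beta_wave b a t (u - v) =
  Gamma (a + b) * (cexp ('i * (2 * t * u)%:C) * wilson_kernel (a + b) (a - b) u v).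
Proof.
move=> a0 b0; rewrite /beta_wave /wilson_kernel [b + a]addrC.
have h := GI_pair u v (ReD_gt0 a0 b0).
transitivity (cexp ((a + 'i * t%:C) * (u + v)%:C) * cexp ((b + 'i * t%:C) * (u - v)%:C) *
  (GI (a + b) (quarter_den (u + v)) * GI (a + b) (quarter_den (u - v)))).
  by move: (GI _ _) (GI _ _) (cexp _) (cexp _) => x y z w; ring.
rewrite h.
have -> : Gamma (a + b) * (cexp ('i * (2 * t * u)%:C) * (cexp ((a - b) * v%:C) * GI (a + b) (cosh_sinh u v)))
  = (cexp ('i * (2 * t * u)%:C) * cexp ((a - b) * v%:C)) * (Gamma (a + b) * GI (a + b) (cosh_sinh u v)).
  by move: (GI _ _) (Gamma _) (cexp _) (cexp _) => x y z w; ring.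
have -> : Gamma (a + b) * (cexp (- ((a + b) * u%:C)) * GI (a + b) (cosh_sinh u v)) =
  cexp (- ((a + b) * u%:C)) * (Gamma (a + b) * GI (a + b) (cosh_sinh u v)).
  by move: (GI _ _) (Gamma _) (cexp _) => x y z; ring.
rewrite mulrA -!cexpD; congr (cexp _ * _).
by rewrite !(rmorphD, rmorphM, rmorphN, rmorph_nat); ring.
Qed.

(** The decay is read off from the product of beta waves at t = 0, divided by Gamma (a + b), which
    is nonzero; no separate estimate of the kernel is made. *)
Lemma wilson_kernel_ED2 a b : 0 < Re a -> 0 < Re b -> ED2 (wilson_kernel (a + b) (a - b)).
Proof.
move=> a0 b0; have G0 := Gamma_neq0 (ReD_gt0 a0 b0).
have [e _] := beta_wave_pair 0 a0 b0 b0 a0.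
apply: ED2_ext (ED2_cst (Gamma (a + b))^-1 e) => u v.
by rewrite beta_wave_sum// mulr0 mul0r mulr0 cexp0 mul1r mulKf.
Qed.

Lemma quarter_identity u v :
  cexp ('i * (pi / 4)%:C) * (expR (u + v))%:C * quarter_den (u - v) -
  cexp ('i * (- (pi / 4))%:C) * quarter_den (u + v) = 'i * (expR u)%:C * (ccosh2 u)%:C.
Proof.
rewrite /quarter_den /wave_den /ccosh2.
have m2 := cexp_quarter2; have mV := cexp_quarterV.
have mm : cexp ('i * (- (pi / 4))%:C) * cexp ('i * (- (pi / 4))%:C) = - 'i :> R[i].
  have i1 : 'i%R != 0 :> R[i] := ii_neq0.
  by apply: (mulfI i1); rewrite -{1}m2 mulrACA mV mulr1 mulrN ii_m1 opprK.
set W := cexp ('i * (pi / 4)%:C) in m2 mV *.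
set V := cexp ('i * (- (pi / 4))%:C) in mV mm *.
have eu : expR u * expR (- u) = 1 by rewrite -expRD subrr expR0.
have ev : expR v * expR (- v) = 1 by rewrite -expRD subrr expR0.
rewrite !expRD.
have {}eu : (expR u)%:C * (expR (- u))%:C = 1 :> R[i] by rewrite -rmorphM eu.
have {}ev : (expR v)%:C * (expR (- v))%:C = 1 :> R[i] by rewrite -rmorphM ev.
rewrite !(rmorphD, rmorphM, rmorphN) /=.
move: eu ev; set x := (expR u)%:C; set y := (expR v)%:C; set x' := (expR (- u))%:C.
set y' := (expR (- v))%:C => eu ev.
transitivity (W * W * (x * x) * (y * y') - V * V); first by ring.
rewrite mm m2 ev.
transitivity ('i * (x * x) + 'i * (x * x')); last by ring.
by rewrite eu; ring.
Qed.

(** The weights exp (i pi / 4) and exp (- i pi / 4) are those for which [quarter_identity] leaves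
    exactly [ccosh2 u]. On the Gamma side the same combination yields the factor t, see
    [gamma_quad_int1]. *)
Lemma beta_wave_diff c d t u v : 0 < Re c -> 0 < Re d ->
  cexp ('i * (pi / 4)%:C) * (beta_wave (c + 1) d t (u + v) * beta_wave d c t (u - v)) -
  cexp ('i * (- (pi / 4))%:C) * (beta_wave c d t (u + v) * beta_wave d (c + 1) t (u - v)) =
  'i * Gamma (c + d) * (cexp ('i * (2 * t * u)%:C) *
     ((ccosh2 u)%:C * wilson_kernel (c + d + 1) (c - d) u v)).
Proof.
move=> c0 d0; set n := c + d; have n0 : 0 < Re n := ReD_gt0 c0 d0.
rewrite /beta_wave /wilson_kernel (_ : c + 1 + d = n + 1); last by rewrite /n; ring.
rewrite (_ : d + (c + 1) = n + 1); last by rewrite /n; ring.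
rewrite (_ : d + c = n) -/n; last by rewrite /n addrC.
have h := GI_pair u v n0.
have r1 := GI_rec n0 (Re_quarter_den (u + v)).
have r2 := GI_rec n0 (Re_quarter_den (u - v)).
have r3 := GI_rec n0 (Re_cosh_sinh u v).
have m := quarter_den_mul u v; have id := quarter_identity u v.
have W1 : quarter_den (u + v) != 0.
  by apply/eqP => e; have := Re_quarter_den (u + v); rewrite e ltxx.
have W2 : quarter_den (u - v) != 0.
  by apply/eqP => e; have := Re_quarter_den (u - v); rewrite e ltxx.
set E := cexp ((c + 'i * t%:C) * (u + v)%:C) * cexp ((d + 'i * t%:C) * (u - v)%:C).
have e1 : cexp ((c + 1 + 'i * t%:C) * (u + v)%:C) =
    cexp ((c + 'i * t%:C) * (u + v)%:C) * (expR (u + v))%:C.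
  by rewrite -[X in _ = _ * X]cexpR -cexpD; congr cexp; ring.
have e2 : cexp ('i * (2 * t * u)%:C) * cexp ((c - d) * v%:C) = E * cexp (- (n * u%:C)).
  rewrite /E -!cexpD; congr cexp; rewrite /n.
  by rewrite !(rmorphD, rmorphM, rmorphN, rmorph_nat); ring.
have -> : 'i * Gamma n * (cexp ('i * (2 * t * u)%:C) *
   ((ccosh2 u)%:C * (cexp ((c - d) * v%:C) * GI (n + 1) (cosh_sinh u v)))) =
   (cexp ('i * (2 * t * u)%:C) * cexp ((c - d) * v%:C)) *
   ('i * Gamma n * (ccosh2 u)%:C * GI (n + 1) (cosh_sinh u v)).
  move: (GI _ _) (Gamma _) (cexp _) (cexp _) => x y z w; ring.
rewrite e1 e2 -[X in _ = X]mulrA; move: m id h r1 r2 r3.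
move: (GI n (quarter_den (u + v))) (GI n (quarter_den (u - v))) => g1 g2.
move: (GI (n + 1) (quarter_den (u + v))) (GI (n + 1) (quarter_den (u - v))) => G1 G2.
move: (GI n (cosh_sinh u v)) (GI (n + 1) (cosh_sinh u v)) => g H.
move: (cexp (- (n * u%:C))) (Gamma n) => e G m id h r1 r2 r3.
rewrite /E; move: (cexp ((c + 'i * t%:C) * (u + v)%:C)) (cexp ((d + 'i * t%:C) * (u - v)%:C)) => X Y.
move: W1 W2 m id r1 r2 r3; move: (quarter_den (u + v)) (quarter_den (u - v)) => W1 W2.
move: (cexp ('i * (pi / 4)%:C)) (cexp ('i * (- (pi / 4))%:C)) (expR (u + v))%:C => om omV x.
move: (cosh_sinh u v) (expR u)%:C (ccosh2 u)%:C => w y C W10 W20 m id r1 r2 r3.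
transitivity (X * Y * (om * x * G1 * g2 - omV * g1 * G2)); first by ring.
(* Multiplication by both denominators lets [r1] and [r2] lower n + 1 to n in both terms; afterwards
   [r3] raises it again for the merged parameter. *)
congr (_ * _); apply: (mulfI (mulf_neq0 W10 W20)).
transitivity (om * x * W2 * (W1 * G1) * g2 - omV * W1 * g1 * (W2 * G2)); first by ring.
rewrite -r1 -r2.
transitivity (n * (g1 * g2) * (om * x * W2 - omV * W1)); first by ring.
rewrite id h m.
transitivity ('i * y * C * G * e * (n * g)); first by ring.
by rewrite r3; ring.
Qed.

(** The factor [ccosh2 u] is the Jacobian that [GI_sinh_convolution] requires, and the order c + d +
    1 meets its condition 1 < Re m. *)
Definition wilson_kernel1 c d u v : R[i] :=
  (ccosh2 u)%:C * wilson_kernel (c + d + 1) (c - d) u v.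

Lemma wilson_kernel1_ED2 c d : 0 < Re c -> 0 < Re d -> ED2 (wilson_kernel1 c d).
Proof.
move=> c0 d0; have G0 := Gamma_neq0 (ReD_gt0 c0 d0).
have c1 : 0 < Re (c + 1) by rewrite cReD /=; lra.
have [e1 _] := beta_wave_pair 0 c1 d0 d0 c0.
have [e2 _] := beta_wave_pair 0 c0 d0 d0 c1.
have e3 := ED2D (ED2_cst (cexp ('i * (pi / 4)%:C)) e1)
                (ED2_cst (- cexp ('i * (- (pi / 4))%:C)) e2).
have iG : 'i%R * Gamma (c + d) != 0 by rewrite mulf_neq0// ii_neq0.
apply: ED2_ext (ED2_cst ('i%R * Gamma (c + d))^-1 e3) => u v.
by rewrite mulNr beta_wave_diff// mulr0 mul0r mulr0 cexp0 mul1r mulKf.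
Qed.

Definition gamma_quad a b t : R[i] :=
  Gamma (a + 'i * t%:C) * Gamma (b - 'i * t%:C) *
  (Gamma (b + 'i * t%:C) * Gamma (a - 'i * t%:C)).

Lemma gamma_quad_int a b t : 0 < Re a -> 0 < Re b ->
  gamma_quad a b t * cexp (pi * t)%:C = 2 * Gamma (a + b) *
   cint (fun u => cint (wilson_kernel (a + b) (a - b) u) * cexp ('i * (2 * t * u)%:C)).
Proof.
move=> a0 b0; have e := wilson_kernel_ED2 a0 b0.
have := (beta_wave_pair t a0 b0 b0 a0).2.
rewrite (_ : b - a + (a - b) = 0) ?mul0r ?cexp0 ?mulr1; last by ring.
rewrite -/(gamma_quad a b t) => ->; rewrite -mulrA; congr (_ * _).
have i1 : cintble (fun u => cint (wilson_kernel (a + b) (a - b) u) * cexp ('i * (2 * t * u)%:C)).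
  apply: (cintegrable_bound _ (cintegrable_normc (ED1_integrable (ED2_int e)))).
    by apply: cmeasM; [exact: (ED2_int e).1|cmeas].
  move=> u; rewrite Normc.normcM normc_cexp cReM /= mul0r mulr0 subrr expR0 mulr1//.
rewrite -cintegralZ//; apply: eq_cintegral => u.
transitivity (cint (fun v => Gamma (a + b) * cexp ('i * (2 * t * u)%:C) * wilson_kernel (a + b) (a - b) u v)).
  by apply: eq_cintegral => v; rewrite beta_wave_sum// mulrA.
rewrite cintegralZ; last exact: ED1_integrable (ED2_fst u e).
by rewrite -mulrA [X in _ * X]mulrC.
Qed.

(** Raising c by 1 multiplies the product of Gamma factors by c + i t in one wave and by c - i t in
    the other. The weighted difference of the two cases leaves 2 i t, which inserts the linear part
    of Wilson's density. *)
Lemma gamma_quad_int1 c d t : 0 < Re c -> 0 < Re d ->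
  t%:C * gamma_quad c d t * cexp (pi * t)%:C = Gamma (c + d) *
   cint (fun u => cint (wilson_kernel1 c d u) * cexp ('i * (2 * t * u)%:C)).
Proof.
move=> c0 d0; have e := wilson_kernel1_ED2 c0 d0.
have c1 : 0 < Re (c + 1) by rewrite cReD /=; lra.
have [x1 y1] := beta_wave_pair t c1 d0 d0 c0.
have [x2 y2] := beta_wave_pair t c0 d0 d0 c1.
have i1 : cintble (fun u => cint (wilson_kernel1 c d u) * cexp ('i * (2 * t * u)%:C)).
  apply: (cintegrable_bound _ (cintegrable_normc (ED1_integrable (ED2_int e)))).
    by apply: cmeasM; [exact: (ED2_int e).1|cmeas].
  move=> u; rewrite Normc.normcM normc_cexp cReM /= mul0r mulr0 subrr expR0 mulr1//.
have p1 : (d - (c + 1) + (c - d)) * ('i * (pi / 4)%:C) = 'i * (- (pi / 4))%:C :> R[i].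
  by rewrite rmorphN; ring.
have p2 : (d - c + (c + 1 - d)) * ('i * (pi / 4)%:C) = 'i * (pi / 4)%:C :> R[i] by ring.
rewrite p1 in y1; rewrite p2 in y2.
have G1 : Gamma (c + 1 + 'i * t%:C) = (c + 'i * t%:C) * Gamma (c + 'i * t%:C).
  by rewrite -GammaS; [congr Gamma; ring|rewrite ReDi].
have G2 : Gamma (c + 1 - 'i * t%:C) = (c - 'i * t%:C) * Gamma (c - 'i * t%:C).
  by rewrite -GammaS; [congr Gamma; ring|rewrite subiE ReDi].
have J : cexp ('i * (pi / 4)%:C) * cint (fun u => cint (fun v => beta_wave (c + 1) d t (u + v) * beta_wave d c t (u - v))) -
  cexp ('i * (- (pi / 4))%:C) * cint (fun u => cint (fun v => beta_wave c d t (u + v) * beta_wave d (c + 1) t (u - v))) =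
  'i * Gamma (c + d) * cint (fun u => cint (wilson_kernel1 c d u) * cexp ('i * (2 * t * u)%:C)).
  have j1 := ED1_integrable (ED2_int x1); have j2 := ED1_integrable (ED2_int x2).
  rewrite (cint_lin2 _ _ j1 j2) -cintegralZ//; apply: eq_cintegral => u.
  have k1 := ED1_integrable (ED2_fst u x1); have k2 := ED1_integrable (ED2_fst u x2).
  rewrite (cint_lin2 _ _ k1 k2).
  transitivity (cint (fun v => 'i * Gamma (c + d) * cexp ('i * (2 * t * u)%:C) * wilson_kernel1 c d u v)).
    by apply: eq_cintegral => v; rewrite beta_wave_diff// -[RHS]mulrA.
  rewrite cintegralZ; last exact: ED1_integrable (ED2_fst u e).
  by rewrite -[LHS]mulrA [X in _ = _ * X]mulrC.
have mV := cexp_quarterV.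
apply: (mulfI (ii_neq0)); rewrite [RHS]mulrA -J.
have n2 : (2 : R[i]) != 0 by rewrite pnatr_eq0.
apply: (mulfI n2).
have aux (W V I1 I2 X Y Z T E z w : R[i]) : W * V = 1 ->
    (w + 'i * z) * X * Y * (Z * T) * V * E = 2 * I1 ->
    X * Y * (Z * ((w - 'i * z) * T)) * W * E = 2 * I2 ->
    2 * ('i * (z * (X * Y * (Z * T)) * E)) = 2 * (W * I1 - V * I2).
  move=> h h1 h2; transitivity (W * (2 * I1) - V * (2 * I2)); last by ring.
  rewrite -h1 -h2.
  transitivity ((W * V) * (2 * ('i * (z * (X * Y * (Z * T)) * E)))); last by ring.
  by rewrite h mul1r.
rewrite G1 in y1; rewrite G2 in y2; exact: (aux _ _ _ _ _ _ _ _ _ _ _ mV y1 y2).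
Qed.

End WilsonPair.

(** * Evaluation of the Wilson integral by Parseval *)

Section Wilson.
Context {R : realType}.
Local Notation RM := (measurableTypeR R).
Implicit Types (a b c d n w : R[i]) (s t u v : R).

(** The transform of [g] is expanded and Fubini applied, after which the transform of [f] is
    inverted at - u. Accordingly [f] carries the hypotheses of inversion and [g] only
    integrability. *)
Lemma parseval (f g : R -> R[i]) (K : R) :
  let F (h : R -> R[i]) := fun s : R => cint (fun u => h u * cexp ('i * (s * u)%:C)) in
  cintble f -> (forall u, Normc.normc (f u) <= K) -> (forall x, ccontat f x) ->
  cintble (F f) -> cintble g ->
  cint (fun s : R => F f s * F g s) = (2 * pi)%:C * cint (fun u => f (- u) * g u).
Proof.
move=> F fi fK cf Ffi gi.
pose H (s u : R) := F f s * (g u * cexp ('i * (s * u)%:C)).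
have mH : @cmeas R _ (RM * RM)%type (fun p => H p.1 p.2).
  apply: cmeasM; first by apply: (cmeas_comp (cintegrable_meas Ffi)); exact: measurable_fst.
  apply: cmeasM; first by apply: (cmeas_comp (cintegrable_meas gi)); exact: measurable_snd.
  apply: cmeas_cexp; apply: cmeasM; first exact: cmeas_cst.
  apply: cmeasR; apply: measurable_funM; [exact: measurable_fst|exact: measurable_snd].
have Hb s u : Normc.normc (H s u) <= Normc.normc (F f s) * Normc.normc (g u).
  by rewrite /H 2!Normc.normcM normc_wave mulr1.
transitivity (cint (fun s => cint (H s))).
  apply: eq_cintegral => s; rewrite /H cintegralZ//.
  apply: (cintegrable_bound _ (cintegrable_normc gi)) => [|u].
    by apply: cmeasM; [exact: cintegrable_meas gi|cmeas].
  by rewrite Normc.normcM normc_wave mulr1.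
rewrite (cfubini_dom mH (cintegrable_normc Ffi) (cintegrable_normc gi) Hb).
have i1 : cintble (fun u => f (- u) * g u).
  have ik := integrableZl measurableT K (cintegrable_normc gi).
  apply: (cintegrable_bound _ ik) => [|u].
    apply: cmeasM; last exact: cintegrable_meas gi.
    by apply: (cmeas_comp (cintegrable_meas fi)); apply: meas_N; exact: measurable_id.
  by rewrite Normc.normcM ler_wpM2r// normc_ge0.
rewrite -cintegralZ//; apply: eq_cintegral => u.
transitivity (cint (fun s => g u * (F f s * cexp (- ('i * (s * - u)%:C))))).
  apply: eq_cintegral => s; rewrite /H cexp_opp_wave.
  by move: (F f s) (g u) (cexp _) => x y z; ring.
rewrite cintegralZ; last first.
  apply: (cintegrable_bound _ (cintegrable_normc Ffi)) => [|s].
    by apply: cmeasM; [exact: cintegrable_meas Ffi|cmeas].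
  by rewrite Normc.normcM -cexp_opp_wave normc_wave mulr1.
rewrite (fourier_inversion fi fK (cf (- u)) Ffi).
by move: (f _) (g _) => x y; ring.
Qed.

Lemma cmeas_GammaN a {dT : measure_display} {T : measurableType dT} (r : T -> R) : 0 < Re a ->
  measurable_fun setT r -> cmeas (fun p => Gamma (a - 'i * (r p)%:C)).
Proof.
move=> a0 mr; apply: (@cmeas_ext _ _ _ (fun p => Gamma (a + 'i * (- r p)%:C))).
  by move=> p; rewrite subiE.
by apply: cmeas_Gamma => //; exact: meas_N.
Qed.

Lemma gamma_quad_decay a b : 0 < Re a -> 0 < Re b ->
  exists2 C, 0 <= C & forall t, Normc.normc (gamma_quad a b t) <= C * expR (- (3 / 2 * pi * `|t|)).
Proof.
move=> a0 b0; have p0 := pi_gt0 R.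
(* Four factors of rate 3 pi / 8 decay at rate 3 pi / 2, which leaves pi / 2 after multiplication by
   exp (pi t). *)
have th : (0 : R) <= 3 / 8 * (pi : R) < (pi : R) / 2.
  apply/andP; split; lra.
have [A A0 hA] := Gamma_decay a0 th; have [B B0 hB] := Gamma_decay b0 th.
exists (A * B * (B * A)); first by rewrite !mulr_ge0.
have hA' t : Normc.normc (Gamma (a - 'i * t%:C)) <= A * expR (- (3 / 8 * pi * `|t|)).
  by rewrite subiE -normrN; exact: hA.
have hB' t : Normc.normc (Gamma (b - 'i * t%:C)) <= B * expR (- (3 / 8 * pi * `|t|)).
  by rewrite subiE -normrN; exact: hB.
have e4 (x y z w : R[i]) : Normc.normc (x * y * (z * w)) =
    Normc.normc x * Normc.normc y * (Normc.normc z * Normc.normc w) by rewrite !Normc.normcM.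
move=> t; rewrite /gamma_quad e4.
have ge z : 0 <= Normc.normc z :> R by exact: normc_ge0.
have h := ler_pM (mulr_ge0 (ge _) (ge _)) (mulr_ge0 (ge _) (ge _))
  (ler_pM (ge _) (ge _) (hA t) (hB' t)) (ler_pM (ge _) (ge _) (hB t) (hA' t)).
apply: (le_trans h); rewrite le_eqVlt; apply/orP; left; apply/eqP.
have -> : - (3 / 2 * pi * `|t|) = - (3 / 8 * pi * `|t|) - (3 / 8 * pi * `|t|) -
   (3 / 8 * pi * `|t|) - (3 / 8 * pi * `|t|) by field.
rewrite !expRD; move: (expR _) => x; ring.
Qed.

Lemma cmeas_gamma_quad a b : 0 < Re a -> 0 < Re b -> @cmeas R _ RM (gamma_quad a b).
Proof.
move=> a0 b0; rewrite /gamma_quad; apply: cmeasM; apply: cmeasM.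
- by apply: cmeas_Gamma => //; exact: measurable_id.
- by apply: cmeas_GammaN => //; exact: measurable_id.
- by apply: cmeas_Gamma => //; exact: measurable_id.
- by apply: cmeas_GammaN => //; exact: measurable_id.
Qed.

Lemma gamma_quad_exp_ED1 a b : 0 < Re a -> 0 < Re b ->
  ED1 (fun t => gamma_quad a b t * cexp (pi * t)%:C).
Proof.
move=> a0 b0; have p0 := pi_gt0 R; have [C C0 hC] := gamma_quad_decay a0 b0.
split; first by apply: cmeasM; [exact: cmeas_gamma_quad|cmeas].
exists C, (pi / 2); split; [by []|by rewrite divr_gt0|] => t.
rewrite Normc.normcM normc_cexp /=.
have h : expR (pi * t) <= expR (pi * `|t|) by rewrite ler_expR ler_wpM2l ?ler_norm// ltW.
apply: (le_trans (ler_pM (normc_ge0 _) (expR_ge0 _) (hC t) h)).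
by rewrite -[X in X <= _]mulrA; apply: ler_wpM2l => //; rewrite /edec -expRD ler_expR; lra.
Qed.

Lemma gamma_quad_exp1_ED1 a b : 0 < Re a -> 0 < Re b ->
  ED1 (fun t => t%:C * gamma_quad a b t * cexp (pi * t)%:C).
Proof.
move=> a0 b0; have p0 := pi_gt0 R; have [m [C [c [C0 c0 h]]]] := gamma_quad_exp_ED1 a0 b0.
split; first by apply: cmeas_ext (cmeasM (cmeasR (@measurable_id _ RM setT)) m) => t; rewrite mulrA.
have c20 : 0 < c / 2 by rewrite divr_gt0.
exists (2 / c * C), (c / 2); split => //; first by rewrite mulr_ge0// divr_ge0// ltW.
move=> t; rewrite -mulrA Normc.normcM normcR.
have ht : `|t| <= 2 / c * expR (c / 2 * `|t|).
  have := expR_ge1Dx (c / 2 * `|t|) => h1.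
  rewrite -ler_pdivrMl ?divr_gt0// invf_div; lra.
apply: (le_trans (ler_pM (normr_ge0 _) (normc_ge0 _) ht (h t))).
have -> : 2 / c * expR (c / 2 * `|t|) * (C * edec c t) = 2 / c * C * (expR (c / 2 * `|t|) * edec c t) by ring.
apply: ler_wpM2l; first by rewrite mulr_ge0// divr_ge0// ltW.
by rewrite /edec -expRD ler_expR; lra.
Qed.

Lemma gamma_quadN a b t : gamma_quad a b (- t) = gamma_quad a b t.
Proof.
rewrite /gamma_quad rmorphN mulrN !opprK.
by move: (Gamma _) (Gamma _) (Gamma _) (Gamma _) => x y z w; ring.
Qed.

Lemma ED1D (f g : R -> R[i]) : ED1 f -> ED1 g -> ED1 (fun x => f x + g x).
Proof.
move=> [mf [C [c [C0 c0 h]]]] [mg [D [e [D0 e0 k]]]]; split; first exact: cmeasD.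
exists (C + D), (Num.min c e); split; [by rewrite addr_ge0|by rewrite lt_min c0|].
move=> x; apply: (le_trans (le_normcD _ _)).
have e1 (z : R) : edec c z <= edec (Num.min c e) z by apply: edec_le; rewrite ge_min lexx.
have e2 (z : R) : edec e z <= edec (Num.min c e) z by apply: edec_le; rewrite ge_min lexx orbT.
by rewrite mulrDl lerD// ?(le_trans (h _))// ?(le_trans (k _))// ler_wpM2l.
Qed.

Lemma ED1_cst (k : R[i]) (f : R -> R[i]) : ED1 f -> ED1 (fun x => k * f x).
Proof.
move=> [mf [C [c [C0 c0 h]]]]; split; first by apply: cmeasM => //; exact: cmeas_cst.
exists (Normc.normc k * C), c; split => //; first by rewrite mulr_ge0 ?normc_ge0.
by move=> x; rewrite Normc.normcM -mulrA ler_wpM2l ?normc_ge0.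
Qed.

Lemma wilson_kernel_cont n w u v : 0 < Re n -> ccontat ((wilson_kernel n w) ^~ v) u.
Proof.
move=> n0; rewrite /wilson_kernel.
rewrite (_ : (fun x => _) = (fun x => cexp (w * v%:C) * (Gamma n * P n (cosh_sinh x v)))); last first.
  by apply/funext => x; rewrite GI_Gamma// Re_cosh_sinh.
apply: ccontatM; first exact: ccontat_cst.
apply: ccontatM; first exact: ccontat_cst.
apply: ccontat_P; last exact: Re_cosh_sinh.
rewrite /cosh_sinh; apply: ccontatD; first exact: ccontat_cst.
by apply: ccontatM; [exact: ccontat_cst|apply: ccontatR; exact: continuous_csinh2].
Qed.

Definition wilson_integrand a b c d t : R[i] :=
  gamma_quad a b t * gamma_quad c d t /
  (Gamma ('i * (2 * t)%:C) * Gamma (- ('i * (2 * t)%:C))).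

(** By [GammaGamma_inv] the density at 2 t is (t / pi) (exp (2 pi t) - exp (- 2 pi t)). As
    [gamma_quad] is even, the second exponential gives the reflection of the first term, and each
    exp (2 pi t) is split between the two quadruples. *)
Lemma wilson_integrandE a b c d t : wilson_integrand a b c d t =
  (pi^-1)%:C *
   (gamma_quad a b t * cexp (pi * t)%:C * (t%:C * gamma_quad c d t * cexp (pi * t)%:C) +
    gamma_quad a b (- t) * cexp (pi * - t)%:C *
      ((- t)%:C * gamma_quad c d (- t) * cexp (pi * - t)%:C)).
Proof.
rewrite /wilson_integrand GammaGamma_inv !gamma_quadN !cexpR.
have p0 : pi != 0 :> R by rewrite gt_eqF// pi_gt0.
have -> : 2 * t * (expR (pi * (2 * t)) - expR (- (pi * (2 * t)))) / (2 * pi) =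
   pi^-1 * (t * (expR (pi * t) * expR (pi * t)) - t * (expR (pi * - t) * expR (pi * - t))) :> R.
  rewrite -!expRD (_ : pi * t + pi * t = pi * (2 * t)); last by ring.
  rewrite (_ : pi * - t + pi * - t = - (pi * (2 * t))); last by ring.
  by move: p0; move: (pi : R) => q q0; field.
rewrite rmorphM rmorphB !rmorphM rmorphN.
by move: (gamma_quad _ _ _) (gamma_quad _ _ _) => x y; ring.
Qed.

Lemma wilson_integrand_ED1 a b c d : 0 < Re a -> 0 < Re b -> 0 < Re c -> 0 < Re d ->
  ED1 (wilson_integrand a b c d) /\
  cint (wilson_integrand a b c d) = (2 / pi)%:C *
   cint (fun t => gamma_quad a b t * cexp (pi * t)%:C * (t%:C * gamma_quad c d t * cexp (pi * t)%:C)).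
Proof.
move=> a0 b0 c0 d0.
have e := ED1M (gamma_quad_exp_ED1 a0 b0) (gamma_quad_exp1_ED1 c0 d0).
have eN := ED1_opp e.
have i1 := ED1_integrable e; have i2 := ED1_integrable eN.
split.
  apply: (@ED1_ext _ (fun t => (pi^-1)%:C *
   (gamma_quad a b t * cexp (pi * t)%:C * (t%:C * gamma_quad c d t * cexp (pi * t)%:C) +
    gamma_quad a b (- t) * cexp (pi * - t)%:C *
      ((- t)%:C * gamma_quad c d (- t) * cexp (pi * - t)%:C)))).
    by move=> t; rewrite wilson_integrandE.
  exact: (ED1_cst _ (ED1D e eN)).
rewrite (_ : cint _ = cint (fun t => (pi^-1)%:C *
   (gamma_quad a b t * cexp (pi * t)%:C * (t%:C * gamma_quad c d t * cexp (pi * t)%:C) +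
    gamma_quad a b (- t) * cexp (pi * - t)%:C *
      ((- t)%:C * gamma_quad c d (- t) * cexp (pi * - t)%:C)))); last first.
  by apply: eq_cintegral => t; exact: wilson_integrandE.
rewrite cintegralZ; last exact: cintegrableD.
rewrite cintegralD//.
have E := cint_opp i1; rewrite E.
move: (cint _) => I; rewrite rmorphM rmorph_nat; ring.
Qed.

(** The factor 2 in [gamma_quad_int] cancels the 1/2 from rescaling the frequency 2 t, so only the 2
    pi of Parseval is left. *)
Lemma gamma_quad_parseval a b c d : 0 < Re a -> 0 < Re b -> 0 < Re c -> 0 < Re d ->
  cint (fun t => gamma_quad a b t * cexp (pi * t)%:C * (t%:C * gamma_quad c d t * cexp (pi * t)%:C)) =
  Gamma (a + b) * Gamma (c + d) * (2 * pi)%:C *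
  cint (fun u => cint (wilson_kernel (a + b) (a - b) (- u)) * cint (wilson_kernel1 c d u)).
Proof.
move=> a0 b0 c0 d0; have G0 := Gamma_neq0 (ReD_gt0 a0 b0).
have ef := wilson_kernel_ED2 a0 b0; have eg := wilson_kernel1_ED2 c0 d0.
pose f u := cint (wilson_kernel (a + b) (a - b) u); pose g u := cint (wilson_kernel1 c d u).
pose Ff s := cint (fun u => f u * cexp ('i * (s * u)%:C)).
pose Fg s := cint (fun u => g u * cexp ('i * (s * u)%:C)).
have E1 t : gamma_quad a b t * cexp (pi * t)%:C = 2 * Gamma (a + b) * Ff (2 * t).
  exact: gamma_quad_int.
have E2 t : t%:C * gamma_quad c d t * cexp (pi * t)%:C = Gamma (c + d) * Fg (2 * t).
  exact: gamma_quad_int1.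
have n2 : (2^-1 : R) != 0 by rewrite invr_eq0 pnatr_eq0.
have n2' : (2 : R) != 0 by rewrite pnatr_eq0.
have iF : cintble Ff.
  have := cintble_affine 0 n2 (ED1_integrable (gamma_quad_exp_ED1 a0 b0)).
  move=> /(cintegrableZ (2 * Gamma (a + b))^-1); apply: cintble_ext => t.
  by rewrite E1 addr0 mulVKf// mulKf// mulf_neq0// pnatr_eq0.
have [K hK] := ED1_bdd (ED2_int ef).
have cf x : ccontat f x.
  have [C [c' [C0 c'0 h]]] := ef.2.
  apply: (ccont_int (G := fun v => C * edec c' v)).
  - by move=> t; exact: (ED2_fst t ef).1.
  - by move=> t u; apply: wilson_kernel_cont; exact: ReD_gt0.
  - exact: (integrableZl measurableT C (integrable_edec c'0)).
  - move=> t u; apply: (le_trans (h t u)); rewrite ler_wpM2l// ler_piMl ?edec_ge0// edec_le1// ltW//.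
have := parseval (ED1_integrable (ED2_int ef)) hK cf iF (ED1_integrable (ED2_int eg)).
rewrite -/Ff -/Fg => PE.
have iFg : cintble (fun s => Ff s * Fg s).
  have := ED1_integrable (ED1M (gamma_quad_exp_ED1 a0 b0) (gamma_quad_exp1_ED1 c0 d0)).
  move=> /(cintble_affine 0 n2) /(cintegrableZ (2 * Gamma (a + b) * Gamma (c + d))^-1); apply: cintble_ext => t.
  rewrite E1 E2 addr0 (mulVKf n2').
  have G1 := Gamma_neq0 (ReD_gt0 c0 d0).
  rewrite [2 * Gamma (a + b) * Ff t * _]mulrACA mulKf//.
  have m2 : (2 : R[i]) != 0 by rewrite pnatr_eq0.
  exact: mulf_neq0 (mulf_neq0 m2 G0) G1.
have A := cint_affine 0 n2' iFg.
transitivity (2 * Gamma (a + b) * Gamma (c + d) * cint (fun t => Ff (2 * t + 0) * Fg (2 * t + 0))).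
  rewrite -cintegralZ; last exact: (cintble_affine 0 n2' iFg).
  apply: eq_cintegral => t; rewrite E1 E2 addr0.
  by move: (Ff _) (Fg _) => x y; ring.
have aux (I K' J x y p : R[i]) : I = (`|2 : R|^-1)%:C * K' -> K' = p * J ->
    2 * x * y * I = x * y * p * J.
  move=> -> ->; rewrite ger0_norm// fmorphV rmorph_nat.
  have m2 : (2 : R[i]) != 0 by rewrite pnatr_eq0.
  by field.
exact: aux A PE.
Qed.

Lemma ED2_mul_ED3 (f g : R -> R -> R[i]) : ED2 f -> ED2 g -> ED3 (fun u x y => f u x * g u y).
Proof.
move=> [mf [C [c [C0 c0 h]]]] [mg [D [e [D0 e0 k]]]]; split.
  apply: cmeasM; first by apply: (cmeas_comp mf); exact: measurable_fst.
  have := @cmeas_comp _ _ _ (RM * RM * RM)%type (RM * RM)%type _ (fun p => (p.1.1, p.2)) mg.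
  apply; apply: measurable_fun_pair; last exact: measurable_snd.
  by apply: (measurableT_comp measurable_fst); exact: measurable_fst.
exists (C * D), (Num.min c e); split; [by rewrite mulr_ge0|by rewrite lt_min c0|].
move=> u x y; rewrite Normc.normcM.
have e1 (z : R) : edec c z <= edec (Num.min c e) z by apply: edec_le; rewrite ge_min lexx.
have e2 (z : R) : edec e z <= edec (Num.min c e) z by apply: edec_le; rewrite ge_min lexx orbT.
apply: (le_trans (ler_pM (normc_ge0 _) (normc_ge0 _) (h u x) (k u y))).
rewrite mulrACA ler_wpM2l ?mulr_ge0//.
have k1 : edec e u <= 1 by rewrite edec_le1// ltW.
have ge (z w : R) : 0 <= edec z w by exact: edec_ge0.
rewrite mulrACA [X in X <= _](_ : _ = edec c u * edec c x * edec e y * edec e u); last by ring.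
rewrite -[X in _ <= X]mulr1 ler_pM ?mulr_ge0 ?ge// ler_pM ?mulr_ge0 ?ge// ler_pM// ?ge//.
Qed.

Lemma ED3_cycle (f : R -> R -> R -> R[i]) : ED3 f ->
  cint (fun u => cint (fun x => cint (f u x))) =
  cint (fun x => cint (fun y => cint (fun u => f u x y))).
Proof.
move=> e3; apply: (etrans (ED2_fubini (ED3_int e3))); apply: eq_cintegral => x.
exact: (ED2_fubini (ED3_fst x (ED3_perm213 e3))).
Qed.

Lemma ccosh2_sumdiff (x y : R) : ccosh2 (x + y) + ccosh2 (x - y) = ccosh2 x * ccosh2 y.
Proof. by rewrite /ccosh2 !opprD !opprK !expRD; ring. Qed.

Lemma ED1_double (f : R -> R[i]) : ED1 f -> ED1 (fun x => f (2 * x + 0)).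
Proof.
move=> [m [C [c [C0 c0 h]]]]; split.
  have := @cmeas_comp _ _ _ RM RM _ (fun x : RM => 2 * x + 0) m.
  by apply; apply: measurable_funD; [apply: measurable_funM; [exact: measurable_cst|exact: measurable_id]|exact: measurable_cst].
exists C, c; split => // x; apply: (le_trans (h _)); rewrite ler_wpM2l// /edec ler_expR lerN2.
apply: ler_wpM2l; first exact: ltW.
by rewrite addr0 normrM (ger0_norm (ler0n _ 2)) mulr_natl mulr2n lerDl.
Qed.

Lemma cint_double (f : R -> R[i]) : cintble f -> cint (fun x => f (2 * x + 0)) = 2^-1 * cint f.
Proof.
move=> fi; have n2 : (2 : R) != 0 by rewrite pnatr_eq0.
by rewrite (cint_affine 0 n2 fi) ger0_norm// fmorphV rmorph_nat.
Qed.

(** The beta integral with w1 = w2 = 1 in the doubled variable, where 1 + exp (2 x) = exp x * 2 cosh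
    x makes the integrand symmetric. *)
Lemma cosh_mellin a b : 0 < Re a -> 0 < Re b ->
  ED1 (fun x => cexp ((a - b) * x%:C) * GI (a + b) (ccosh2 x)%:C) /\
  cint (fun x => cexp ((a - b) * x%:C) * GI (a + b) (ccosh2 x)%:C) =
  2^-1 * (Gamma a * Gamma b).
Proof.
move=> a0 b0.
have o1 : 0 < Re (1 : R[i]) by rewrite /= ltr01.
have Eb : a + b - a = b by ring.
have b0' : 0 < Re (a + b - a) by rewrite Eb.
have [e1 i1] := beta_ED1 a0 b0' o1 o1.
rewrite Eb -(GammaE a0) -(GammaE b0) in i1.
have ab0 := ReD_gt0 a0 b0.
have E x : cexp (a * (2 * x + 0)%:C) * GI (a + b) (1 + 1 * (expR (2 * x + 0))%:C) =
    cexp ((a - b) * x%:C) * GI (a + b) (ccosh2 x)%:C.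
  have eq : 1 + 1 * (expR (2 * x + 0))%:C = (expR x)%:C * (ccosh2 x)%:C :> R[i].
    rewrite mul1r -rmorphM /ccosh2 mulrDr -!expRD subrr expR0 addrC rmorphD /= addr0 mulrDl mul1r.
    by rewrite addrC.
  have h1 : 0 < Re (expR x)%:C by rewrite /= expR_gt0.
  have h2 : 0 < Re (ccosh2 x)%:C by rewrite /= ccosh2_gt0.
  have h3 : 0 < Re ((expR x)%:C * (ccosh2 x)%:C) by rewrite cReZ mulr_gt0 ?expR_gt0 ?ccosh2_gt0.
  rewrite eq (GI_Gamma ab0 h3) (GI_Gamma ab0 h2) P_mul// P_real ?expR_gt0// expRK.
  transitivity (cexp (a * (2 * x + 0)%:C) * cexp (- ((a + b) * x%:C)) * (Gamma (a + b) * P (a + b) (ccosh2 x)%:C)).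
    by move: (Gamma _) (P _ _) (cexp _) (cexp _) => p q r s; ring.
  rewrite -cexpD; congr (cexp _ * _).
  by rewrite addr0 rmorphM rmorph_nat; ring.
split.
  exact: ED1_ext E (ED1_double e1).
transitivity (cint (fun x => cexp (a * (2 * x + 0)%:C) * GI (a + b) (1 + 1 * (expR (2 * x + 0))%:C))).
  by symmetry; apply: eq_cintegral => x; exact: E.
apply: (etrans (cint_double (ED1_integrable e1))); congr (_ * _); exact: i1.
Qed.

Lemma GI_mul n w1 w2 : 0 < Re n -> 0 < Re w1 -> 0 < Re w2 -> 0 < Re (w1 * w2) ->
  Gamma n * GI n (w1 * w2) = GI n w1 * GI n w2.
Proof.
move=> n0 h1 h2 h3; rewrite (GI_Gamma n0 h1) (GI_Gamma n0 h2) (GI_Gamma n0 h3) (P_mul _ h1 h2 h3).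
by move: (P _ _) (P _ _) (Gamma _) => x y z; ring.
Qed.

Lemma cint_prod (k : R[i]) (f g : R -> R[i]) : cintble f -> cintble g ->
  cint (fun x => cint (fun y => k * (f x * g y))) = k * (cint f * cint g).
Proof.
move=> fi gi; transitivity (cint (fun x => k * cint g * f x)).
  apply: eq_cintegral => x; rewrite cintegralZ; last exact: cintegrableZ.
  by rewrite cintegralZ// -mulrA [f x * _]mulrC.
by rewrite cintegralZ// -mulrA [X in k * X]mulrC.
Qed.

(** Integrating in u first, [GI_sinh_convolution] leaves [GI N] at ccosh2 x + ccosh2 y with N = a +
    b + c + d. In sum and difference coordinates this argument is a product, [GI_mul] splits the
    power at the cost of Gamma N, and two integrals of type [cosh_mellin] remain. *)
Lemma wilson_kernel_int a b c d : 0 < Re a -> 0 < Re b -> 0 < Re c -> 0 < Re d ->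
  Gamma (a + b + c + d) *
  cint (fun u => cint (wilson_kernel (a + b) (a - b) (- u)) * cint (wilson_kernel1 c d u)) =
  pi%:C * (Gamma (a + c) * Gamma (b + d) * (Gamma (a + d) * Gamma (b + c))).
Proof.
move=> a0 b0 c0 d0.
have ef := wilson_kernel_ED2 a0 b0; have eg := wilson_kernel1_ED2 c0 d0.
have efN : ED2 (fun u v => wilson_kernel (a + b) (a - b) (- u) v).
  apply: (ED2_comp (p := fun u _ => - u) (q := fun _ v => v) (K := 0) ltr01 _ _ _ ef).
  - by apply: meas_N; exact: measurable_fst.
  - exact: measurable_snd.
  - by move=> x y; rewrite normrN mul1r subr0.
have e3 := ED2_mul_ED3 efN eg.
pose F u x y := wilson_kernel (a + b) (a - b) (- u) x * wilson_kernel1 c d u y.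
rewrite -/F in e3.
have S1 : cint (fun u => cint (wilson_kernel (a + b) (a - b) (- u)) * cint (wilson_kernel1 c d u)) =
   cint (fun u => cint (fun x => cint (F u x))).
  apply: eq_cintegral => u.
  have i1 := ED1_integrable (ED2_fst u efN); have i2 := ED1_integrable (ED2_fst u eg).
  rewrite -cintegralZr//; apply: eq_cintegral => x.
  by symmetry; exact: (cintegralZ _ i2).
have S2 : cint (fun u => cint (fun x => cint (F u x))) =
    cint (fun x => cint (fun y => cint (fun u => F u x y))).
  exact: ED3_cycle e3.
pose G x y := cint (fun u => F u x y).
have eG : ED2 G.
  have := ED3_int (ED3_perm132 (ED3_perm213 e3)); exact.
have ab0 := ReD_gt0 a0 b0; have cd0 := ReD_gt0 c0 d0.
have cd1 : 1 < Re (c + d + 1) by rewrite cReD /= ltrDr.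
pose N := a + b + c + d.
have N0 : 0 < Re N by rewrite /N !cReD; rewrite !cReD in ab0 cd0; lra.
have GE x y : G x y = (2 * pi)%:C *
   (cexp ((a - b) * x%:C) * cexp ((c - d) * y%:C) * GI N (ccosh2 x + ccosh2 y)%:C).
  have := GI_sinh_convolution ab0 cd1 (ccosh2_gt0 x) (ccosh2_gt0 y).
  rewrite (_ : a + b + (c + d + 1) - 1 = N); last by rewrite /N; ring.
  set I := fun u : R => _; move=> E; rewrite [RHS]mulrCA -E.
  set q := cexp _ * cexp _.
  have q0 : q != 0 by rewrite mulf_neq0 ?cexp_neq0.
  have FE u : F u x y = q * I u.
    rewrite /F /q /I /wilson_kernel1 /wilson_kernel /cosh_sinh csinh2N rmorphN mulrN.
    by move: (GI _ _) (GI _ _) (cexp _) (cexp _) => p r s t; ring.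
  have iF : cintble (fun u => F u x y).
    exact: ED1_integrable (ED3_fst2 x y (ED3_perm132 (ED3_perm213 e3))).
  have iI : cintble I.
    by apply: cintble_ext (cintegrableZ q^-1 iF) => u; rewrite FE mulKf.
  by apply: (etrans _ (cintegralZ q iI)); apply: eq_cintegral => u; exact: FE.
rewrite S1 S2 -/G (cint_sumdiff eG).
have [k1 j1] := cosh_mellin (ReD_gt0 a0 c0) (ReD_gt0 b0 d0).
have [k2 j2] := cosh_mellin (ReD_gt0 a0 d0) (ReD_gt0 b0 c0).
have [i1 i2] := (ED1_integrable k1, ED1_integrable k2).
rewrite (_ : a + c + (b + d) = N) in i1 j1; last by rewrite /N; ring.
rewrite (_ : a + d + (b + c) = N) in i2 j2; last by rewrite /N; ring.
set f1 := (fun x : R => _) in i1 j1; set f2 := (fun x : R => _) in i2 j2.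
have GS x y : Gamma N * G (x + y) (x - y) = (2 * pi)%:C * (f1 x * f2 y).
  rewrite GE ccosh2_sumdiff /f1 /f2.
  have h1 : 0 < Re (ccosh2 x)%:C by rewrite /= ccosh2_gt0.
  have h2 : 0 < Re (ccosh2 y)%:C by rewrite /= ccosh2_gt0.
  have h3 : 0 < Re ((ccosh2 x)%:C * (ccosh2 y)%:C) by rewrite cReZ mulr_gt0 ?ccosh2_gt0.
  have m3 := GI_mul N0 h1 h2 h3; rewrite -rmorphM in m3.
  have EE : cexp ((a - b) * (x + y)%:C) * cexp ((c - d) * (x - y)%:C) =
     cexp ((a + c - (b + d)) * x%:C) * cexp ((a + d - (b + c)) * y%:C).
    by rewrite -!cexpD; congr cexp; rewrite rmorphB rmorphD; ring.
  have aux (g p A B A' B' G1 G2 G3 : R[i]) : g * G3 = G1 * G2 -> A * B = A' * B' ->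
      g * (p * (A * B * G3)) = p * (A' * G1 * (B' * G2)).
    move=> e1 e2; transitivity (p * (A * B) * (g * G3)); first by ring.
    by rewrite e1 e2; ring.
  exact: aux m3 EE.
have eS := ED2_sumdiff eG.
transitivity (2 * cint (fun x => cint (fun y => (2 * pi)%:C * (f1 x * f2 y)))).
  rewrite mulrCA; congr (_ * _).
  rewrite -cintegralZ; last exact: ED1_integrable (ED2_int eS).
  apply: eq_cintegral => x.
  rewrite -cintegralZ; last exact: ED1_integrable (ED2_fst x eS).
  by apply: eq_cintegral => y; exact: GS.
transitivity (2 * ((2 * pi)%:C * (cint f1 * cint f2))).
  by congr (_ * _); exact: cint_prod.
have q2 : (2 * pi)%:C = 2 * pi%:C :> R[i] by rewrite rmorphM rmorph_nat.
rewrite j1 j2 q2.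
have m2 : (2 : R[i]) != 0 by rewrite pnatr_eq0.
move: (Gamma _) (Gamma _) (Gamma _) (Gamma _) => p q r s.
by move: (pi%:C) => P; field.
Qed.

(** The constant 4 pi is the product of 2 / pi from the folded density, 2 pi from Parseval, and pi
    from [wilson_kernel_int]. *)
Theorem wilson a b c d : 0 < Re a -> 0 < Re b -> 0 < Re c -> 0 < Re d ->
  Gamma (a + b + c + d) * cint (wilson_integrand a b c d) =
  (4 * pi)%:C * (Gamma (a + b) * Gamma (c + d) *
    (Gamma (a + c) * Gamma (b + d) * (Gamma (a + d) * Gamma (b + c)))).
Proof.
move=> a0 b0 c0 d0.
have [_ E1] := wilson_integrand_ED1 a0 b0 c0 d0.
have E2 := gamma_quad_parseval a0 b0 c0 d0; have E3 := wilson_kernel_int a0 b0 c0 d0.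
have p0 : (pi%:C : R[i]) != 0 by rewrite fmorph_eq0 gt_eqF// pi_gt0.
have aux (g I J K x y z : R[i]) : I = (2 / pi)%:C * J -> J = x * y * (2 * pi)%:C * K ->
    g * K = pi%:C * z -> g * I = (4 * pi)%:C * (x * y * z).
  move=> -> -> e; transitivity ((2 / pi)%:C * (2 * pi)%:C * (x * y * (g * K))); first by ring.
  have q2 : (2 * pi)%:C = 2 * pi%:C :> R[i] by rewrite rmorphM rmorph_nat.
  have q3 : (2 / pi)%:C = 2 / pi%:C :> R[i] by rewrite fmorph_div rmorph_nat.
  have q4 : (4 * pi)%:C = 4 * pi%:C :> R[i] by rewrite rmorphM rmorph_nat.
  rewrite e q2 q3 q4; move: p0; move: (pi%:C) => q q0; by field.
exact: aux E1 E2 E3.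
Qed.

End Wilson.

(** * Transformation of the Whittaker vectors *)

Section Intertwiners.
Context {R : realType}.
Local Notation pi' := (pi%:C : R[i]).

Lemma barnes_quad_int (a b c d : R[i]) : 0 < Re a -> 0 < Re b -> 0 < Re c -> 0 < Re d ->
  cintble (fun s : R => Gamma (a + 'i * s%:C) * Gamma (b + 'i * s%:C) *
    Gamma (c - 'i * s%:C) * Gamma (d - 'i * s%:C)).
Proof.
move=> a0 b0 c0 d0.
apply: cintble_ext (ED1_integrable (ED1M (GammaGamma_ED1 a0 c0) (GammaGamma_ED1 b0 d0))) => s.
by move: (Gamma _) (Gamma _) (Gamma _) (Gamma _) => x y z w; ring.
Qed.

Lemma prodr_pair (f : R[i] -> R[i]) z w : \prod_(t <- [:: z; w]) f t = f z * f w.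
Proof. by rewrite big_cons big_seq1. Qed.

Lemma prodr_triple (f : R[i] -> R[i]) z w u :
  \prod_(t <- [:: z; w; u]) f t = f z * (f w * f u).
Proof. by rewrite 2!big_cons big_seq1. Qed.

Lemma Re_half : Re (2^-1 : R[i]) = 2^-1.
Proof. by rewrite -(rmorph_nat (real_complex R)) -fmorphV. Qed.

Lemma Re_ii (z : R[i]) : Re ('i * z) = - Im z.
Proof. by rewrite cReM /=; ring. Qed.

Lemma real_Re_ii (t : R) : Re ('i * t%:C : R[i]) = 0.
Proof. by rewrite Re_ii /= oppr0. Qed.

Section RightVector.
Variables (g1 g2 g3 : R[i]) (kappa t11 t21 t22 : R).
Hypothesis kappa_gt0 : 0 < kappa.
Hypothesis g1_kappa : Im g1 + kappa < 2^-1.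
Hypothesis g2_kappa : Im g2 + kappa < 2^-1.

(** The sum s11 + s22 is fixed by the delta-functions, so Gamma (1 - i s11 - i s22) does not vary
    with s21; it equals Gamma (a + b + c + d) and cancels the denominator of Barnes' lemma. Gamma
    (1/2 - i s21) cancels against the kernel. The bounds on Im g1 and Im g2 are Re b > 0 and Re a >
    0. *)
Lemma B_R_phiR :
  B_R g1 g2 g3 kappa phiR t11%:C t21%:C t22%:C =
  half_density t11%:C t21%:C t22%:C * psiR g1 g2 g3 (t11%:C - 'i * kappa%:C) t21%:C t22%:C.
Proof.
pose a : R[i] := 2^-1 - kappa%:C + 'i * (g2 - t11%:C).
pose b : R[i] := 2^-1 - kappa%:C + 'i * (g1 - t11%:C).
pose c : R[i] := kappa%:C + 'i * (t11 - t21)%:C.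
pose d : R[i] := kappa%:C + 'i * (t11 - t22)%:C.
have a0 : 0 < Re a.
  by rewrite /a !(cReD, cReN) Re_ii cImD cImN Re_half /= subr0 -addrA -opprD subr_gt0 addrC.
have b0 : 0 < Re b.
  by rewrite /b !(cReD, cReN) Re_ii cImD cImN Re_half /= subr0 -addrA -opprD subr_gt0 addrC.
have c0 : 0 < Re c by rewrite /c ReDi.
have d0 : 0 < Re d by rewrite /d ReDi.
have B := barnes_first a0 b0 c0 d0; have iB := barnes_quad_int a0 b0 c0 d0.
have n0 : Gamma (a + b + c + d) != 0.
  exact: Gamma_neq0 (ReD_gt0 (ReD_gt0 (ReD_gt0 a0 b0) c0) d0).
pose K0 := (2 * pi')^-1 * (cexp (pi' * (t11%:C - 'i * kappa%:C) / 2) / Gamma ('i * t21%:C - 'i * t22%:C))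
  * (Gamma ('i * (t21%:C - t11%:C) - kappa%:C + 2^-1) * Gamma ('i * (g3 - t21%:C) + 2^-1)
  * (Gamma ('i * (t22%:C - t11%:C) - kappa%:C + 2^-1) * Gamma ('i * (g3 - t22%:C) + 2^-1)))
  * norm_GG.
pose K := K0 * Gamma (a + b + c + d).
rewrite /B_R /apply_kernel /delta_integral.
transitivity (cint (fun s : R => K * (Gamma (a + 'i * s%:C) * Gamma (b + 'i * s%:C) *
    Gamma (c - 'i * s%:C) * Gamma (d - 'i * s%:C)))).
  apply: eq_cintegral => s; rewrite /kernel_R /phiR prodr_pair.
  have h0 : Gamma (2^-1 - 'i * s%:C) != 0 by apply: Gamma_neq0; rewrite subiE ReDi Re_half invr_gt0.
  have -> : 'i * (g2 - g1 - (t11%:C - 'i * kappa%:C - g1 - s%:C)) + 2^-1 = a + 'i * s%:C.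
    by rewrite /a; ring: (@ii_m1 R).
  have -> : - 'i * s%:C + 2^-1 = 2^-1 - 'i * s%:C :> R[i] by ring.
  have -> : 2^-1 - 'i * (t11%:C - 'i * kappa%:C - g1 - s%:C) = b + 'i * s%:C.
    by rewrite /b; ring: (@ii_m1 R).
  have -> : 1 - 'i * (t11%:C - 'i * kappa%:C - g1 - s%:C) -
    'i * (t21%:C + t22%:C - g1 - g2 - (t11%:C - 'i * kappa%:C - g1 - s%:C)) = a + b + c + d.
    by rewrite /a /b /c /d !rmorphB; field: (@ii_m1 R).
  have -> : 'i * (t11%:C - t21%:C - s%:C) + kappa%:C = c - 'i * s%:C.
    by rewrite /c !rmorphB; ring.
  have -> : 'i * (t11%:C - t22%:C - s%:C) + kappa%:C = d - 'i * s%:C.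
    by rewrite /d !rmorphB; ring.
  rewrite /K /K0; move: h0.
  move: (Gamma (2^-1 - 'i * s%:C)) (Gamma (a + 'i * s%:C)) (Gamma (b + 'i * s%:C)) => h A B1 h0.
  move: (Gamma (c - 'i * s%:C)) (Gamma (d - 'i * s%:C)) (Gamma (a + b + c + d)) => C D S.
  move: (Gamma ('i * t21%:C - 'i * t22%:C))^-1 => x.
  move: (Gamma _) (Gamma _) (Gamma _) (Gamma _) => y z w v.
  move: (cexp _) norm_GG (2 * pi')^-1 => e N q; by field.
apply: (etrans (cintegralZ K iB)).
apply: (etrans (etrans (esym (mulrA K0 _ _)) (congr1 (fun z => K0 * z) B))); rewrite {}/K {}/K0 /half_density /psiR prodr_triple !prodr_pair.
have -> : 'i * (t21%:C - (t11%:C - 'i * kappa%:C)) + 2^-1 =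
    'i * (t21%:C - t11%:C) - kappa%:C + 2^-1 :> R[i] by ring: (@ii_m1 R).
have -> : 'i * (t22%:C - (t11%:C - 'i * kappa%:C)) + 2^-1 =
    'i * (t22%:C - t11%:C) - kappa%:C + 2^-1 :> R[i] by ring: (@ii_m1 R).
have -> : a + c = 'i * (g2 - t21%:C) + 2^-1 by rewrite /a /c rmorphB; ring.
have -> : a + d = 'i * (g2 - t22%:C) + 2^-1 by rewrite /a /d rmorphB; ring.
have -> : b + c = 'i * (g1 - t21%:C) + 2^-1 by rewrite /b /c rmorphB; ring.
have -> : b + d = 'i * (g1 - t22%:C) + 2^-1 by rewrite /b /d rmorphB; ring.
have -> : cexp (pi' * (t11%:C - 'i * kappa%:C) / 2) =
    cexp (pi' / 2 * (t21%:C + t22%:C)) * cexp (pi' / 2 * (t11%:C - 'i * kappa%:C - t21%:C - t22%:C)).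
  by rewrite -cexpD; congr cexp; field.
have q2 : (2 * pi)%:C = 2 * pi' by rewrite rmorphM rmorph_nat.
have p0 : 2 * pi' != 0 by rewrite mulf_neq0 ?pnatr_eq0// fmorph_eq0 gt_eqF// pi_gt0.
rewrite q2; move: p0.
move: (Gamma ('i * t21%:C - 'i * t22%:C))^-1 => x.
move: (Gamma ('i * (t21%:C - t11%:C) - kappa%:C + 2^-1)) (Gamma ('i * (t22%:C - t11%:C) - kappa%:C + 2^-1)) => y1 y2.
move: (Gamma ('i * (g1 - t21%:C) + 2^-1)) (Gamma ('i * (g1 - t22%:C) + 2^-1)) => z1 z2.
move: (Gamma ('i * (g2 - t21%:C) + 2^-1)) (Gamma ('i * (g2 - t22%:C) + 2^-1)) => u1 u2.
move: (Gamma ('i * (g3 - t21%:C) + 2^-1)) (Gamma ('i * (g3 - t22%:C) + 2^-1)) => v1 v2.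
move: (cexp _) (cexp _) norm_GG (2 * pi') => e f N q q0; by field.
Qed.

End RightVector.

Section LeftVector.
Variables (g1 g2 g3 : R[i]) (kappa t11 t21 t22 : R).
Hypothesis kappa_gt0 : 0 < kappa.
Hypothesis kappa_lt : kappa < 2^-1.
Hypothesis g2_kappa : Im g2 < 2^-1 + kappa.
Hypothesis g3_real : conjc g3 = g3.

(** The four Gamma values produced by Barnes' lemma are exactly those in the denominator of
    [kernel_L], so only exponentials and the half density survive. Reality of g3 identifies its
    conjugate in [phiL] with g3 in the kernel. *)
Lemma B_L_phiL :
  B_L g1 g2 g3 kappa (phiL g1 g2 g3) t11%:C t21%:C t22%:C =
  half_density t11%:C t21%:C t22%:C * psiL (t11%:C - 'i * kappa%:C) t21%:C t22%:C.
Proof.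
have g3i : Im g3 = 0.
  have := congr1 (fun z : R[i] => Im z) g3_real; case: (g3) => x y /= /eqP.
  by rewrite eq_sym -subr_eq0 opprK -mulr2n mulrn_eq0 => /eqP.
pose b1 := conjc g1; pose b2 := conjc g2.
pose a : R[i] := 2^-1.
pose b : R[i] := 2^-1 - kappa%:C + 'i * ((t21 + t22 - t11)%:C - g3).
pose c : R[i] := kappa%:C + 'i * (t11 - t21)%:C.
pose d : R[i] := kappa%:C + 'i * (t11 - t22)%:C.
have a0 : 0 < Re a by rewrite /a Re_half invr_gt0.
have b0 : 0 < Re b.
  by rewrite /b !(cReD, cReN) Re_ii cImD cImN Re_half g3i /= subr0 oppr0 addr0 subr_gt0.
have c0 : 0 < Re c by rewrite /c ReDi.
have d0 : 0 < Re d by rewrite /d ReDi.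
have B := barnes_first a0 b0 c0 d0; have iB := barnes_quad_int a0 b0 c0 d0.
have nac := Gamma_neq0 (ReD_gt0 a0 c0); have nad := Gamma_neq0 (ReD_gt0 a0 d0).
have nbc := Gamma_neq0 (ReD_gt0 b0 c0); have nbd := Gamma_neq0 (ReD_gt0 b0 d0).
pose K0 := (2 * pi')^-1 * (cexp (- (pi' * (t11%:C - 'i * kappa%:C) / 2)) / Gamma ('i * t21%:C - 'i * t22%:C))
  * (Gamma (a + c) * Gamma (a + d) * (Gamma (b + c) * Gamma (b + d)))^-1
  * norm_GG.
pose K := K0 * Gamma (a + b + c + d).
rewrite /B_L /apply_kernel /delta_integral.
transitivity (cint (fun s : R => K * (Gamma (a + 'i * s%:C) * Gamma (b + 'i * s%:C) *
    Gamma (c - 'i * s%:C) * Gamma (d - 'i * s%:C)))).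
  apply: eq_cintegral => s; rewrite /kernel_L /phiL prodr_pair g3_real -/b1 -/b2.
  (* This factor of [phiL] is divided out by the kernel; its argument has real part 1/2 + kappa - Im
     g2, positive by [g2_kappa]. *)
  have h0 : Gamma ('i * (b1 - b2 + (t11%:C - 'i * kappa%:C - b1 - s%:C)) + 2^-1) != 0.
    apply: Gamma_neq0.
    have -> : 'i * (b1 - b2 + (t11%:C - 'i * kappa%:C - b1 - s%:C)) + 2^-1 =
       2^-1 + kappa%:C - 'i * b2 + 'i * (t11 - s)%:C.
      by rewrite rmorphB; ring: (@ii_m1 R).
    rewrite ReDi !(cReD, cReN) Re_ii Re_half /b2 opprK.
    by case: (g2) g2_kappa => x y /=; rewrite subr_gt0.
  have -> : 'i * s%:C + 2^-1 = a + 'i * s%:C by rewrite /a addrC.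
  have -> : 'i * (b2 - g3 + (t21%:C + t22%:C - b1 - b2 - (t11%:C - 'i * kappa%:C - b1 - s%:C))) + 2^-1
     = b + 'i * s%:C.
    by rewrite /b rmorphB rmorphD; ring: (@ii_m1 R).
  have -> : 'i * (b1 - g3 + (t11%:C - 'i * kappa%:C - b1 - s%:C) + s%:C) + 1 = a + b + c + d.
    by rewrite /a /b /c /d !(rmorphB, rmorphD); field: (@ii_m1 R).
  have -> : 'i * (t11%:C - t21%:C - s%:C) + kappa%:C = c - 'i * s%:C.
    by rewrite /c !rmorphB; ring.
  have -> : 'i * (t11%:C - t22%:C - s%:C) + kappa%:C = d - 'i * s%:C.
    by rewrite /d !rmorphB; ring.
  have -> : 'i * (t11%:C - t21%:C) + kappa%:C + 2^-1 = a + c by rewrite /a /c !rmorphB; ring.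
  have -> : 'i * (t11%:C - t22%:C) + kappa%:C + 2^-1 = a + d by rewrite /a /d !rmorphB; ring.
  have -> : 'i * (t22%:C - g3) + 2^-1 = b + c by rewrite /b /c !(rmorphB, rmorphD); ring.
  have -> : 'i * (t21%:C - g3) + 2^-1 = b + d by rewrite /b /d !(rmorphB, rmorphD); ring.
  rewrite /K /K0; move: h0 nac nad nbc nbd.
  move: (Gamma ('i * (b1 - b2 + (t11%:C - 'i * kappa%:C - b1 - s%:C)) + 2^-1)) => h.
  move: (Gamma (a + 'i * s%:C)) (Gamma (b + 'i * s%:C)) (Gamma (c - 'i * s%:C)) (Gamma (d - 'i * s%:C)) => A B1 C D.
  move: (Gamma (a + c)) (Gamma (a + d)) (Gamma (b + c)) (Gamma (b + d)) => ac ad bc bd.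
  move: (Gamma ('i * t21%:C - 'i * t22%:C))^-1 (Gamma (a + b + c + d)) => x S.
  move: (cexp _) norm_GG (2 * pi')^-1 => e N q h0 n1 n2 n3 n4; field.
  by rewrite n1 n2 n3 n4 h0.
apply: (etrans (cintegralZ K iB)).
apply: (etrans (etrans (esym (mulrA K0 _ _)) (congr1 (fun z => K0 * z) B))); rewrite {}/K {}/K0 /half_density /psiL.
have -> : cexp (- (pi' * (t11%:C - 'i * kappa%:C) / 2)) =
    cexp (pi' / 2 * (t21%:C + t22%:C)) * cexp (- (pi' / 2) * (t11%:C - 'i * kappa%:C + t21%:C + t22%:C)).
  by rewrite -cexpD; congr cexp; field.
have q2 : (2 * pi)%:C = 2 * pi' by rewrite rmorphM rmorph_nat.
have p0 : 2 * pi' != 0 by rewrite mulf_neq0 ?pnatr_eq0// fmorph_eq0 gt_eqF// pi_gt0.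
rewrite q2; move: p0 nac nad nbc nbd.
move: (Gamma ('i * t21%:C - 'i * t22%:C))^-1 => x.
move: (Gamma (a + c)) (Gamma (a + d)) (Gamma (b + c)) (Gamma (b + d)) => ac ad bc bd.
move: (cexp _) (cexp _) norm_GG (2 * pi') => e f N q q0 n1 n2 n3 n4; field.
by rewrite n1 n2 n3 n4 q0.
Qed.

End LeftVector.
End Intertwiners.

(** * The Gauss-Givental integral *)

Section GammaPairShift.
Context {R : realType}.
Local Notation RM := (measurableTypeR R).

Lemma ED3_prod (f g h : R -> R[i]) : ED1 f -> ED1 g -> ED1 h ->
  ED3 (fun x y z => f x * g y * h z).
Proof.
move=> [mf [C [c [C0 c0 hf]]]] [mg [D [d [D0 d0 hg]]]] [mh [E [e [E0 e0 hh]]]]; split.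
  apply: cmeasM; last by apply: (cmeas_comp mh); exact: measurable_snd.
  apply: cmeasM.
    by apply: (cmeas_comp mf); apply: (measurableT_comp measurable_fst); exact: measurable_fst.
  by apply: (cmeas_comp mg); apply: (measurableT_comp measurable_snd); exact: measurable_fst.
pose k := Num.min c (Num.min d e).
exists (C * D * E), k; split; [by rewrite !mulr_ge0|by rewrite !lt_min c0 d0|].
have kc z : edec c z <= edec k z by apply: edec_le; rewrite /k ge_min lexx.
have kd z : edec d z <= edec k z by apply: edec_le; rewrite /k !ge_min lexx orbT.
have ke z : edec e z <= edec k z by apply: edec_le; rewrite /k !ge_min lexx !orbT.
have ge (z : R[i]) : 0 <= Normc.normc z by exact: normc_ge0.
have gd (l z : R) : 0 <= edec l z by exact: edec_ge0.
move=> x y z; rewrite 2!Normc.normcM.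
apply: (le_trans (ler_pM (mulr_ge0 (ge _) (ge _)) (ge _)
  (ler_pM (ge _) (ge _) (hf x) (hg y)) (hh z))).
rewrite [X in X <= _](_ : _ = C * D * E * (edec c x * edec d y * edec e z)); last by ring.
by rewrite ler_wpM2l ?mulr_ge0// ler_pM ?mulr_ge0// ler_pM.
Qed.

Lemma ED3M_bdd (F G : R -> R -> R -> R[i]) :
  @cmeas R _ (RM * RM * RM)%type (fun p => G p.1.1 p.1.2 p.2) ->
  (exists K, forall x y z, Normc.normc (G x y z) <= K) ->
  ED3 F -> ED3 (fun x y z => F x y z * G x y z).
Proof.
move=> mG [K GK] [mF [C [c [C0 c0 h]]]]; split; first exact: cmeasM.
have K0 : 0 <= K by apply: le_trans (GK 0 0 0); exact: normc_ge0.
exists (C * K), c; split => //; first exact: mulr_ge0.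
move=> x y z; rewrite Normc.normcM mulrAC.
by apply: ler_pM => //; exact: normc_ge0.
Qed.

Lemma Gamma_bdd (a : R[i]) : 0 < Re a ->
  exists K, forall t : R, Normc.normc (Gamma (a + 'i * t%:C)) <= K.
Proof. by move=> a0; exact: ED1_bdd (Gamma_ED1 a0). Qed.

Lemma gexp_FT (a : R[i]) (s y : R) : 0 < Re a ->
  cint (fun u => gexp a 1 (u + y) * cexp ('i * (s * u)%:C)) =
  Gamma (a + 'i * s%:C) * cexp (- ('i * (s * y)%:C)).
Proof.
move=> a0; have as0 : 0 < Re (a + 'i * s%:C) by rewrite ReDi.
have o1 : 0 < Re (1 : R[i]) by rewrite /= ltr01.
have i1 := ED1_integrable (gexp_ED1 as0 o1).
rewrite (GammaE as0) /GI -(cint_shift y i1).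
have i2 := cintble_shift y i1.
rewrite -cintegralZr//; apply: eq_cintegral => u.
by rewrite /gexp -!cexpD; congr cexp; rewrite !(rmorphM, rmorphD); ring.
Qed.

Lemma gamma_pair_conv (a b : R[i]) (y : R) : 0 < Re a -> 0 < Re b ->
  cintble (fun s : R => Gamma (a - 'i * s%:C) * Gamma (b - 'i * s%:C) * cexp ('i * (s * y)%:C)) /\
  cint (fun s : R => Gamma (a - 'i * s%:C) * Gamma (b - 'i * s%:C) * cexp ('i * (s * y)%:C)) =
  (2 * pi)%:C * cint (fun u => gexp a 1 (- u) * gexp b 1 (u + y)).
Proof.
move=> a0 b0; have o1 : 0 < Re (1 : R[i]) by rewrite /= ltr01.
have ea := gexp_ED1 a0 o1; have eb := gexp_ED1 b0 o1.
have ib := cintble_shift y (ED1_integrable eb).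
have [K hK] := ED1_bdd ea.
have FTa s : cint (fun u => gexp a 1 u * cexp ('i * (s * u)%:C)) = Gamma (a + 'i * s%:C).
  have := gexp_FT s 0 a0; rewrite mulr0 mulr0 oppr0 cexp0 mulr1 => <-.
  by apply: eq_cintegral => u; rewrite addr0.
have iFT : cintble (fun s : R => cint (fun u => gexp a 1 u * cexp ('i * (s * u)%:C))).
  by apply: cintble_ext (ED1_integrable (Gamma_ED1 a0)) => s; rewrite FTa.
have := parseval (ED1_integrable ea) hK (ccontat_gexp a 1) iFT ib => /= <-.
have eJ : ED1 (fun s : R => Gamma (a + 'i * s%:C) * (Gamma (b + 'i * s%:C) * cexp (- ('i * (s * y)%:C)))).
  apply: ED1M; first exact: Gamma_ED1.
  apply: ED1M_bdd (Gamma_ED1 b0); first by cmeas.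
  by exists 1 => s; rewrite -mulrN -rmorphN normc_wave.
have iJ := ED1_integrable eJ.
have E s : Gamma (a - 'i * s%:C) * Gamma (b - 'i * s%:C) * cexp ('i * (s * y)%:C) =
  Gamma (a + 'i * (- s)%:C) * (Gamma (b + 'i * (- s)%:C) * cexp (- ('i * (- s * y)%:C))).
  by rewrite -!subiE -mulrA mulNr rmorphN mulrN opprK.
split; first by apply: cintble_ext (cintble_opp iJ) => s; rewrite E.
transitivity (cint (fun s : R => Gamma (a + 'i * s%:C) * (Gamma (b + 'i * s%:C) * cexp (- ('i * (s * y)%:C))))).
  by rewrite -(cint_opp iJ); apply: eq_cintegral => s; exact: E.
by apply: eq_cintegral => s; rewrite FTa gexp_FT.
Qed.

(* The contour shift s -> s - i e without Cauchy's theorem: after Parseval it is the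
   multiplication of the integrand by the constant exp (- e y). *)
Lemma gamma_pair_shift (a b : R[i]) (e y : R) : 0 < Re a -> 0 < Re b -> e < Re a -> e < Re b ->
  cint (fun s : R => Gamma (a - 'i * s%:C) * Gamma (b - 'i * s%:C) * cexp ('i * (s * y)%:C)) =
  cint (fun s : R => Gamma (a - e%:C - 'i * s%:C) * Gamma (b - e%:C - 'i * s%:C) *
     cexp ('i * (s * y)%:C + (e * y)%:C)).
Proof.
move=> a0 b0 ea eb.
have a1 : 0 < Re (a - e%:C) by rewrite cReD cReN /= subr_gt0.
have b1 : 0 < Re (b - e%:C) by rewrite cReD cReN /= subr_gt0.
have [_ ->] := gamma_pair_conv y a0 b0; have [i1 e1] := gamma_pair_conv y a1 b1.
transitivity (cexp (e * y)%:C * cint (fun s : R => Gamma (a - e%:C - 'i * s%:C) * Gamma (b - e%:C - 'i * s%:C) *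
     cexp ('i * (s * y)%:C))); last first.
  rewrite -cintegralZ//; apply: eq_cintegral => s; rewrite cexpD.
  by move: (Gamma _) (Gamma _) (cexp _) (cexp _) => p q r t; ring.
rewrite e1 mulrCA; congr (_ * _).
have ey : cexp (e * y)%:C != 0 :> R[i] by exact: cexp_neq0.
have E u : gexp (a - e%:C) 1 (- u) * gexp (b - e%:C) 1 (u + y) =
   cexp (- (e * y)%:C) * (gexp a 1 (- u) * gexp b 1 (u + y)).
  rewrite /gexp -!cexpD; congr cexp; rewrite !(rmorphM, rmorphD, rmorphN); ring.
have i2 : cintble (fun u => gexp a 1 (- u) * gexp b 1 (u + y)).
  have o1 : 0 < Re (1 : R[i]) by rewrite /= ltr01.
  have [K hK] := ED1_bdd (ED1_opp (gexp_ED1 a0 o1)).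
  have ib := cintble_shift y (ED1_integrable (gexp_ED1 b0 o1)).
  apply: (cintegrable_bound _ (integrableZl measurableT K (cintegrable_normc ib))).
    by apply: cmeasM; [exact: (ED1_opp (gexp_ED1 a0 o1)).1|exact: cintegrable_meas ib].
  by move=> u; rewrite Normc.normcM ler_wpM2r ?normc_ge0.
have I2 : cint (fun u => gexp (a - e%:C) 1 (- u) * gexp (b - e%:C) 1 (u + y)) =
    cexp (- (e * y)%:C) * cint (fun u => gexp a 1 (- u) * gexp b 1 (u + y)).
  by apply: (etrans _ (cintegralZ _ i2)); apply: eq_cintegral => u; exact: E.
by rewrite I2 cexpN mulVKf.
Qed.

End GammaPairShift.

(** * The Gauss-Givental integral in the Fourier modes p and q *)

Section Givental.
Context {R : realType}.
Local Notation RM := (measurableTypeR R).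
Local Notation pi' := (pi%:C : R[i]).
Implicit Types (p q s t u v : R).

Lemma GammaN_ED1 (a : R[i]) : 0 < Re a -> ED1 (fun t : R => Gamma (a - 'i * t%:C)).
Proof. by move=> a0; apply: ED1_ext (ED1_opp (Gamma_ED1 a0)) => t; rewrite -subiE. Qed.

Lemma GammaN_bdd (a : R[i]) : 0 < Re a ->
  exists K, forall t : R, Normc.normc (Gamma (a - 'i * t%:C)) <= K.
Proof. by move=> a0; exact: ED1_bdd (GammaN_ED1 a0). Qed.

Lemma normc_mul_le (z w : R[i]) (K L : R) : Normc.normc z <= K -> Normc.normc w <= L ->
  Normc.normc (z * w) <= K * L.
Proof. by move=> h k; rewrite Normc.normcM; apply: ler_pM => //; exact: normc_ge0. Qed.

(** At fixed s the new coordinates are translates of the two inner variables, so translation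
    invariance is enough; Fubini then moves s to the innermost place. *)
Lemma cint3_shear (f g : R -> R -> R -> R[i]) (k : R[i]) (a b : R) : ED3 f -> ED3 g ->
  (forall s p q, k * f s (p - a - s) (q - b - s) = g s p q) ->
  k * cint (fun s => cint (fun u => cint (f s u))) =
  cint (fun p => cint (fun q => cint (fun s => g s p q))).
Proof.
move=> ef eg E; apply: (etrans _ (ED3_cycle eg)).
apply: (etrans (esym (cintegralZ k (ED1_integrable (ED2_int (ED3_int ef)))))).
apply: eq_cintegral => s.
have i1 := ED1_integrable (ED2_int (ED3_fst s ef)).
have E1 : cint (fun u => cint (f s u)) = cint (fun p => cint (f s (p - a - s))).
  apply: (etrans (esym (cint_shift (- a - s) i1))); apply: eq_cintegral => p.
  by rewrite addrA.
have i2 : cintble (fun p => cint (f s (p - a - s))).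
  by apply: cintble_ext (cintble_shift (- a - s) i1) => p; rewrite addrA.
rewrite E1 -(cintegralZ k i2); apply: eq_cintegral => p.
have i3 := ED1_integrable (ED3_fst2 s (p - a - s) ef).
have i4 : cintble (fun q => f s (p - a - s) (q - b - s)).
  by apply: cintble_ext (cintble_shift (- b - s) i3) => q; rewrite addrA.
rewrite -(cint_shift (- b - s) i3) -cintegralZ; last exact: cintble_shift.
by apply: eq_cintegral => q; rewrite -E addrA.
Qed.

Variables (lam1 lam2 lam3 eps x1 x2 x3 : R).
Hypothesis eps_gt0 : 0 < eps.
Hypothesis eps_lt : eps < 2^-1.
Let g1 : R[i] := lam1%:C + 'i * eps%:C.
Let g2 : R[i] := lam2%:C - 'i * eps%:C.
Let g3 : R[i] := lam3%:C.

Let A : R[i] := 2^-1 - 'i * (g2 - g3).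
Let B : R[i] := 1 - 'i * (g1 - g3).
Let C : R[i] := 2^-1 - 'i * (g1 - g2).

Definition givental_rest s t : R[i] :=
  cexp ('i * s%:C * (x1 - x3)%:C + 'i * t%:C * (x2 - x3)%:C) *
  (Gamma (2^-1 - 'i * s%:C) * Gamma (1 - 'i * (s + t)%:C) *
   Gamma (A - 'i * t%:C) * Gamma (C - 'i * s%:C)).

(* The Gauss-Givental integrand with s21 moved to s21 - i e. *)
Definition givental_shifted (e : R) s u t : R[i] :=
  givental_rest s t *
  (Gamma (2^-1 - e%:C - 'i * u%:C) * Gamma (B - e%:C - 'i * (s + u)%:C) *
   cexp ('i * (u * (x1 - x2))%:C + (e * (x1 - x2))%:C)).

Let ReA : 0 < Re A.
Proof.
rewrite /A cReD cReN Re_ii opprK Re_half /g2 /g3 !reimE /=.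
by move: eps_lt => h; rewrite (_ : _ + _ = 2^-1 - eps) ?subr_gt0//; ring.
Qed.

Let ReB e : e < 2^-1 -> 0 < Re (B - e%:C).
Proof.
move=> he; rewrite /B !(cReD, cReN) Re_ii opprK /g1 /g3 !reimE /=.
have h2 : (2^-1 : R) <= 1 by rewrite invf_le1// ler1n.
have : e < 1 + eps by apply: (lt_le_trans he); rewrite (le_trans h2)// lerDl ltW.
rewrite -subr_gt0 => h; rewrite (_ : 1 + (0 + (0 * 0 + 1 * eps) - 0) - e = 1 + eps - e)//.
by ring.
Qed.

Let ReC : 0 < Re C.
Proof.
rewrite /C cReD cReN Re_ii opprK Re_half /g1 /g2 !reimE /=.
have : 0 < 2^-1 + (eps + eps) :> R by rewrite !addr_gt0// invr_gt0.
by move=> h; rewrite (_ : _ + _ = 2^-1 + (eps + eps))//; ring.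
Qed.

Let Re_halfB e : e < 2^-1 -> 0 < Re (2^-1 - e%:C : R[i]).
Proof. by move=> he; rewrite cReD cReN Re_half /= subr_gt0. Qed.

Let Re_half0 : 0 < Re (2^-1 : R[i]).
Proof. by rewrite Re_half invr_gt0. Qed.

Let Re_one0 : 0 < Re (1 : R[i]).
Proof. by rewrite /= ltr01. Qed.

(** Three Gamma factors, each in one of the variables s, u, t, supply the decay; the other three and
    the exponentials are merely bounded. *)
Lemma givental_shifted_ED3 e : e < 2^-1 -> ED3 (givental_shifted e).
Proof.
move=> he; have h1 := Re_halfB he; have hB := ReB he.
have e3 := ED3_prod (GammaN_ED1 Re_half0) (GammaN_ED1 h1) (GammaN_ED1 ReA).
pose G s u t := cexp ('i * s%:C * (x1 - x3)%:C + 'i * t%:C * (x2 - x3)%:C) *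
   cexp ('i * (u * (x1 - x2))%:C + (e * (x1 - x2))%:C) *
   (Gamma (1 - 'i * (s + t)%:C) * Gamma (C - 'i * s%:C) * Gamma (B - e%:C - 'i * (s + u)%:C)).
have m1 : measurable_fun [set: RM * RM * RM] (fun p : RM * RM * RM => p.1.1).
  by apply: (measurableT_comp measurable_fst); exact: measurable_fst.
have m2 : measurable_fun [set: RM * RM * RM] (fun p : RM * RM * RM => p.1.2).
  by apply: (measurableT_comp measurable_snd); exact: measurable_fst.
have m3 : measurable_fun [set: RM * RM * RM] (fun p : RM * RM * RM => p.2) by exact: measurable_snd.
have mG : @cmeas R _ (RM * RM * RM)%type (fun w => G w.1.1 w.1.2 w.2).
  apply: cmeasM; first by apply: cmeasM; apply: cmeas_cexp; cmeas.
  apply: cmeasM; last by apply: cmeas_GammaN => //; exact: measurable_funD.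
  by apply: cmeasM; apply: cmeas_GammaN => //; exact: measurable_funD.
have bG : exists K, forall s u t, Normc.normc (G s u t) <= K.
  have [K1 b1] := GammaN_bdd Re_one0; have [K2 b2] := GammaN_bdd ReC; have [K3 b3] := GammaN_bdd hB.
  exists (1 * expR (e * (x1 - x2)) * (K1 * K2 * K3)) => s u t.
  apply: normc_mul_le; last first.
    by apply: normc_mul_le => //; exact: normc_mul_le.
  apply: normc_mul_le; rewrite normc_cexp cReD.
    rewrite -!mulrA !Re_ii !cImM /= -[leRHS]expR0 ler_expR le_eqVlt; apply/orP; left; apply/eqP; ring.
  by rewrite real_Re_ii add0r.
apply: ED3_ext (ED3M_bdd mG bG e3) => s u t; rewrite /G /givental_shifted /givental_rest.
move: (Gamma (2^-1 - 'i * s%:C)) (Gamma (1 - 'i * (s + t)%:C)) (Gamma (A - 'i * t%:C)) => a b c.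
move: (Gamma (C - 'i * s%:C)) (Gamma (B - e%:C - 'i * (s + u)%:C)) (Gamma (2^-1 - e%:C - 'i * u%:C)) => d f g.
by move: (cexp _) (cexp _) => h k; ring.
Qed.

(** Only two of the six Gamma factors involve u, so this is [gamma_pair_shift] with the rest as a
    constant. The bound eps < 1/2 keeps the shifted line to the right of the pole of Gamma (1/2 - i
    s21). *)
Lemma givental_shift s t :
  cint (fun u => givental_shifted 0 s u t) = cint (fun u => givental_shifted eps s u t).
Proof.
have b0 : 0 < Re (B - 'i * s%:C).
  have h0 : 0 < (2^-1 : R) by rewrite invr_gt0.
  by rewrite subiE ReDi; have := ReB h0; rewrite subr0.
have be : eps < Re (B - 'i * s%:C).
  rewrite subiE ReDi; have := ReB eps_lt; rewrite cReD cReN /= subr_gt0//.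
have ae : eps < Re (2^-1 : R[i]) by rewrite Re_half.
have := gamma_pair_shift (x1 - x2) Re_half0 b0 ae be.
have half_pos : (0 : R) < 2^-1 by rewrite invr_gt0.
have i0 := ED1_integrable (ED3_fst2 s t (ED3_perm132 (givental_shifted_ED3 half_pos))).
have i1 := ED1_integrable (ED3_fst2 s t (ED3_perm132 (givental_shifted_ED3 eps_lt))).
have [i2 _] := gamma_pair_conv (x1 - x2) Re_half0 b0.
have a1 : 0 < Re (2^-1 - eps%:C : R[i]) by exact: Re_halfB.
have b1 : 0 < Re (B - 'i * s%:C - eps%:C) by rewrite cReD cReN /= subr_gt0.
have [i3 _] := gamma_pair_conv (x1 - x2) a1 b1.
set f0 := (fun u : R => _) => E.
have E0 u : givental_shifted 0 s u t = givental_rest s t * f0 u.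
  rewrite /givental_shifted /f0 subr0 (_ : 0 * (x1 - x2) = 0); last by ring.
  rewrite addr0 (_ : B - 0%:C - 'i * (s + u)%:C = B - 'i * s%:C - 'i * u%:C) //.
  by rewrite subr0 rmorphD; ring.
have E1 u : givental_shifted eps s u t = givental_rest s t *
  (Gamma (2^-1 - eps%:C - 'i * u%:C) * Gamma (B - 'i * s%:C - eps%:C - 'i * u%:C) *
     cexp ('i * (u * (x1 - x2))%:C + (eps * (x1 - x2))%:C)).
  rewrite /givental_shifted (_ : B - eps%:C - 'i * (s + u)%:C = B - 'i * s%:C - eps%:C - 'i * u%:C) //.
  by rewrite rmorphD; ring.
transitivity (givental_rest s t * cint f0).
  by apply: (etrans _ (cintegralZ _ i2)); apply: eq_cintegral => u; exact: E0.
rewrite E; symmetry.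
apply: (etrans _ (cintegralZ _ _)); first by apply: eq_cintegral => u; exact: E1.
apply: cintble_ext (cintegrableZ (cexp (eps * (x1 - x2))%:C) i3) => u.
by rewrite cexpD; move: (Gamma _) (Gamma _) (cexp _) (cexp _) => a b c d; ring.
Qed.

Let Sg : R := lam1 + lam2 + lam3.
Let Ha : R[i] := 2^-1 + 'i * g1.
Let Hb : R[i] := 2^-1 + 'i * (g1 + g3).
Let Hd : R[i] := 2^-1 + 'i * (g2 - g1).

Definition mode_phase p q : R[i] :=
  cexp ('i * (p * (x1 - x2) + q * (x2 - x3) + x3 * Sg)%:C).

(* The Gauss-Givental integrand in the coordinates s = s11, p, q dual to
   x1 - x2 and x2 - x3. *)
Definition mode_integrand s p q : R[i] := mode_phase p q *
  (Gamma (1 + 'i * (g1 + g2) - 'i * q%:C) * Gamma (1 + 'i * g3 - 'i * p%:C)) *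
  (Gamma (Ha - 'i * p%:C + 'i * s%:C) * Gamma (Hb - 'i * q%:C + 'i * s%:C) *
   Gamma (2^-1 - 'i * s%:C) * Gamma (Hd - 'i * s%:C)).

Definition mode_fun p q : R[i] := cint (fun s => mode_integrand s p q).

Let ReHa : 0 < Re Ha.
Proof.
rewrite /Ha cReD Re_ii Re_half /g1 !reimE /=.
by rewrite (_ : _ + _ = 2^-1 - eps) ?subr_gt0//; ring.
Qed.

Let ReHb : 0 < Re Hb.
Proof.
rewrite /Hb cReD Re_ii Re_half /g1 /g3 !reimE /=.
by rewrite (_ : _ + _ = 2^-1 - eps) ?subr_gt0//; ring.
Qed.

Let ReHd : 0 < Re Hd.
Proof.
rewrite /Hd cReD Re_ii Re_half /g1 /g2 !reimE /=.
have : 0 < 2^-1 + (eps + eps) :> R by rewrite !addr_gt0// invr_gt0.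
by move=> h; rewrite (_ : _ + _ = 2^-1 + (eps + eps))//; ring.
Qed.

Let Re12 : 0 < Re (1 + 'i * (g1 + g2)).
Proof.
rewrite cReD Re_ii /g1 /g2 !reimE /=.
by rewrite (_ : 1 - _ = 1)//; ring.
Qed.

Let Re3 : 0 < Re (1 + 'i * g3).
Proof. by rewrite cReD Re_ii /g3 /= oppr0 addr0. Qed.

Lemma mode_integrand_ED3 : ED3 mode_integrand.
Proof.
have e3 := ED3_prod (GammaN_ED1 Re_half0) (GammaN_ED1 Re3) (GammaN_ED1 Re12).
pose G s p q := mode_phase p q * (Gamma (Hd - 'i * s%:C) * Gamma (Ha + 'i * (s - p)%:C) * Gamma (Hb + 'i * (s - q)%:C)).
have m1 : measurable_fun [set: RM * RM * RM] (fun p : RM * RM * RM => p.1.1).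
  by apply: (measurableT_comp measurable_fst); exact: measurable_fst.
have m2 : measurable_fun [set: RM * RM * RM] (fun p : RM * RM * RM => p.1.2).
  by apply: (measurableT_comp measurable_snd); exact: measurable_fst.
have m3 : measurable_fun [set: RM * RM * RM] (fun p : RM * RM * RM => p.2) by exact: measurable_snd.
have mG : @cmeas R _ (RM * RM * RM)%type (fun w => G w.1.1 w.1.2 w.2).
  apply: cmeasM.
    rewrite /mode_phase; apply: cmeas_cexp; apply: cmeasM; first exact: cmeas_cst.
    by apply: cmeasR; rmeas.
  apply: cmeasM; last by apply: cmeas_Gamma => //; exact: measurable_funB.
  by apply: cmeasM; [apply: cmeas_GammaN|apply: cmeas_Gamma => //; exact: measurable_funB].
have bG : exists K, forall s p q, Normc.normc (G s p q) <= K.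
  have [K1 b1] := GammaN_bdd ReHd; have [K2 b2] := Gamma_bdd ReHa; have [K3 b3] := Gamma_bdd ReHb.
  exists (1 * (K1 * K2 * K3)) => s p q.
  apply: normc_mul_le; first by rewrite /mode_phase normc_wave.
  by apply: normc_mul_le => //; exact: normc_mul_le.
apply: ED3_ext (ED3M_bdd mG bG e3) => s p q; rewrite /G /mode_integrand.
have -> : Ha - 'i * p%:C + 'i * s%:C = Ha + 'i * (s - p)%:C by rewrite rmorphB; ring.
have -> : Hb - 'i * q%:C + 'i * s%:C = Hb + 'i * (s - q)%:C by rewrite rmorphB; ring.
move: (Gamma (2^-1 - 'i * s%:C)) (Gamma (Hd - 'i * s%:C)) (Gamma (Ha + 'i * (s - p)%:C)) => a b c.
move: (Gamma _) (Gamma _) (Gamma _) (mode_phase _ _) => d f g h; ring.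
Qed.

(** The two Gamma factors free of s complete the four values from Barnes' lemma to a product
    symmetric in g1, g2, g3, the form in which Wilson's integral also comes out in
    [gt_kernel_int]. *)
Lemma mode_funE p q :
  Gamma (2 + 'i * (Sg - p - q)%:C) * mode_fun p q =
  mode_phase p q * (2 * pi)%:C *
  (Gamma (1 + 'i * (g1 - p%:C)) * Gamma (1 + 'i * (g2 - p%:C)) * Gamma (1 + 'i * (g3 - p%:C)) *
   (Gamma (1 + 'i * (g1 + g2 - q%:C)) * Gamma (1 + 'i * (g1 + g3 - q%:C)) * Gamma (1 + 'i * (g2 + g3 - q%:C)))).
Proof.
have a0 : 0 < Re (Ha - 'i * p%:C) by rewrite subiE ReDi.
have b0 : 0 < Re (Hb - 'i * q%:C) by rewrite subiE ReDi.
have E := barnes_first a0 b0 Re_half0 ReHd.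
have iB := barnes_quad_int a0 b0 Re_half0 ReHd.
have -> : mode_fun p q = mode_phase p q *
  (Gamma (1 + 'i * (g1 + g2) - 'i * q%:C) * Gamma (1 + 'i * g3 - 'i * p%:C)) *
  cint (fun s : R => Gamma (Ha - 'i * p%:C + 'i * s%:C) * Gamma (Hb - 'i * q%:C + 'i * s%:C) *
   Gamma (2^-1 - 'i * s%:C) * Gamma (Hd - 'i * s%:C)).
  by rewrite -cintegralZ.
rewrite (_ : Ha - 'i * p%:C + (Hb - 'i * q%:C) + 2^-1 + Hd = 2 + 'i * (Sg - p - q)%:C) in E; last first.
  rewrite /Ha /Hb /Hd /Sg /g1 /g2 /g3 !(rmorphB, rmorphD); by field.
rewrite mulrCA E.
rewrite (_ : Ha - 'i * p%:C + 2^-1 = 1 + 'i * (g1 - p%:C)); last by rewrite /Ha; field.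
rewrite (_ : Ha - 'i * p%:C + Hd = 1 + 'i * (g2 - p%:C)); last by rewrite /Ha /Hd; field.
rewrite (_ : Hb - 'i * q%:C + 2^-1 = 1 + 'i * (g1 + g3 - q%:C)); last by rewrite /Hb; field.
rewrite (_ : Hb - 'i * q%:C + Hd = 1 + 'i * (g2 + g3 - q%:C)); last by rewrite /Hb /Hd; field.
rewrite (_ : 1 + 'i * (g1 + g2) - 'i * q%:C = 1 + 'i * (g1 + g2 - q%:C)); last by ring.
rewrite (_ : 1 + 'i * g3 - 'i * p%:C = 1 + 'i * (g3 - p%:C)); last by ring.
move: (Gamma _) (Gamma _) (Gamma _) (Gamma _) (Gamma _) (Gamma _) => a b c d e f.
by move: (mode_phase _ _) => z; ring.
Qed.

(** The factor exp (eps (x1 - x2)) left by the shift cancels the one coming from the imaginary parts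
    of g1 and g2, so that [mode_phase] is unimodular. *)
Lemma givental_mode s p q :
  cexp ('i * (g1 * x1%:C + g2 * x2%:C + g3 * x3%:C)) *
  givental_shifted eps s (p - lam1 - s) (q - (lam1 + lam2) - s) = mode_integrand s p q.
Proof.
rewrite /givental_shifted /givental_rest /mode_integrand.
have -> : 2^-1 - eps%:C - 'i * (p - lam1 - s)%:C = Ha - 'i * p%:C + 'i * s%:C.
  by rewrite /Ha /g1 !rmorphB; ring: (@ii_m1 R).
have -> : B - eps%:C - 'i * (s + (p - lam1 - s))%:C = 1 + 'i * g3 - 'i * p%:C.
  by rewrite /B /g1 /g3 !(rmorphB, rmorphD); ring: (@ii_m1 R).
have -> : 1 - 'i * (s + (q - (lam1 + lam2) - s))%:C = 1 + 'i * (g1 + g2) - 'i * q%:C.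
  by rewrite /g1 /g2 !(rmorphB, rmorphD); ring.
have -> : A - 'i * (q - (lam1 + lam2) - s)%:C = Hb - 'i * q%:C + 'i * s%:C.
  by rewrite /A /Hb /g1 /g2 /g3 !rmorphB; ring.
have -> : C - 'i * s%:C = Hd - 'i * s%:C by rewrite /C /Hd; ring.
have E : mode_phase p q = cexp ('i * (g1 * x1%:C + g2 * x2%:C + g3 * x3%:C)) *
   cexp ('i * s%:C * (x1 - x3)%:C + 'i * (q - (lam1 + lam2) - s)%:C * (x2 - x3)%:C) *
   cexp ('i * ((p - lam1 - s) * (x1 - x2))%:C + (eps * (x1 - x2))%:C).
  rewrite -!cexpD /mode_phase; congr cexp.
  by rewrite /Sg /g1 /g2 /g3 !(rmorphB, rmorphD, rmorphM); ring: (@ii_m1 R).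
rewrite E.
move: (Gamma _) (Gamma _) (Gamma _) (Gamma _) (Gamma _) (Gamma _) => a b c d e f.
by move: (cexp _) (cexp _) (cexp _) => x y z; ring.
Qed.

Lemma givental_mode_int :
  cexp ('i * (g1 * x1%:C + g2 * x2%:C + g3 * x3%:C)) *
  cint (fun s => cint (fun u => cint (givental_shifted 0 s u))) =
  cint (fun p => cint (mode_fun p)).
Proof.
have half_pos : (0 : R) < 2^-1 by rewrite invr_gt0.
have e0 := givental_shifted_ED3 half_pos; have e1 := givental_shifted_ED3 eps_lt.
have eM := mode_integrand_ED3.
have H := @cint3_shear (givental_shifted eps) mode_integrand
  (cexp ('i * (g1 * x1%:C + g2 * x2%:C + g3 * x3%:C))) lam1 (lam1 + lam2) e1 eM givental_mode.
have S : cint (fun s => cint (fun u => cint (givental_shifted 0 s u))) =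
    cint (fun s => cint (fun u => cint (givental_shifted eps s u))).
  apply: eq_cintegral => s.
  apply: (etrans (ED2_fubini (ED3_fst s e0))); apply: (etrans _ (esym (ED2_fubini (ED3_fst s e1)))).
  by apply: eq_cintegral => t; exact: givental_shift.
exact: (etrans (congr1 (fun z => cexp ('i * (g1 * x1%:C + g2 * x2%:C + g3 * x3%:C)) * z) S) H).
Qed.

Lemma explicit_integrandE s u t :
  cexp ('i * u%:C * (x1 - x2)%:C + 'i * s%:C * (x1 - x3)%:C + 'i * t%:C * (x2 - x3)%:C)
      * Gamma (2^-1 - 'i * u%:C) * Gamma (2^-1 - 'i * s%:C)
      * Gamma (1 - 'i * s%:C - 'i * t%:C)
      * Gamma (- 'i * (g1 - g3 + s%:C + u%:C) + 1)
      * Gamma (- 'i * (g2 - g3 + t%:C) + 2^-1)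
      * Gamma (- 'i * (g1 - g2 + s%:C) + 2^-1) = givental_shifted 0 s u t.
Proof.
rewrite /givental_shifted /givental_rest.
rewrite (_ : 2^-1 - 0%:C - 'i * u%:C = 2^-1 - 'i * u%:C); last by rewrite subr0.
rewrite (_ : B - 0%:C - 'i * (s + u)%:C = - 'i * (g1 - g3 + s%:C + u%:C) + 1); last first.
  by rewrite subr0 /B rmorphD; ring.
rewrite (_ : 1 - 'i * (s + t)%:C = 1 - 'i * s%:C - 'i * t%:C); last by rewrite rmorphD; ring.
rewrite (_ : A - 'i * t%:C = - 'i * (g2 - g3 + t%:C) + 2^-1); last by rewrite /A; ring.
rewrite (_ : C - 'i * s%:C = - 'i * (g1 - g2 + s%:C) + 2^-1); last by rewrite /C; ring.
rewrite (_ : cexp ('i * u%:C * (x1 - x2)%:C + 'i * s%:C * (x1 - x3)%:C + 'i * t%:C * (x2 - x3)%:C) =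
   cexp ('i * s%:C * (x1 - x3)%:C + 'i * t%:C * (x2 - x3)%:C) *
   cexp ('i * (u * (x1 - x2))%:C + (0 * (x1 - x2))%:C)); last first.
  rewrite -cexpD; congr cexp; rewrite mul0r rmorphM /=; ring.
move: (Gamma _) (Gamma _) (Gamma _) (Gamma _) (Gamma _) (Gamma _) => a b c d e f.
by move: (cexp _) (cexp _) => y z; ring.
Qed.

Lemma cint_conj (f : R -> R[i]) : cintble f -> cint (fun x => conjc (f x)) = conjc (cint f).
Proof.
move=> fi; have E := cintegralN fi.
apply: complex_ext; rewrite /cintegral.
  rewrite /= /Rintegral; congr fine; apply: eq_integral => x _; by case: (f x).
have := congr1 (@complex.Im R) E; rewrite /cintegral /= => <-.
rewrite /Rintegral; congr fine; apply: eq_integral => x _; by case: (f x).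
Qed.

Lemma Gamma_conj (z : R[i]) : 0 < Re z -> conjc (Gamma z) = Gamma (conjc z).
Proof.
move=> z0; have z0' : 0 < Re (conjc z) by case: (z) z0.
have o1 : 0 < Re (1 : R[i]) by rewrite /= ltr01.
rewrite (GammaE z0) (GammaE z0') /GI -cint_conj; last exact: ED1_integrable (gexp_ED1 z0 o1).
apply: eq_cintegral => u; rewrite /gexp -cexp_conj; congr cexp.
by apply: complex_ext; case: (z) => a b /=; ring.
Qed.

Lemma norm_GG_sqr : norm_GG * norm_GG = ((2 * pi') ^+ 3)^-1 :> R[i].
Proof.
have p0 : 0 < 2 * pi :> R by rewrite mulr_gt0// pi_gt0.
have E : (2 * pi : R) `^ (3 / 2) * (2 * pi) `^ (3 / 2) = (2 * pi) ^+ 3.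
  rewrite -powRD; last by rewrite (gt_eqF p0) implybT.
  by rewrite -powR_mulrn ?ltW//; congr (_ `^ _); field.
rewrite /norm_GG -rmorphM -invfM E fmorphV rmorphXn /=.
have q2 : (2 * pi)%:C = 2 * pi' by rewrite rmorphM rmorph_nat.
by rewrite q2.
Qed.

Let gnorm : R[i] := cexp ('i * (g1 * x1%:C + g2 * x2%:C + g3 * x3%:C)) * ((2 * pi') ^+ 3)^-1.

Lemma integrand_GGE s u t :
  integrand_GG (phiL g1 g2 g3) (torus_GG g1 g2 g3 x1 x2 x3 phiR) s%:C u%:C t%:C =
  gnorm * givental_shifted 0 s u t.
Proof.
rewrite -explicit_integrandE /integrand_GG /phiL /torus_GG /phiR.
have N : conjc norm_GG = norm_GG :> R[i] by rewrite /norm_GG /= oppr0.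
have cD (x y z w : R[i]) : conjc (x * y * z * w) = conjc x * conjc y * conjc z * conjc w.
  by rewrite !rmorphM.
have cA (z : R[i]) (c : R) : conjc ('i * z + c%:C) = - 'i * conjc z + c%:C.
  by apply: complex_ext; case: z => a b /=; ring.
have half : 2^-1 = (2^-1)%:C :> R[i] by rewrite fmorphV rmorph_nat.
have r1 : conjc ('i * (conjc g1 - conjc g2 + s%:C) + 2^-1) = - 'i * (g1 - g2 + s%:C) + 2^-1.
  by rewrite half cA; congr (_ * _ + _); apply: complex_ext; rewrite /g1 /g2 /=; ring.
have r2 : conjc ('i * (conjc g2 - conjc g3 + t%:C) + 2^-1) = - 'i * (g2 - g3 + t%:C) + 2^-1.
  by rewrite half cA; congr (_ * _ + _); apply: complex_ext; rewrite /g3 /g2 /=; ring.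
have r3 : conjc ('i * (conjc g1 - conjc g3 + s%:C + u%:C) + 1) = - 'i * (g1 - g3 + s%:C + u%:C) + 1.
  by rewrite (cA _ 1); congr (_ * _ + _); apply: complex_ext; rewrite /g1 /g3 /=; ring.
have c0 (z w : R[i]) : conjc z = w -> 0 < Re w -> conjc (Gamma z) = Gamma w.
  by move=> zw h; rewrite Gamma_conj; [rewrite zw|move: h; rewrite -zw; case: (z)].
have p1 : 0 < Re (- 'i * (g1 - g2 + s%:C) + 2^-1).
  rewrite (_ : - 'i * (g1 - g2 + s%:C) + 2^-1 = C - 'i * s%:C); last by rewrite /C; ring.
  by rewrite subiE ReDi; exact: ReC.
have p2 : 0 < Re (- 'i * (g2 - g3 + t%:C) + 2^-1).
  rewrite (_ : - 'i * (g2 - g3 + t%:C) + 2^-1 = A - 'i * t%:C); last by rewrite /A; ring.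
  by rewrite subiE ReDi; exact: ReA.
have p3 : 0 < Re (- 'i * (g1 - g3 + s%:C + u%:C) + 1).
  have half_pos : (0 : R) < 2^-1 by rewrite invr_gt0.
  have h := ReB half_pos; rewrite subr0 in h.
  rewrite (_ : - 'i * (g1 - g3 + s%:C + u%:C) + 1 = B - 'i * (s + u)%:C); last by rewrite /B rmorphD; ring.
  by rewrite subiE ReDi; exact: h.
have q1 := c0 _ _ r1 p1; have q2 := c0 _ _ r2 p2; have q3 := c0 _ _ r3 p3.
have E := cD norm_GG (Gamma ('i * (conjc g1 - conjc g2 + s%:C) + 2^-1))
  (Gamma ('i * (conjc g2 - conjc g3 + t%:C) + 2^-1)) (Gamma ('i * (conjc g1 - conjc g3 + s%:C + u%:C) + 1)).
rewrite N q1 q2 q3 in E; rewrite E.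
have -> : cexp (- (x1%:C * Eh11 g1 s%:C u%:C t%:C + x2%:C * Eh22 g2 s%:C u%:C t%:C + x3%:C * Eh33 g3 s%:C u%:C t%:C))
  = cexp ('i * (g1 * x1%:C + g2 * x2%:C + g3 * x3%:C)) *
    cexp ('i * u%:C * (x1 - x2)%:C + 'i * s%:C * (x1 - x3)%:C + 'i * t%:C * (x2 - x3)%:C).
  rewrite -cexpD /Eh11 /Eh22 /Eh33; congr cexp; rewrite !rmorphB; ring.
rewrite /gnorm -norm_GG_sqr.
move: (Gamma _) (Gamma _) (Gamma _) (Gamma _) (Gamma _) (Gamma _) => a b c d e f.
by move: (cexp _) (cexp _) norm_GG => y z n; ring.
Qed.

Lemma ED3_integral3 (F : fun3 R) (f : R -> R -> R -> R[i]) : ED3 f ->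
  (forall s u t, F s%:C u%:C t%:C = f s u t) ->
  integrable3 F /\ integral3 F = cint (fun s => cint (fun u => cint (f s u))).
Proof.
move=> ef E.
have e : on_R3 F = (fun w : RM * RM * RM => f w.1.1 w.1.2 w.2).
  by apply/funext => w; exact: E.
by rewrite /integrable3 /integral3 e; split; [exact: ED3_integrable|exact: ED3_fubini].
Qed.

Lemma ED3Z (k : R[i]) (f : R -> R -> R -> R[i]) : ED3 f ->
  ED3 (fun x y z => k * f x y z) /\
  cint (fun x => cint (fun y => cint (fun z => k * f x y z))) =
  k * cint (fun x => cint (fun y => cint (f x y))).
Proof.
move=> ef; split.
  have mk : @cmeas R _ (RM * RM * RM)%type (fun=> k) by exact: cmeas_cst.
  have bk : exists K, forall x y z : R, Normc.normc k <= K by exists (Normc.normc k).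
  by apply: ED3_ext (@ED3M_bdd _ f (fun _ _ _ => k) mk bk ef) => x y z; rewrite mulrC.
apply: (etrans _ (cintegralZ k (ED1_integrable (ED2_int (ED3_int ef))))); apply: eq_cintegral => x.
apply: (etrans _ (cintegralZ k (ED1_integrable (ED2_int (ED3_fst x ef))))); apply: eq_cintegral => y.
exact: cintegralZ (ED1_integrable (ED3_fst2 x y ef)).
Qed.

Let givental_ED3 : ED3 (givental_shifted 0).
Proof. by apply: givental_shifted_ED3; rewrite invr_gt0. Qed.

Lemma integrable3_GG :
  integrable3 (integrand_GG (phiL g1 g2 g3) (torus_GG g1 g2 g3 x1 x2 x3 phiR)).
Proof.
have [e _] := ED3Z gnorm givental_ED3.
by have [] := ED3_integral3 e integrand_GGE.
Qed.

Lemma W_GG_modes : W_GG g1 g2 g3 x1 x2 x3 =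
  cexp (- (x1 - x3)%:C) * (((2 * pi') ^+ 3)^-1 * cint (fun p => cint (mode_fun p))).
Proof.
have [e Z] := ED3Z gnorm givental_ED3.
have [_ E] := ED3_integral3 e integrand_GGE.
have M := givental_mode_int.
have aux (a g n I J : R[i]) : a * I = J -> a * n * I = n * J by move=> <-; ring.
have E' := etrans Z (aux _ 0 (((2 * pi') ^+ 3)^-1) _ _ M).
exact: (congr1 (fun z => cexp (- (x1 - x3)%:C) * z) (etrans E E')).
Qed.

Lemma W_GG_explicitE : W_GG g1 g2 g3 x1 x2 x3 = W_GG_explicit g1 g2 g3 x1 x2 x3.
Proof.
have [e Z] := ED3Z gnorm givental_ED3.
have [_ E] := ED3_integral3 e integrand_GGE.
pose F : fun3 R := fun s11 s21 s22 : R[i] =>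
      cexp ('i * s21 * (x1 - x2)%:C + 'i * s11 * (x1 - x3)%:C
            + 'i * s22 * (x2 - x3)%:C)
      * Gamma (2^-1 - 'i * s21) * Gamma (2^-1 - 'i * s11)
      * Gamma (1 - 'i * s11 - 'i * s22)
      * Gamma (- 'i * (g1 - g3 + s11 + s21) + 1)
      * Gamma (- 'i * (g2 - g3 + s22) + 2^-1)
      * Gamma (- 'i * (g1 - g2 + s11) + 2^-1).
have [_ E'] := @ED3_integral3 F _ givental_ED3 explicit_integrandE.
rewrite /W_GG /W_GG_explicit /pairing_GG.
apply: (etrans (congr1 (fun z => cexp (- (x1 - x3)%:C) * z) (etrans E Z))).
apply: (etrans _ (esym (congr1 (fun z => cexp ('i * (g1 * x1%:C + g2 * x2%:C + g3 * x3%:C) - x1%:C + x3%:C)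
  / (2 * pi') ^+ 3 * z) E'))).
have -> : cexp ('i * (g1 * x1%:C + g2 * x2%:C + g3 * x3%:C) - x1%:C + x3%:C) =
  cexp (- (x1 - x3)%:C) * cexp ('i * (g1 * x1%:C + g2 * x2%:C + g3 * x3%:C)).
  by rewrite -cexpD; congr cexp; rewrite rmorphB; ring.
have aux (a b n I : R[i]) : a * (b * n * I) = a * b * n * I by ring.
exact: aux.
Qed.

End Givental.

(** * The Gelfand-Tsetlin integral *)

Section GelfandTsetlin.
Context {R : realType}.
Local Notation RM := (measurableTypeR R).
Implicit Types (p q s t u v a b x y : R).

Lemma GammaN_decay (h : R[i]) : 0 < Re h ->
  exists2 K, 0 <= K &
  forall t, Normc.normc (Gamma (h - 'i * t%:C)) <= K * expR (- (3 / 8 * pi * `|t|)).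
Proof.
move=> h0; have p0 := pi_gt0 R.
have th : (0 : R) <= 3 / 8 * (pi : R) < (pi : R) / 2 by apply/andP; split; lra.
have [K K0 hK] := Gamma_decay h0 th; exists K; first exact: K0.
by move=> t; rewrite subiE -normrN; exact: hK.
Qed.

(** The value of 1 / |Gamma (i y)|^2 from [GammaGamma_inv], in a form whose growth can be
    estimated. *)
Definition plancherel_density y : R := y * (expR (pi * y) - expR (- (pi * y))) / (2 * pi).

(** The exponential grows at rate pi, and a further pi / 8 pays for the linear factor. The total 9
    pi / 8 is divided as 2/8 + 7/8 between two bounds of |y|, because in [gt_kernel_ED3] two
    different groups of Gamma factors have to absorb it. *)
Lemma plancherel_density_le y (D E : R) : `|y| <= D -> `|y| <= E ->
  `|plancherel_density y| <= 8 / pi ^+ 2 * expR (2 / 8 * pi * D + 7 / 8 * pi * E).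
Proof.
move=> yD yE; have p0 := pi_gt0 R.
have h1 : pi / 8 * `|y| <= expR (pi / 8 * `|y|).
  by apply: le_trans (expR_ge1Dx _); rewrite lerDr.
have h2 : `|expR (pi * y) - expR (- (pi * y))| <= 2 * expR (pi * `|y|).
  apply: (le_trans (ler_normB _ _)); rewrite [`|expR (pi * y)|]gtr0_norm ?expR_gt0// [`|expR (- _)|]gtr0_norm ?expR_gt0//.
  rewrite (_ : 2 * _ = expR (pi * `|y|) + expR (pi * `|y|)); last by ring.
  by apply: lerD; rewrite ler_expR -?mulrN ler_pM2l// ?ler_norm// -normrN ler_norm.
have h3 : `|y| <= 8 / pi * expR (pi / 8 * `|y|).
  rewrite -ler_pdivrMl; last by rewrite divr_gt0.
  by rewrite invf_div.
rewrite /plancherel_density normrM normfV normrM [`|2 * pi|]gtr0_norm ?mulr_gt0//.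
rewrite ler_pdivrMr ?mulr_gt0//.
apply: (le_trans (ler_pM (normr_ge0 _) (normr_ge0 _) h3 h2)).
have -> : 8 / pi * expR (pi / 8 * `|y|) * (2 * expR (pi * `|y|)) =
   16 / pi * expR (9 / 8 * pi * `|y|).
  rewrite (_ : 9 / 8 * pi * `|y| = pi / 8 * `|y| + pi * `|y|); last by field.
  by rewrite expRD; ring.
have -> : 8 / pi ^+ 2 * expR (2 / 8 * pi * D + 7 / 8 * pi * E) * (2 * pi) =
   16 / pi * expR (2 / 8 * pi * D + 7 / 8 * pi * E).
  move: (expR _) => e; have pn : pi != 0 :> R by rewrite gt_eqF.
  by move: (pi : R) pn => q qn; field.
rewrite ler_pM2l ?divr_gt0// ler_expR.
have k1 : 2 / 8 * pi * `|y| <= 2 / 8 * pi * D by rewrite ler_pM2l// mulr_gt0//; lra.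
have k2 : 7 / 8 * pi * `|y| <= 7 / 8 * pi * E by rewrite ler_pM2l// mulr_gt0//; lra.
by move: k1 k2; rewrite (_ : 9 / 8 * pi * `|y| = 2 / 8 * pi * `|y| + 7 / 8 * pi * `|y|); [exact: lerD|field].
Qed.

Lemma measurable_plancherel_density : measurable_fun [set: RM] plancherel_density.
Proof. by rewrite /plancherel_density; rmeas. Qed.

Variables g1 g2 g3 : R[i].
Let h1 : R[i] := 2^-1 + 'i * g1.
Let h2 : R[i] := 2^-1 + 'i * g2.
Let h3 : R[i] := 2^-1 + 'i * g3.
Hypotheses (h1_gt0 : 0 < Re h1) (h2_gt0 : 0 < Re h2) (h3_gt0 : 0 < Re h3).

Let Re_half0 : 0 < Re (2^-1 : R[i]).
Proof. by rewrite Re_half invr_gt0. Qed.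

Definition gt_gammas a : R[i] :=
  Gamma (h1 - 'i * a%:C) * Gamma (h2 - 'i * a%:C) * Gamma (h3 - 'i * a%:C).

(* The Gelfand-Tsetlin integrand without the factor (2 pi)^-3 and the phase. *)
Definition gt_kernel p a b : R[i] :=
  Gamma (2^-1 - 'i * (p - a)%:C) * Gamma (2^-1 - 'i * (p - b)%:C) *
  (gt_gammas a * gt_gammas b) * (plancherel_density (a - b))%:C.

Lemma gt_gammas_decay : exists2 K, 0 <= K &
  forall a, Normc.normc (gt_gammas a) <= K * expR (- (9 / 8 * pi * `|a|)).
Proof.
have [K1 K10 k1] := GammaN_decay h1_gt0; have [K2 K20 k2] := GammaN_decay h2_gt0.
have [K3 K30 k3] := GammaN_decay h3_gt0; exists (K1 * K2 * K3); first by rewrite !mulr_ge0.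
have e3 (x y z : R[i]) : Normc.normc (x * y * z) =
    Normc.normc x * Normc.normc y * Normc.normc z by rewrite !Normc.normcM.
have ge z : 0 <= Normc.normc z :> R by exact: normc_ge0.
move=> a; rewrite /gt_gammas e3.
apply: (le_trans (ler_pM (mulr_ge0 (ge _) (ge _)) (ge _) (ler_pM (ge _) (ge _) (k1 a) (k2 a)) (k3 a))).
rewrite le_eqVlt; apply/orP; left; apply/eqP.
have -> : - (9 / 8 * pi * `|a|) = - (3 / 8 * pi * `|a|) - (3 / 8 * pi * `|a|) - (3 / 8 * pi * `|a|).
  by field.
by rewrite !expRD; move: (expR _) => x; ring.
Qed.

(** The factors in p - a and p - b have rate 3/8 (in units of pi) and lose 2/8 to the density; the
    factors in a and b have rate 9/8 and lose 7/8. What remains is 1/8 and 2/8, and as no factor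
    depends on p alone, decay in p follows from 2 |p| <= |p - a| + |p - b| + |a| + |b|. *)
Lemma gt_kernel_ED3 : ED3 gt_kernel.
Proof.
have p0 := pi_gt0 R; have w0 : 0 <= 8 / (pi : R) ^+ 2 by rewrite divr_ge0// exprn_ge0// ltW.
have m1 : measurable_fun [set: RM * RM * RM] (fun p : RM * RM * RM => p.1.1).
  by apply: (measurableT_comp measurable_fst); exact: measurable_fst.
have m2 : measurable_fun [set: RM * RM * RM] (fun p : RM * RM * RM => p.1.2).
  by apply: (measurableT_comp measurable_snd); exact: measurable_fst.
have m3 : measurable_fun [set: RM * RM * RM] (fun p : RM * RM * RM => p.2) by exact: measurable_snd.
split.
  apply: cmeasM; last first.
    by apply: cmeasR; apply: (measurableT_comp measurable_plancherel_density); exact: measurable_funB.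
  apply: cmeasM; first by apply: cmeasM; apply: cmeas_GammaN => //; exact: measurable_funB.
  by apply: cmeasM; apply: cmeasM; [apply: cmeasM| |apply: cmeasM|]; exact: cmeas_GammaN.
have [K K0 hK] := GammaN_decay Re_half0; have [L L0 hL] := gt_gammas_decay.
exists (K * K * (L * L) * (8 / pi ^+ 2)), (pi / 8); split; [|by rewrite divr_gt0|].
  by apply: mulr_ge0 => //; rewrite !mulr_ge0.
have e5 (x y z w : R[i]) (r : R) : Normc.normc (x * y * (z * w) * r%:C) =
    Normc.normc x * Normc.normc y * (Normc.normc z * Normc.normc w) * `|r|.
  by rewrite -normcR !Normc.normcM.
have ge z : 0 <= Normc.normc z :> R by exact: normc_ge0.
move=> p a b; rewrite /gt_kernel e5.
have yD : `|a - b| <= `|p - a| + `|p - b|.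
  by rewrite (_ : a - b = (p - b) - (p - a)) ?(le_trans (ler_normB _ _))// 1?addrC//; ring.
have yE : `|a - b| <= `|a| + `|b| by exact: ler_normB.
apply: (le_trans (ler_pM (mulr_ge0 (mulr_ge0 (ge _) (ge _)) (mulr_ge0 (ge _) (ge _))) (normr_ge0 _)
  (ler_pM (mulr_ge0 (ge _) (ge _)) (mulr_ge0 (ge _) (ge _))
    (ler_pM (ge _) (ge _) (hK _) (hK _)) (ler_pM (ge _) (ge _) (hL _) (hL _)))
  (plancherel_density_le yD yE))).
set Dp := `|p - a|; set Dq := `|p - b|.
have tri : `|p| + `|p| <= Dp + Dq + (`|a| + `|b|).
  rewrite addrACA; apply: lerD.
    by rewrite -{1}(subrK a p) ler_normD.
  by rewrite -{1}(subrK b p) ler_normD.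
have -> : K * expR (- (3 / 8 * pi * Dp)) * (K * expR (- (3 / 8 * pi * Dq))) *
    (L * expR (- (9 / 8 * pi * `|a|)) * (L * expR (- (9 / 8 * pi * `|b|)))) *
    (8 / pi ^+ 2 * expR (2 / 8 * pi * (Dp + Dq) + 7 / 8 * pi * (`|a| + `|b|))) =
  K * K * (L * L) * (8 / pi ^+ 2) *
    expR (- (pi / 8 * (Dp + Dq)) - 2 / 8 * pi * (`|a| + `|b|)).
  have -> : - (pi / 8 * (Dp + Dq)) - 2 / 8 * pi * (`|a| + `|b|) =
    - (3 / 8 * pi * Dp) - (3 / 8 * pi * Dq) - (9 / 8 * pi * `|a|) - (9 / 8 * pi * `|b|) +
    (2 / 8 * pi * (Dp + Dq) + 7 / 8 * pi * (`|a| + `|b|)) by field.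
  rewrite !expRD; move: (pi ^+ 2)^-1 => w.
  by move: (expR _) (expR _) (expR _) (expR _) (expR _) (expR _) => c d e f g h; ring.
apply: ler_wpM2l; first by apply: mulr_ge0 => //; rewrite !mulr_ge0.
rewrite /edec -!expRD ler_expR.
have := ler_wpM2l (ltW (divr_gt0 p0 (ltr0n R 8))) tri.
have := mulr_ge0 (ltW (divr_gt0 p0 (ltr0n R 8))) (normr_ge0 p).
move: (`|p|) (`|a|) (`|b|) Dp Dq {tri} => P X Y Z W.
by move: (pi : R) => q; lra.
Qed.

Lemma gt_kernel_wilson p u v :
  gt_kernel p (u + v) (u - v) =
  wilson_integrand (2^-1 - 'i * (p - u)%:C) (h1 - 'i * u%:C) (h2 - 'i * u%:C) (h3 - 'i * u%:C) v.
Proof.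
rewrite /gt_kernel /wilson_integrand /gamma_quad /gt_gammas /plancherel_density.
have -> : u + v - (u - v) = 2 * v by ring.
rewrite -GammaGamma_inv.
have e1 : 2^-1 - 'i * (p - (u + v))%:C = 2^-1 - 'i * (p - u)%:C + 'i * v%:C.
  by rewrite !(rmorphB, rmorphD); ring.
have e2 : 2^-1 - 'i * (p - (u - v))%:C = 2^-1 - 'i * (p - u)%:C - 'i * v%:C.
  by rewrite !(rmorphB, rmorphD); ring.
have eP (h : R[i]) : h - 'i * (u + v)%:C = h - 'i * u%:C - 'i * v%:C by rewrite rmorphD; ring.
have eM (h : R[i]) : h - 'i * (u - v)%:C = h - 'i * u%:C + 'i * v%:C by rewrite rmorphB; ring.
rewrite e1 e2 !eP !eM.
move: (Gamma ('i * (2 * v)%:C) * Gamma (- ('i * (2 * v)%:C)))^-1 => w.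
move: (Gamma _) (Gamma _) (Gamma _) (Gamma _) (Gamma _) (Gamma _) (Gamma _) (Gamma _) => a b c d e f g h.
by ring.
Qed.

Lemma gt_kernel_int p u :
  Gamma (2 + 'i * (g1 + g2 + g3 - p%:C - (2 * u)%:C)) *
  cint (fun v => gt_kernel p (u + v) (u - v)) =
  (4 * pi)%:C *
  (Gamma (1 + 'i * (g1 - p%:C)) * Gamma (1 + 'i * (g2 - p%:C)) * Gamma (1 + 'i * (g3 - p%:C)) *
   (Gamma (1 + 'i * (g1 + g2 - (2 * u)%:C)) * Gamma (1 + 'i * (g1 + g3 - (2 * u)%:C)) *
    Gamma (1 + 'i * (g2 + g3 - (2 * u)%:C)))).
Proof.
have -> : cint (fun v => gt_kernel p (u + v) (u - v)) =
  cint (wilson_integrand (2^-1 - 'i * (p - u)%:C) (h1 - 'i * u%:C) (h2 - 'i * u%:C) (h3 - 'i * u%:C)).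
  by apply: eq_cintegral => v; exact: gt_kernel_wilson.
have q0 : 0 < Re (2^-1 - 'i * (p - u)%:C : R[i]) by rewrite subiE ReDi.
have q1 : 0 < Re (h1 - 'i * u%:C) by rewrite subiE ReDi.
have q2 : 0 < Re (h2 - 'i * u%:C) by rewrite subiE ReDi.
have q3 : 0 < Re (h3 - 'i * u%:C) by rewrite subiE ReDi.
have E := wilson q0 q1 q2 q3.
have d2 : (2 * u)%:C = 2 * u%:C :> R[i] by rewrite rmorphM rmorph_nat.
have s (x y z w z' : R[i]) : z = z' -> x = y -> Gamma z * x = w -> Gamma z' * y = w by move=> -> ->.
have n2 : (2 : R[i]) != 0 by rewrite pnatr_eq0.
have f0 : 2^-1 - 'i * (p - u)%:C + (h1 - 'i * u%:C) + (h2 - 'i * u%:C) + (h3 - 'i * u%:C) =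
   2 + 'i * (g1 + g2 + g3 - p%:C - (2 * u)%:C).
  by rewrite /h1 /h2 /h3 d2 rmorphB; field.
have fp (g : R[i]) : 2^-1 - 'i * (p - u)%:C + (2^-1 + 'i * g - 'i * u%:C) = 1 + 'i * (g - p%:C).
  by rewrite rmorphB; field.
have fq (g g' : R[i]) : 2^-1 + 'i * g - 'i * u%:C + (2^-1 + 'i * g' - 'i * u%:C) =
   1 + 'i * (g + g' - (2 * u)%:C) by rewrite d2; field.
rewrite f0 /h1 /h2 /h3 !fp !fq in E.
apply: (etrans E).
move: (Gamma _) (Gamma _) (Gamma _) (Gamma _) (Gamma _) (Gamma _) => a b c d e f.
by move: ((4 * pi)%:C) => z; ring.
Qed.

End GelfandTsetlin.

(** * Comparison of the two realizations mode by mode *)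

Section Comparison.
Context {R : realType}.
Local Notation RM := (measurableTypeR R).
Local Notation pi' := (pi%:C : R[i]).
Implicit Types (p q s t u v a b x y : R).

(** The exponential weights of the measure and of the two Whittaker vectors multiply to 1, and
    reality of g1 + g2 + g3 makes the torus factor a unimodular phase. What is left is [gt_kernel]
    in the variables p = t11, a = t21, b = t22. *)
Lemma integrand_GTE (g1 g2 g3 : R[i]) (S x1 x2 x3 p a b : R) : g1 + g2 + g3 = S%:C ->
  integrand_GT psiL (torus_GT g1 g2 g3 x1 x2 x3 (psiR g1 g2 g3)) p%:C a%:C b%:C =
  ((2 * pi') ^+ 3)^-1 *
  (cexp ('i * (p * (x1 - x2) + (a + b) * (x2 - x3) + x3 * S)%:C) * gt_kernel g1 g2 g3 p a b).
Proof.
move=> gS; rewrite /integrand_GT /mu_GT /torus_GT /psiR /psiL /gt_kernel /gt_gammas.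
rewrite prodr_triple !prodr_pair.
have e1 (c : R) : 'i * (c%:C - p%:C) + 2^-1 = 2^-1 - 'i * (p - c)%:C :> R[i].
  by rewrite rmorphB; ring.
have e2 (g : R[i]) (c : R) : 'i * (g - c%:C) + 2^-1 = 2^-1 + 'i * g - 'i * c%:C by ring.
rewrite !e1 !e2.
have f1 : 'i * a%:C - 'i * b%:C = 'i * (a - b)%:C :> R[i] by rewrite rmorphB mulrBr.
have f2 : 'i * b%:C - 'i * a%:C = - ('i * (a - b)%:C) :> R[i] by rewrite rmorphB mulrBr opprB.
rewrite f1 f2 GammaGamma_inv -/(plancherel_density (a - b)).
have -> : conjc (cexp (- (pi' / 2) * (p%:C + a%:C + b%:C))) = cexp (- (pi' / 2) * (p%:C + a%:C + b%:C)).
  rewrite -cexp_conj; congr cexp.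
  have -> : - (pi' / 2) * (p%:C + a%:C + b%:C) = (- (pi / 2) * (p + a + b))%:C.
    by rewrite rmorphM rmorphN fmorph_div rmorph_nat !rmorphD.
  by rewrite /= oppr0.
have X : cexp (- (x1%:C * E11 p%:C a%:C b%:C + x2%:C * E22 p%:C a%:C b%:C
    + x3%:C * E33 g1 g2 g3 p%:C a%:C b%:C)) =
  cexp ('i * (p * (x1 - x2) + (a + b) * (x2 - x3) + x3 * S)%:C).
  by congr cexp; rewrite /E11 /E22 /E33 gS !(rmorphD, rmorphM, rmorphB); ring.
rewrite X.
have Y : cexp (pi' * (a%:C + b%:C)) * cexp (- (pi' / 2) * (p%:C + a%:C + b%:C)) *
   cexp (pi' / 2 * (p%:C - a%:C - b%:C)) = 1.
  rewrite -!cexpD -[RHS]cexp0; congr cexp.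
  by move: pi' => q; field.
have aux (n e d c X1 Y1 G1 G2 H1 H2 H3 H4 H5 H6 : R[i]) : e * c * Y1 = 1 ->
   n * (e * d) * c * (X1 * (Y1 * (G1 * G2) * (H1 * H2 * (H3 * H4 * (H5 * H6))))) =
   n * (X1 * (G1 * G2 * (H1 * H3 * H5 * (H2 * H4 * H6)) * d)).
  move=> E; transitivity (e * c * Y1 * (n * (X1 * (G1 * G2 * (H1 * H3 * H5 * (H2 * H4 * H6)) * d)))).
    by ring.
  by rewrite E mul1r.
exact: aux Y.
Qed.

Variables (lam1 lam2 lam3 eps x1 x2 x3 : R).
Hypothesis eps_gt0 : 0 < eps.
Hypothesis eps_lt : eps < 2^-1.
Let g1 : R[i] := lam1%:C + 'i * eps%:C.
Let g2 : R[i] := lam2%:C - 'i * eps%:C.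
Let g3 : R[i] := lam3%:C.
Let Sg := lam1 + lam2 + lam3.
Let phase := mode_phase lam1 lam2 lam3 x1 x2 x3.
Let mode := mode_fun lam1 lam2 lam3 eps x1 x2 x3.

Let h1_gt0 : 0 < Re (2^-1 + 'i * g1).
Proof.
rewrite cReD Re_ii Re_half /g1 !reimE /=.
by rewrite (_ : _ + _ = 2^-1 - eps) ?subr_gt0//; ring.
Qed.

Let h2_gt0 : 0 < Re (2^-1 + 'i * g2).
Proof.
rewrite cReD Re_ii Re_half /g2 !reimE /=.
have : (0 : R) < 2^-1 + eps by rewrite addr_gt0// invr_gt0.
by move=> h; rewrite (_ : _ + _ = 2^-1 + eps)//; ring.
Qed.

Let h3_gt0 : 0 < Re (2^-1 + 'i * g3).
Proof. by rewrite cReD Re_ii Re_half /g3 /= oppr0 addr0 invr_gt0. Qed.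

Let gK := gt_kernel g1 g2 g3.
Let F p a b : R[i] := phase p (a + b) * gK p a b.

Let F_ED3 : ED3 F.
Proof.
have m1 : measurable_fun [set: RM * RM * RM] (fun p : RM * RM * RM => p.1.1).
  by apply: (measurableT_comp measurable_fst); exact: measurable_fst.
have m2 : measurable_fun [set: RM * RM * RM] (fun p : RM * RM * RM => p.1.2).
  by apply: (measurableT_comp measurable_snd); exact: measurable_fst.
have m3 : measurable_fun [set: RM * RM * RM] (fun p : RM * RM * RM => p.2) by exact: measurable_snd.
have mP : @cmeas R _ (RM * RM * RM)%type (fun w => phase w.1.1 (w.1.2 + w.2)).
  by apply: cmeas_cexp; cmeas.
have bP : exists K, forall p a b : R, Normc.normc (phase p (a + b)) <= K.
  by exists 1 => p a b; rewrite /phase /mode_phase normc_wave.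
by apply: ED3_ext (ED3M_bdd mP bP (gt_kernel_ED3 h1_gt0 h2_gt0 h3_gt0)) => p a b; rewrite mulrC.
Qed.

Let gS : g1 + g2 + g3 = Sg%:C.
Proof. by rewrite /g1 /g2 /g3 /Sg !rmorphD; ring. Qed.

Lemma integrable3_GT :
  integrable3 (integrand_GT psiL (torus_GT g1 g2 g3 x1 x2 x3 (psiR g1 g2 g3))).
Proof.
have [e _] := ED3Z ((2 * pi') ^+ 3)^-1 F_ED3.
by have [] := ED3_integral3 e (fun p a b => integrand_GTE x1 x2 x3 p a b gS).
Qed.

(* Both sides are Gamma quotients, by Wilson's integral on the left and Barnes'
   first lemma on the right. *)
Lemma gt_mode p u : cint (fun v => F p (u + v) (u - v)) = 2 * mode p (2 * u).
Proof.
have i : cintble (fun v => gK p (u + v) (u - v)).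
  apply: cintble_ext (ED1_integrable (proj1 (wilson_integrand_ED1 _ _ _ _)))=> [v||||].
  - by rewrite /gK gt_kernel_wilson.
  - by rewrite subiE ReDi Re_half invr_gt0.
  - by rewrite subiE ReDi.
  - by rewrite subiE ReDi.
  - by rewrite subiE ReDi.
have -> : cint (fun v => F p (u + v) (u - v)) = phase p (2 * u) * cint (fun v => gK p (u + v) (u - v)).
  rewrite -(cintegralZ _ i); apply: eq_cintegral => v.
  by rewrite /F; congr (phase _ _ * _); ring.
have E1 := gt_kernel_int h1_gt0 h2_gt0 h3_gt0 p u.
have E2 := mode_funE lam1 lam2 lam3 x1 x2 x3 eps_gt0 eps_lt p (2 * u).
have gE : 2 + 'i * (g1 + g2 + g3 - p%:C - (2 * u)%:C) = 2 + 'i * (Sg - p - 2 * u)%:C.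
  by rewrite gS !rmorphB.
rewrite gE in E1.
have G0 : Gamma (2 + 'i * (Sg - p - 2 * u)%:C) != 0.
  by apply: Gamma_neq0; rewrite ReDi /= addr_gt0 ?ltr01.
have q2 : (2 * pi)%:C = 2 * pi' by rewrite rmorphM rmorph_nat.
have q4 : (4 * pi)%:C = 4 * pi' by rewrite rmorphM rmorph_nat.
have aux (G I M P x a b c : R[i]) : G != 0 -> a = 2 * c -> b = 4 * c ->
    G * I = b * x -> G * M = P * a * x -> P * I = 2 * M.
  move=> G1 -> -> e1 e2; apply: (mulfI G1).
  transitivity (P * (G * I)); first by ring.
  rewrite e1; transitivity (2 * (G * M)); last by ring.
  by rewrite e2; ring.
exact: aux G0 q2 q4 E1 E2.
Qed.

Lemma integral3_GT :
  integral3 (integrand_GT psiL (torus_GT g1 g2 g3 x1 x2 x3 (psiR g1 g2 g3))) =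
  2 * (((2 * pi') ^+ 3)^-1 * cint (fun p => cint (mode p))).
Proof.
have [e Z] := ED3Z ((2 * pi') ^+ 3)^-1 F_ED3.
have [_ E] := ED3_integral3 e (fun p a b => integrand_GTE x1 x2 x3 p a b gS).
have mE : ED2 mode.
  exact: ED3_int (ED3_perm132 (ED3_perm213 (mode_integrand_ED3 lam1 lam2 lam3 x1 x2 x3 eps_gt0 eps_lt))).
have H : cint (fun p => cint (fun a => cint (F p a))) = 2 * cint (fun p => cint (mode p)).
  apply: (etrans _ (cintegralZ 2 (ED1_integrable (ED2_int mE)))); apply: eq_cintegral => p.
  (* The Jacobian 2 introduced here is undone by q = 2 u in [cint_double]. The 2 that survives is
     the one of [gt_mode], which the factor 1/2! of [pairing_GT] removes. *)
  apply: (etrans (cint_sumdiff (ED3_fst p F_ED3))).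
  have D : cint (fun u => cint (fun v => F p (u + v) (u - v))) = cint (mode p).
    have i : cintble (mode p) := ED1_integrable (ED2_fst p mE).
    have i2 : cintble (fun u => mode p (2 * u + 0)).
      by apply: cintble_affine => //; rewrite pnatr_eq0.
    have n2 : (2 : R[i]) != 0 by rewrite pnatr_eq0.
    have K (I J : R[i]) : J = 2^-1 * I -> 2 * J = I by move=> ->; rewrite mulrA divff// mul1r.
    apply: (etrans _ (K _ _ (cint_double i))).
    apply: (etrans _ (cintegralZ 2 i2)); apply: eq_cintegral => u.
    by rewrite addr0; exact: gt_mode.
  exact: (congr1 (fun z => 2 * z) D).
have K (n I J : R[i]) : I = 2 * J -> n * I = 2 * (n * J) by move=> ->; ring.
exact: (etrans E (etrans Z (K _ _ _ H))).
Qed.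

Lemma W_GT_GG : W_GT g1 g2 g3 x1 x2 x3 = W_GG g1 g2 g3 x1 x2 x3.
Proof.
have M := W_GG_modes lam1 lam2 lam3 x1 x2 x3 eps_gt0 eps_lt.
apply: (etrans _ (esym M)); rewrite /W_GT /pairing_GT /rho.
have n2 : (2`!%:R : R[i]) != 0 by rewrite pnatr_eq0.
have K (c I J : R[i]) : I = 2 * J -> c * ((2`!)%:R^-1 * I) = c * J.
  by move=> ->; rewrite [_^-1 * _]mulrA mulVf ?mul1r// pnatr_eq0.
exact: K integral3_GT.
Qed.

End Comparison.

Theorem theorem4p1 (R : realType) (lam1 lam2 lam3 eps kappa : R)
    (eps_gt0 : 0 < eps) (eps_lt : eps < 2^-1)
    (kappa_gt0 : 0 < kappa) (kappa_lt : kappa < 2^-1) :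
  let g1 : R[i] := lam1%:C + 'i * eps%:C in
  let g2 : R[i] := lam2%:C - 'i * eps%:C in
  let g3 : R[i] := lam3%:C in
  (* transformation of the right Whittaker vector *)
  (kappa + eps < 2^-1 -> forall t11 t21 t22 : R,
     B_R g1 g2 g3 kappa phiR t11%:C t21%:C t22%:C
     = half_density t11%:C t21%:C t22%:C
       * psiR g1 g2 g3 (t11%:C - 'i * kappa%:C) t21%:C t22%:C) /\
  (* transformation of the left Whittaker vector *)
  (forall t11 t21 t22 : R,
     B_L g1 g2 g3 kappa (phiL g1 g2 g3) t11%:C t21%:C t22%:C
     = half_density t11%:C t21%:C t22%:C
       * psiL (t11%:C - 'i * kappa%:C) t21%:C t22%:C) /\
  (* both integral forms converge absolutely, and they agree *)
  (forall x1 x2 x3 : R,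
     [/\ integrable3
           (integrand_GT psiL (torus_GT g1 g2 g3 x1 x2 x3 (psiR g1 g2 g3))),
         integrable3
           (integrand_GG (phiL g1 g2 g3) (torus_GG g1 g2 g3 x1 x2 x3 phiR)),
         W_GG g1 g2 g3 x1 x2 x3 = W_GG_explicit g1 g2 g3 x1 x2 x3 &
         W_GT g1 g2 g3 x1 x2 x3 = W_GG g1 g2 g3 x1 x2 x3]).

Proof.
move=> g1 g2 g3.
have im1 : Im g1 = eps by rewrite /g1 !reimE /=; ring.
have im2 : Im g2 = - eps by rewrite /g2 !reimE /=; ring.
split; last split.
(* Since Im g1 = eps, the condition kappa + eps < 1/2 is positivity of the Barnes parameter 1/2 -
   kappa - eps; the parameter of g2 is then positive as well, because Im g2 = - eps. *)
- move=> ke t11 t21 t22; apply: B_R_phiR => //.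
    by rewrite im1 addrC.
  by rewrite im2; apply: lt_trans ke; rewrite addrC ltrD2l; lra.
- move=> t11 t21 t22; apply: B_L_phiL => //.
    by rewrite im2; lra.
  by rewrite /g3 /= oppr0.
- move=> x1 x2 x3; split.
  + exact: integrable3_GT.
  + exact: integrable3_GG.
  + exact: W_GG_explicitE.
  + exact: W_GT_GG.
Qed.
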